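(* Let $G$ be a benzenoid system with boundary cycle $Z$, and let $|Z|$ denote the number of vertices of $Z$. Then the edge-Szeged index $Sz_e(G)$ can be computed in $O(|Z|)$ time.
   Context: Let $\mathcal H$ be the hexagonal (graphite) lattice in the plane and $Z$ a cycle in it. The benzenoid system determined by $Z$ is the graph $G$ induced by the vertices and edges of $\mathcal H$ lying on $Z$ and in its interior; $Z$ is called its boundary cycle. The input to the computation is the boundary cycle $Z$ (the cyclic sequence of its vertices in the plane). $d_G$ is the shortest-path distance; for a vertex $x$ and edge $f=ab$, $d_G(x,f)=\min\{d_G(x,a),d_G(x,b)\}$. For an edge $e=uv$ of $G$, let $M_1(e|G)=\{f\in E(G): d_G(f,u)<d_G(f,v)\}$ and $M_2(e|G)=\{f\in E(G): d_G(f,v)<d_G(f,u)\}$, where $d_G(f,u)$ means $d_G(u,f)$. The edge-Szeged index is $Sz_e(G)=\sum_{e\in E(G)}|M_1(e|G)|\cdot|M_2(e|G)|$. *)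

(* Defs.v *)
From HB Require Import structures.
From mathcomp Require Import all_boot all_order all_algebra.
From mathcomp Require Import finmap.
From mathcomp Require Import all_classical all_reals all_analysis.

Set Implicit Arguments.
Unset Strict Implicit.
Unset Printing Implicit Defensive.

Import Order.TTheory GRing.Theory Num.Theory numFieldNormedType.Exports.

Local Open Scope fset_scope.
Local Open Scope classical_set_scope.
Local Open Scope ring_scope.

(* A finite graph is given by its edge set, every edge being listed once, in
   one of its two orientations.  Isolated vertices are irrelevant to Sz_e. *)
Section EdgeSzeged.
Variables (V : choiceType) (E : {fset V * V}).

Definition gadj : rel V := [rel u v | ((u, v) \in E) || ((v, u) \in E)].

Definition walk (u v : V) (n : nat) : Prop :=
  exists p : seq V, [/\ path gadj u p, last u p = v & size p = n].

(* 0 by convention when u and v are not connected. *)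
Definition gdist (u v : V) : nat :=
  xget 0%N [set n | walk u v n /\ forall m, walk u v m -> (n <= m)%N].

Definition edist (x : V) (f : V * V) : nat := minn (gdist x f.1) (gdist x f.2).

Definition M1 (e : V * V) : {fset V * V} :=
  [fset f in E | (edist e.1 f < edist e.2 f)%N].

Definition M2 (e : V * V) : {fset V * V} :=
  [fset f in E | (edist e.2 f < edist e.1 f)%N].

(* The summand is invariant under reversing the orientation of e. *)
Definition Sz_e : nat := \sum_(e <- E) (#|` M1 e| * #|` M2 e|)%N.

End EdgeSzeged.

(* Vertices of the hexagonal lattice are indexed by Z^2: row y is the zigzag
   ... - (x, y) - (x + 1, y) - ..., and (x, y) is joined to (x, y + 1) exactly
   when x + y is even.  The geometric realization is [pos] below. *)
Definition vertex : Type := (int * int)%type.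

Definition even_vertex (v : vertex) : bool := ~~ odd `|(v.1 + v.2)%R|%N.

(* Edges are oriented from their even to their odd endpoint. *)
Definition hex_edge (e : vertex * vertex) : bool :=
  even_vertex e.1 &&
  (e.2 \in [:: (e.1.1 - 1, e.1.2); (e.1.1 + 1, e.1.2); (e.1.1, e.1.2 + 1)]).

Definition hex_adj : rel vertex := [rel u v | hex_edge (u, v) || hex_edge (v, u)].

(* The size condition excludes the empty sequence and an edge traversed back
   and forth. *)
Definition hex_cycle (z : seq vertex) : bool := (2 < size z)%N && ucycleb hex_adj z.

Section Benzenoid.
Variable R : realType.

(* Regular hexagons with sides of length 1. *)
Definition pos (v : vertex) : R * R :=
  (Num.sqrt 3 / 2 * v.1%:~R,
   3 / 2 * v.2%:~R + (if even_vertex v then 1 / 4 else - (1 / 4))).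

Definition segment (u v : vertex) : set (R * R) :=
  [set (1 - t) *: pos u + t *: pos v | t in `[0, 1]].

Definition curve (z : seq vertex) : set (R * R) :=
  \bigcup_(u in [set` z]) segment u (next z u).

Definition inside (z : seq vertex) : set (R * R) :=
  [set p | (~` curve z) p /\ bounded_set (connected_component (~` curve z) p)].

(* The edges on z or in its interior; there are finitely many of them, so that
   [fset_set] does not default to the empty set.  The vertices on z or in its
   interior are the endpoints of these edges. *)
Definition benzenoid (z : seq vertex) : {fset vertex * vertex} :=
  fset_set [set e | hex_edge e /\ segment e.1 e.2 `<=` curve z `|` inside z].

End Benzenoid.

(* A word RAM with structured control flow.  Every elementary operation and
   every test takes one unit of time; compiling to jumps costs a constant factor. *)
Inductive cmd : Type :=
| Skip
| Const of nat & int            (* r := c *)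
| Copy of nat & nat             (* r := s *)
| Add of nat & nat & nat        (* r := s + t *)
| Sub of nat & nat & nat        (* r := s - t *)
| Mul of nat & nat & nat        (* r := s * t *)
| Read of nat & nat             (* r := cell[s] *)
| Write of nat & nat            (* cell[r] := s *)
| Seq of cmd & cmd
| IfLe of nat & nat & cmd & cmd (* if r <= s then .. else .. *)
| WhileLe of nat & nat & cmd.   (* while r <= s do .. *)

Record state : Type := State { reg : nat -> int; cell : nat -> int }.

Definition set_reg (s : state) (r : nat) (v : int) : state :=
  State [eta reg s with r |-> v] (cell s).

Definition set_cell (s : state) (a : nat) (v : int) : state :=
  State (reg s) [eta cell s with a |-> v].

(* [exec B p s s' t]: run from s, the program p halts in s' after t units of
   time and no word it writes exceeds B in absolute value.  There is no rule for
   an overflow or a negative address: such a run does not count as halting. *)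
Inductive exec (B : nat) : cmd -> state -> state -> nat -> Prop :=
| ExecSkip s : exec B Skip s s 1
| ExecConst s r c : (`|c| <= B)%N ->
    exec B (Const r c) s (set_reg s r c) 1
| ExecCopy s r i :
    exec B (Copy r i) s (set_reg s r (reg s i)) 1
| ExecAdd s r i j : (`|(reg s i + reg s j)%R| <= B)%N ->
    exec B (Add r i j) s (set_reg s r (reg s i + reg s j)) 1
| ExecSub s r i j : (`|(reg s i - reg s j)%R| <= B)%N ->
    exec B (Sub r i j) s (set_reg s r (reg s i - reg s j)) 1
| ExecMul s r i j : (`|(reg s i * reg s j)%R| <= B)%N ->
    exec B (Mul r i j) s (set_reg s r (reg s i * reg s j)) 1
| ExecRead s r i (a : nat) : reg s i = a%:Z ->
    exec B (Read r i) s (set_reg s r (cell s a)) 1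
| ExecWrite s r i (a : nat) : reg s r = a%:Z ->
    exec B (Write r i) s (set_cell s a (reg s i)) 1
| ExecSeq p q s1 s2 s3 t u : exec B p s1 s2 t -> exec B q s2 s3 u ->
    exec B (Seq p q) s1 s3 (t + u)%N
| ExecIfTrue r i p q s s' t : reg s r <= reg s i -> exec B p s s' t ->
    exec B (IfLe r i p q) s s' t.+1
| ExecIfFalse r i p q s s' t : reg s i < reg s r -> exec B q s s' t ->
    exec B (IfLe r i p q) s s' t.+1
| ExecWhileTrue r i p s1 s2 s3 t u : reg s1 r <= reg s1 i ->
    exec B p s1 s2 t -> exec B (WhileLe r i p) s2 s3 u ->
    exec B (WhileLe r i p) s1 s3 (t + u).+1%N
| ExecWhileFalse r i p s : reg s i < reg s r ->
    exec B (WhileLe r i p) s s 1.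

(* The input x_0, y_0, x_1, y_1, ... is stored from address 0 on, and its number
   of vertices is in register 0; everything else is 0. *)
Definition input_state (z : seq vertex) : state :=
  State (fun r => if r == 0%N then (size z)%:Z else 0)
        (fun a => nth 0 (flatten [seq [:: v.1; v.2] | v <- z]) a).

(* Words have k * log N bits, where N bounds the length of the input and the
   numbers occurring in it (so that every input number fits in a word). *)
Definition word_bound (k : nat) (z : seq vertex) : nat :=
  ((size z + \max_(v <- z) maxn `|v.1| `|v.2|) ^ k)%N.

Definition output (s : state) : int := reg s 0%N.

(* Main.v *)
(* The edges of G fall into runs: maximal rows of parallel edges, of which
   exactly the first and the last lie on Z.  The edges of a run form a cut of G,
   and for an edge e of the run the sets M_1(e), M_2(e) consist of the edges on
   the two sides of the cut.  A run thus contributes (r + 1) m_1 m_2, where r + 1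
   is its number of edges and m_1, m_2 are the numbers of edges of the sides.
   The two ends of the run divide Z into two arcs, each bounding one side
   together with the run.  The number of edges of a side is determined by its
   number of hexagons and the length of its arc, and by the discrete Green
   formula its number of hexagons is a difference of prefix sums over Z.  It
   remains to find the pairs of steps of Z which are the ends of a run: they are
   consecutive in their row, and are found by sorting the steps of every
   direction by their position, in linear time since positions are bounded by
   the length of Z. *)

(* Instead of the topological interior the proof works with a combinatorial winding number of the
   cycle around the centres of hexagons, which counts signed crossings with a ray. That it takes
   only the value 0 and one of 1, -1 follows from its jumps across edges and from walks along both
   sides of the cycle; only at the end are the hexagons of nonzero winding number shown to make up
   the bounded part of the complement of the curve. The delicate point is that a run is a cut: no
   walk of [G] may pass from one side to the other around an end of the run. A closed walk of [G]
   has winding number 0 around every outside hexagon, and its signed crossings of a run are a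
   difference of two such numbers. The machine cannot divide, although the count of a side involves
   half the length of an arc. The ends of a run are traversed in opposite directions, so the arc
   strictly between them has an even number of steps, and half of these start at a vertex of colour
   0: counting such steps replaces the division. *)
Require Import Defs.
From mathcomp Require Import all_boot all_order all_algebra.
From mathcomp Require Import finmap zify ring lra.
From mathcomp Require Import all_classical.

Set Implicit Arguments.
Unset Strict Implicit.
Unset Printing Implicit Defensive.

Import Order.TTheory GRing.Theory Num.Theory.

Local Open Scope ring_scope.

(** * Winding numbers on the hexagonal lattice *)

(* Axial coordinates on the triangular lattice: the colours 0 and 1 are the two
   classes of vertices of the hexagonal lattice, and the points of colour 2 are
   the centres of its hexagons.  An edge of direction [t] joins [a], of colour
   0, to [sh t a], of colour 1; the hexagons on its two sides have the centres
   [Lf t a] and [Rf t a]. *)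
Definition pt : Type := (int * int)%type.

Variant dir := T0 | T1 | T2.

Definition nx t := match t with T0 => T1 | T1 => T2 | T2 => T0 end.

Definition du t : int := match t with T0 => 1 | T1 => -1 | T2 => 0 end.
Definition dv t : int := match t with T0 => 0 | T1 => 1 | T2 => -1 end.

Definition sh t (p : pt) : pt := (p.1 + du t, p.2 + dv t).
Definition us t (p : pt) : pt := (p.1 - du t, p.2 - dv t).

Definition col (p : pt) : int := ((p.1 - p.2) %% 3)%Z.

Definition up_step t (x y : pt) : bool := (col x == 0) && (y == sh t x).
Definition hstep (x y : pt) : bool :=
  [|| up_step T0 x y, up_step T1 x y, up_step T2 x y,
      up_step T0 y x, up_step T1 y x | up_step T2 y x].

Definition Lf t a := us (nx t) a.
Definition Rf t a := us (nx (nx t)) a.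

Notation ib b := (Posz (nat_of_bool b)).

Definition stepf t a (x y : pt) : int :=
  ib ((x == a) && (y == sh t a)) - ib ((x == sh t a) && (y == a)).

(** The ray keeps [2 * p.1 + p.2] constant while the second coordinate grows. It passes through the
    midpoints of edges of direction [T0] and through no vertex, so crossings need no
    perturbation. *)
Definition ray_side (f a : pt) : bool :=
  (a.1 * 2 + a.2 + 1 == f.1 * 2 + f.2) && (f.2 < a.2).

(* Signed crossing of a step with a ray from [f]; summed over [z] it gives the
   winding number of [z] around [f]. *)
Definition ray_cross f (x y : pt) : int :=
  ib ((y == sh T0 x) && ray_side f x) - ib ((x == sh T0 y) && ray_side f y).

Definition same_zigzag (a b : pt) : bool :=
  (b.1 * 2 + b.2 == a.1 * 2 + a.2) || (b.1 * 2 + b.2 == a.1 * 2 + a.2 - 1).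

(** The rays from [Lf T0 a] and [Rf T0 a] are nested and differ by the crossing of the edge at [a]
    alone. For [T1] and [T2] the two rays are parallel and the zigzag of vertices through [a] runs
    between them; the value is the signed indicator of the part of this zigzag that starts at the
    right end of the edge. It makes the difference of the crossing numbers exact, up to the edge
    itself. *)
Definition ray_pot t a (b : pt) : int :=
  match t with
  | T0 => 0
  | T1 => - ib (same_zigzag a b && (a.2 < b.2))
  | T2 => ib (same_zigzag a b && (a.2 <= b.2))
  end.

Lemma pt_eqE (a b c d : int) : ((a, b) == (c, d) :> pt) = (a == c) && (b == d).
Proof. by []. Qed.

Lemma sh_us t p : sh t (us t p) = p.
Proof. by case: p => u v; rewrite /sh /us /= !subrK. Qed.
Lemma us_sh t p : us t (sh t p) = p.
Proof. by case: p => u v; rewrite /sh /us /= !addrK. Qed.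

Lemma hstepP x y : reflect (exists t, up_step t x y \/ up_step t y x) (hstep x y).
Proof.
apply: (iffP idP).
  by rewrite /hstep; do 5?[case/orP; first by [exists T0; auto|exists T1; auto|exists T2; auto]]; exists T2; auto.
rewrite /hstep; by case=> -[] [] ->; rewrite ?orbT.
Qed.

Lemma crfC f x y : ray_cross f x y = - ray_cross f y x.
Proof. by rewrite /ray_cross opprB. Qed.
Lemma stepfC t a x y : stepf t a x y = - stepf t a y x.
Proof. by rewrite /stepf opprB (andbC (x == a)) (andbC (x == sh t a)). Qed.

Lemma step_flow t a x y : col a = 0 -> hstep x y ->
  ray_cross (Lf t a) x y - ray_cross (Rf t a) x y - stepf t a x y = ray_pot t a y - ray_pot t a x.
Proof.
move=> ca /hstepP[t' H].
case: a ca => a1 a2; rewrite /col /= => ca.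
wlog: x y t' H / up_step t' x y => [W|].
  case: H => H; first by apply: (W x y t') => //; left.
  move: (W y x t' (or_introl H) H); rewrite ![ray_cross _ y x]crfC [stepf _ _ y x]stepfC; lia.
case/andP; case: x {H} => x1 x2; rewrite /col /= => cx /eqP->.
by case: t t' => -[]; rewrite /ray_cross /stepf /ray_pot /same_zigzag /ray_side /Lf /Rf /sh /us /du /dv /= !pt_eqE; lia.
Qed.

Fixpoint wsum (T : Type) (g : T -> T -> int) x l : int :=
  if l is y :: l' then g x y + wsum g y l' else 0.

Lemma wsum_cat T (g : T -> T -> int) x l1 l2 :
  wsum g x (l1 ++ l2) = wsum g x l1 + wsum g (last x l1) l2.
Proof. by elim: l1 x => [|y l IH] x /=; rewrite ?add0r // IH addrA. Qed.

Lemma wsum_flow t a x l : col a = 0 -> path hstep x l ->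
  wsum (ray_cross (Lf t a)) x l - wsum (ray_cross (Rf t a)) x l - wsum (stepf t a) x l
  = ray_pot t a (last x l) - ray_pot t a x.
Proof.
move=> ca; elim: l x => [|y l IH] x /=; first by move=> _; lia.
by case/andP=> /(step_flow t ca) H /IH; lia.
Qed.

Lemma wsum_far_right (f x : pt) l : all (fun a : pt => a.2 <= f.2) (x :: l) ->
  wsum (ray_cross f) x l = 0.
Proof.
elim: l x => //= y l IH x /and3P[hx hy hl].
rewrite IH /= ?hy //; rewrite /ray_cross /ray_side; lia.
Qed.

(** To the right of [f] the ray cannot be told from the full line, so a crossing is a change of
    side, and these telescope along a path. Together with [wsum_far_right] this confines the faces
    of nonzero winding number to a box. *)
Lemma ray_cross_above f x y : col f = 2 -> hstep x y -> f.2 < x.2 -> f.2 < y.2 ->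
  ray_cross f x y = ib (f.1 * 2 + f.2 < y.1 * 2 + y.2) - ib (f.1 * 2 + f.2 < x.1 * 2 + x.2).
Proof.
move=> cf /hstepP[t H]; case: f cf => f1 f2; rewrite /col /= => cf.
wlog: x y H / up_step t x y => [W|].
  case: H => H; first by apply: W => //; left.
  by move=> h1 h2; move: (W y x (or_introl H) H h2 h1); rewrite /ray_cross; lia.
case/andP; case: x {H} => x1 x2; rewrite /col /= => cx /eqP->.
by case: t; rewrite /ray_cross /ray_side /sh /du /dv /= !pt_eqE; lia.
Qed.

Lemma wsum_far_left f x l : col f = 2 -> path hstep x l ->
  all (fun a : pt => f.2 < a.2) (x :: l) ->
  wsum (ray_cross f) x l = ib (f.1 * 2 + f.2 < (last x l).1 * 2 + (last x l).2)
                     - ib (f.1 * 2 + f.2 < x.1 * 2 + x.2).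
Proof.
move=> cf; elim: l x => [|y l IH] x; first by move=> *; rewrite subrr.
rewrite [path _ _ _]/= => /andP[hs hp] /= /andP[hx ha].
rewrite IH // (ray_cross_above cf hs) //; first lia.
by case/andP: ha.
Qed.

Lemma wsum_neq0 (f x : pt) l : wsum (ray_cross f) x l != 0 ->
  exists2 a, a \in x :: l & ray_side f a.
Proof.
elim: l x => //= y l IH x H.
have [h|/IH[a al ha]] := eqVneq (wsum (ray_cross f) y l) 0; last first.
  by exists a => //; rewrite inE al orbT.
have : ray_cross f x y != 0 by move: H; rewrite h addr0.
rewrite /ray_cross; have [hx _|hx] := boolP (ray_side f x); first by exists x => //; rewrite mem_head.
have [hy _|hy] := boolP (ray_side f y); last by rewrite !andbF.
by exists y => //; rewrite !inE eqxx orbT.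
Qed.

Definition in_box (M : int) (p : pt) := (`|p.1| <= M) && (`|p.2| <= M).

Lemma in_box_ex (l : seq pt) : exists M, all (in_box M) l.
Proof.
elim: l => [|a l [M IH]]; first by exists 0.
exists (`|a.1| + `|a.2| + `|M|) => /=; apply/andP; split; first by rewrite /in_box; lia.
by apply: sub_all IH => b; rewrite /in_box; lia.
Qed.

Lemma wsum_bounded x l : path hstep x l -> last x l = x ->
  exists M : int, forall f, col f = 2 -> wsum (ray_cross f) x l != 0 -> in_box M f.
Proof.
move=> hp hl; have [M hM] := in_box_ex (x :: l).
exists (3 * M + 3) => f cf h; have [a al ha] := wsum_neq0 h.
have bM := allP hM.
have f2M : f.2 <= M.
  by move: ha (bM _ al); rewrite /ray_side /in_box; lia.
have Mf : - M <= f.2.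
  rewrite leNgt; apply/negP => lt; move/eqP: h; apply.
  rewrite wsum_far_left // ?hl ?subrr //.
  by apply: sub_all hM => b; rewrite /in_box; lia.
by move: ha (bM _ al); rewrite /ray_side /in_box; lia.
Qed.

Section Cycle.
Variable z : seq pt.
Hypotheses (z2 : (2 < size z)%N) (zU : uniq z) (zC : cycle hstep z).

Notation nz := (next z).

Lemma sum_next (g : pt -> pt -> int) x p : z = x :: p ->
  \sum_(u <- z) g u (nz u) = wsum g x (rcons p x).
Proof.
have winding l : forall y, wsum g y l = \sum_(i < size l) g (nth y (y :: l) i) (nth y l i).
  elim: l => [|y l IH] y0 /=; first by rewrite big_ord0.
  rewrite big_ord_recl /= IH; congr (_ + _); apply: eq_bigr => i _.
  have hi := ltn_ord i.
  by rewrite /= (set_nth_default y0) ?(@set_nth_default _ l y0 y) //= ltnS ltnW.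
move=> zE; rewrite winding -(big_mkord predT (fun i => g (nth x (x :: rcons p x) i) (nth x (rcons p x) i))).
have -> : size (rcons p x) = size z by rewrite zE size_rcons.
rewrite (big_nth x) big_seq [RHS]big_seq; apply: eq_bigr => i.
rewrite mem_index_iota => /andP[_ hi]; have hi' := hi; rewrite zE /= in hi'.
congr g; first by rewrite -rcons_cons -zE nth_rcons hi.
by rewrite next_nth mem_nth // {1}zE index_uniq // nth_rcons_default.
Qed.

Lemma next2 u : u \in z -> nz (nz u) != u.
Proof.
case/rot_to=> i p E; rewrite -[X in X != _](next_rot i zU) -(next_rot i zU u).
have: uniq (rot i z) by rewrite rot_uniq.
have: (2 < size (rot i z))%N by rewrite size_rot.
rewrite E; case: p {E} => [|a [|b p]] //= _ /and4P[].
rewrite !inE !negb_or eqxx => /and3P[ua ub up] /andP[ab ap] bp _.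
by rewrite ![_ == u]eq_sym (negPf ua) eqxx /=.
Qed.

Lemma mem_nz u : (nz u \in z) = (u \in z).
Proof. exact: mem_next. Qed.

Lemma nz_inj : injective nz.
Proof. exact: can_inj (prev_next zU). Qed.

Lemma hstep_nz u : u \in z -> hstep u (nz u).
Proof. exact: next_cycle. Qed.

Lemma next_ind (Q : pt -> Prop) u : u \in z -> Q u ->
  (forall x, x \in z -> Q x -> Q (nz x)) -> forall y, y \in z -> Q y.
Proof.
move=> uz Qu QS y yz.
case/rot_to: (uz) => i p E.
have F : fcycle nz (u :: p).
  rewrite -E rot_cycle; exact: cycle_next.
have: y \in u :: p by rewrite -E mem_rot.
have: {subset u :: p <= z} by move=> v; rewrite -E mem_rot.
move: F; rewrite /= rcons_path => /andP[F _] {E}.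
elim: p u Qu F {uz} => [|v p IH] u Qu /=; first by move=> _ _; rewrite inE => /eqP->.
case/andP=> /eqP<- F sub; rewrite inE => /orP[/eqP->//|yv].
apply: IH F _ yv; first by apply: QS => //; apply: sub; rewrite mem_head.
by move=> b hb; apply: sub; rewrite inE hb orbT.
Qed.

Definition winding (f : pt) : int := \sum_(u <- z) ray_cross f u (nz u).
Definition edge_flow t a : int := \sum_(u <- z) stepf t a u (nz u).
Definition Zedge t a : bool :=
  ((a \in z) && (nz a == sh t a)) || ((sh t a \in z) && (nz (sh t a) == a)).

Lemma z_cons : exists x p, z = x :: p.
Proof. by case: z z2 => // x p _; exists x, p. Qed.

Lemma z_closed : exists x p, [/\ z = x :: p, path hstep x (rcons p x) & last x (rcons p x) = x].
Proof. by case: z_cons => x [p E]; exists x, p; split; rewrite ?last_rcons //; move: zC; rewrite E. Qed.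

(** This sums [step_flow] over the cycle, along which the potential [ray_pot] returns to its first
    value. *)
Lemma winding_flow t a : col a = 0 -> winding (Lf t a) - winding (Rf t a) = edge_flow t a.
Proof.
move=> ca; have [x [p [E hp hl]]] := z_closed.
rewrite /winding /edge_flow !(sum_next _ E).
by have := wsum_flow t ca hp; rewrite hl subrr => /eqP; rewrite subr_eq0 => /eqP.
Qed.

Lemma winding_bounded : exists M : int, forall f, col f = 2 -> winding f != 0 -> in_box M f.
Proof.
have [x [p [E hp hl]]] := z_closed.
have [M hM] := wsum_bounded hp hl; exists M => f cf.
by rewrite /winding (sum_next _ E); apply: hM.
Qed.

Lemma winding_far (f : pt) : (forall u, u \in z -> u.2 <= f.2) -> winding f = 0.
Proof.
move=> H; have [x [p [E hp hl]]] := z_closed.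
rewrite /winding (sum_next _ E); apply: wsum_far_right; apply/allP => u.
by rewrite inE mem_rcons -E => /orP[/eqP->|]; apply: H; rewrite // E mem_head.
Qed.

Lemma sum_ib (Q : pred pt) a : \sum_(u <- z) ib ((u == a) && Q u) = ib ((a \in z) && Q a).
Proof.
have [az|az] := boolP (a \in z).
  rewrite (bigD1_seq a) //= eqxx /= big1 ?addr0 // => u ua.
  by rewrite (negPf ua).
rewrite big_seq big1 //= => u uz; case: eqP => // ua; by rewrite ua (negPf az) in uz.
Qed.

Lemma edge_flowE t a : edge_flow t a =
  ib ((a \in z) && (nz a == sh t a)) - ib ((sh t a \in z) && (nz (sh t a) == a)).
Proof.
rewrite /edge_flow /stepf sumrB.
by rewrite (sum_ib (fun u => nz u == sh t a)) (sum_ib (fun u => nz u == a)).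
Qed.

Lemma edge_flow_off t a : ~~ Zedge t a -> edge_flow t a = 0.
Proof. by rewrite edge_flowE negb_or => /andP[/negPf-> /negPf->]. Qed.

Lemma edge_flow_on t a : Zedge t a -> edge_flow t a = 1 \/ edge_flow t a = -1.
Proof.
rewrite edge_flowE /Zedge; case: andP => [[az /eqP na] _|_ /= /andP[-> ->] /=]; last by right.
left; by rewrite -na (negPf (next2 az)) andbF.
Qed.

End Cycle.

Definition dir_of (u v : pt) : dir :=
  if v == sh T0 u then T0 else if v == sh T1 u then T1 else T2.

Definition left_face (u v : pt) : pt := if col u == 0 then Lf (dir_of u v) u else Rf (dir_of v u) v.
Definition right_face (u v : pt) : pt := if col u == 0 then Rf (dir_of u v) u else Lf (dir_of v u) v.

Lemma dir_of_sh t u : dir_of u (sh t u) = t.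
Proof. by case: u => a b; case: t; rewrite /dir_of /sh /du /dv /= !pt_eqE; case: ifP => //; try case: ifP => //; lia. Qed.

Lemma dir_of_us t u : dir_of (us t u) u = t.
Proof. by rewrite -{2}(sh_us t u) dir_of_sh. Qed.

Lemma col_sh t u : col (sh t u) = ((col u + 1) %% 3)%Z.
Proof. by case: u => a b; rewrite /col /sh; case: t => /=; lia. Qed.

Lemma col_us t u : col (us t u) = ((col u + 2) %% 3)%Z.
Proof. by case: u => a b; rewrite /col /us; case: t => /=; lia. Qed.

Lemma col_Lf t a : col a = 0 -> col (Lf t a) = 2.
Proof. by move=> h; rewrite /Lf col_us h. Qed.
Lemma col_Rf t a : col a = 0 -> col (Rf t a) = 2.
Proof. by move=> h; rewrite /Rf col_us h. Qed.

Lemma hstep_col u v : hstep u v -> (col u == 0) || (col u == 1).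
Proof.
by move=> /hstepP[t [/andP[-> _]//|/andP[/eqP h /eqP->]]]; rewrite col_sh h orbT.
Qed.

Lemma hstep_even u v : hstep u v -> col u = 0 -> v = sh (dir_of u v) u /\ col v = 1.
Proof.
move=> /hstepP[t [/andP[/eqP h /eqP->] _|/andP[/eqP h /eqP->]]]; first by rewrite dir_of_sh col_sh h.
by rewrite col_sh h.
Qed.
Lemma hstep_odd u v : hstep u v -> col u = 1 -> u = sh (dir_of v u) v /\ col v = 0.
Proof.
move=> /hstepP[t [/andP[/eqP h _]|/andP[/eqP h /eqP->]]] hu; first by rewrite h in hu.
by rewrite dir_of_sh.
Qed.

Lemma hstepC u v : hstep u v = hstep v u.
Proof. by rewrite /hstep; do 6![case: (up_step _ _ _)]. Qed.

(** The edge at [v] that leads neither to [u] nor to [x] lies on one side of the path. On the other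
    side both steps have the same face, and on its own side their faces are the two faces of that
    third edge. *)
Lemma turn u v x : hstep u v -> hstep v x -> u != x ->
  exists t a, [/\ col a = 0, (v = a /\ sh t a != u /\ sh t a != x) \/
                             (v = sh t a /\ a != u /\ a != x) &
   let opp f g := (f = Lf t a /\ g = Rf t a) \/ (f = Rf t a /\ g = Lf t a) in
   (left_face u v = left_face v x /\ opp (right_face u v) (right_face v x)) \/
   (right_face u v = right_face v x /\ opp (left_face u v) (left_face v x))].
Proof.
move=> uv vx ux; have vu := uv; rewrite hstepC in vu.
have shN t t' : t <> t' -> sh t v != sh t' v.
  move=> tt; apply/eqP => /(congr1 (dir_of v)); by rewrite !dir_of_sh.
have usN t t' : t <> t' -> us t v != us t' v.
  move=> tt; apply/eqP => /(congr1 (dir_of^~ v)); by rewrite !dir_of_us.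
case/orP: (hstep_col vx) => /eqP cv.
  have [xE cx] := hstep_even vx cv; have [uE cu] := hstep_even vu cv.
  set t := dir_of v u in uE *; set t' := dir_of v x in xE *.
  have tt : t <> t' by move=> E; rewrite uE xE E eqxx in ux.
  exists (if t' is T0 then if t is T1 then T2 else T1 else
     if t' is T1 then if t is T0 then T2 else T0 else
     if t is T0 then T1 else T0), v.
  split=> //; first by left; rewrite uE xE; split=> //; split; apply: shN; move: tt; case: (t) (t') => -[].
  rewrite /left_face /right_face cv cu /= -/t -/t'.
  by move: tt; rewrite /Lf /Rf; case: (t) (t') => -[] //= _; auto.
have [xE cx] := hstep_odd vx cv; have [uE cu] := hstep_odd vu cv.
rewrite /left_face /right_face cv cu /=.
move: uE xE; set t := dir_of u v; set t' := dir_of x v => uE xE.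
have {}uE : u = us t v by rewrite uE us_sh.
have {}xE : x = us t' v by rewrite xE us_sh.
have tt : t <> t' by move=> E; rewrite uE xE E eqxx in ux.
pose t3 := (if t' is T0 then if t is T1 then T2 else T1 else
     if t' is T1 then if t is T0 then T2 else T0 else
     if t is T0 then T1 else T0).
exists t3, (us t3 v).
split; first by rewrite col_us cv.
  by right; rewrite sh_us uE xE; split=> //; split; apply: usN; move: tt; rewrite /t3; case: (t) (t') => -[].
rewrite uE xE /t3.
case: (v) => v1 v2; move: tt; rewrite /Lf /Rf; case: (t) (t') => -[] //= _; 
 rewrite /us /=;
 (try by left; (split; [congr pair; lia|]); (try by left; split; congr pair; lia); right; split; congr pair; lia);
 (try by right; (split; [congr pair; lia|]); (try by left; split; congr pair; lia); right; split; congr pair; lia).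
Qed.

(** * A discrete Jordan theorem for the faces of the lattice *)

Section Jordan.
Variable z : seq pt.
Hypotheses (z2 : (2 < size z)%N) (zU : uniq z) (zC : cycle hstep z).
Notation nz := (next z).
Notation w := (winding z).

Definition face_adj (f g : pt) : Prop := exists t a, [/\ col a = 0, ~~ Zedge z t a &
  (f = Lf t a /\ g = Rf t a) \/ (f = Rf t a /\ g = Lf t a)].

(* Impredicative form of the reflexive transitive closure of [face_adj]. *)
Definition reach (f g : pt) : Prop :=
  forall Q : pt -> Prop, (forall f g, face_adj f g -> Q f -> Q g) -> Q f -> Q g.

Lemma face_adj_sym f g : face_adj f g -> face_adj g f.
Proof. by case=> t [a [h1 h2 h3]]; exists t, a; split=> //; case: h3 => -[-> ->]; auto. Qed.

Lemma reach_refl f : reach f f. Proof. by move=> Q. Qed.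
Lemma reach_trans f g h : reach f g -> reach g h -> reach f h.
Proof. by move=> fg gh Q HQ Qf; exact: (gh Q HQ (fg Q HQ Qf)). Qed.
Lemma reach_adj f g : face_adj f g -> reach f g.
Proof. by move=> fg Q HQ; exact: HQ fg. Qed.
Lemma reach_sym f g : reach f g -> reach g f.
Proof.
move=> fg; apply: (fg (reach^~ f)); last exact: reach_refl.
move=> x y xy xf; apply: reach_trans xf; apply: reach_adj; exact: face_adj_sym.
Qed.

Lemma reach_winding f g : reach f g -> w f = w g.
Proof.
move=> fg; apply/esym; apply: (fg (fun x => w x = w f)) => // x y [t [a [ca nZ H]]] <-.
have := winding_flow z2 zU zC t ca; rewrite edge_flow_off //.
by case: H => -[-> ->]; lia.
Qed.

Lemma reach_turn u : u \in z ->
  reach (left_face u (nz u)) (left_face (nz u) (nz (nz u))) /\ reach (right_face u (nz u)) (right_face (nz u) (nz (nz u))).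
Proof.
move=> uz; set v := nz u; set x := nz v.
have vz : v \in z by rewrite mem_nz.
have ux : u != x by rewrite eq_sym next2.
have [t [a [ca H K]]] := turn (hstep_nz zC uz) (hstep_nz zC vz) ux.
(* The cycle visits [v] once, between [u] and [x], hence avoids the third edge there. *)
have nZ : ~~ Zedge z t a.
  rewrite /Zedge; case: H => -[<- [Hu Hx]]; apply/negP => /orP[]/andP[? /eqP e].
  - by rewrite -e eqxx in Hx.
  - by rewrite (nz_inj zU e) eqxx in Hu.
  - by rewrite (nz_inj zU e) eqxx in Hu.
  - by rewrite -e eqxx in Hx.
have A f g : (f = Lf t a /\ g = Rf t a) \/ (f = Rf t a /\ g = Lf t a) -> reach f g.
  by move=> h; apply: reach_adj; exists t, a.
case: K => -[-> /A h]; split=> //; exact: reach_refl.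
Qed.

Lemma reach_sides u v : u \in z -> v \in z ->
  reach (left_face u (nz u)) (left_face v (nz v)) /\ reach (right_face u (nz u)) (right_face v (nz v)).
Proof.
move=> uz; move: v; apply: (next_ind zU uz); first by split; apply: reach_refl.
move=> x xz [h1 h2]; have [h3 h4] := reach_turn xz.
by split; [apply: reach_trans h3|apply: reach_trans h4].
Qed.

Lemma winding_sides u : u \in z -> w (left_face u (nz u)) = w (right_face u (nz u)) + 1.
Proof.
move=> uz; have hs := hstep_nz zC uz; case/orP: (hstep_col hs) => /eqP cu.
  have [E _] := hstep_even hs cu; rewrite /left_face /right_face cu /=.
  have := winding_flow z2 zU zC (dir_of u (nz u)) cu; rewrite edge_flowE // -E uz eqxx /=.
  by rewrite (negPf (next2 z2 zU uz)) andbF; lia.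
have [E cv] := hstep_odd hs cu; rewrite /left_face /right_face cu /=.
have := winding_flow z2 zU zC (dir_of (nz u) u) cv; rewrite edge_flowE // -E uz eqxx /=.
by rewrite (negPf (next2 z2 zU uz)) andbF; lia.
Qed.

Definition far (f : pt) := forall u, u \in z -> u.2 < f.2.

Lemma row_walk f : col f = 2 -> exists g, [/\ col g = 2, reach f g, f.2 <= g.2 &
  far g \/ Zedge z T0 (sh T1 g)].
Proof.
have [M hM] := in_box_ex z.
have Hfar (g : pt) : M < g.2 -> far g.
  by move=> Mg u uz; have := allP hM _ uz; rewrite /in_box /=; move: (g) (u) Mg => [g1 g2] [u1 u2] /=; lia.
move: {2}(`|(M + 2 - f.2)%R|%N) (leqnn `|(M + 2 - f.2)%R|%N) => m.
elim: m f => [|m IH] f.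
  move=> h cf; exists f; split=> //.
  have lt : M < f.2 by lia.
  by left; exact: (Hfar f lt).
have [lt|le] := ltP M f.2; first by exists f; split=> //; left; exact: (Hfar f).
move=> h cf; have [Z|nZ] := boolP (Zedge z T0 (sh T1 f)).
  by exists f; split=> //; right.
have ca : col (sh T1 f) = 0 by rewrite col_sh cf.
pose g := Rf T0 (sh T1 f).
have g2 : g.2 = f.2 + 2 by rewrite /g /Rf /sh /us /=; case: (f) => f1 f2 /=; lia.
have [||k [ck gk gk2 H]] := IH g; [lia|exact: col_Rf|].
exists k; split=> //; last lia; apply: reach_trans gk; apply: reach_adj.
by exists T0, (sh T1 f); split=> //; left; rewrite /Lf us_sh.
Qed.

Lemma Zedge_sides t a : col a = 0 -> Zedge z t a -> exists2 u, u \in z &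
  (left_face u (nz u) = Lf t a /\ right_face u (nz u) = Rf t a) \/ (left_face u (nz u) = Rf t a /\ right_face u (nz u) = Lf t a).
Proof.
move=> ca /orP[]/andP[uz /eqP nu].
  by exists a => //; left; rewrite /left_face /right_face ca /= nu dir_of_sh.
exists (sh t a) => //; right; rewrite /left_face /right_face nu.
by rewrite col_sh ca dir_of_sh.
Qed.

Lemma winding_of_far f : far f -> w f = 0.
Proof. by move=> ff; apply: winding_far => // u uz; apply: ltW; apply: ff. Qed.

Lemma z_in : exists u, u \in z.
Proof. by case: z z2 => // x p _; exists x; rewrite mem_head. Qed.

(* Take a vertical edge of [z] that is extreme to the right. *)
Lemma rightmost : exists2 a, col a = 0 & Zedge z T0 a /\
   exists g, [/\ far g, col g = 2 & reach (Rf T0 a) g].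
Proof.
have [u0 u0z] := z_in.
have [a0 ca0 Za0] : exists2 a, col a = 0 & Zedge z T0 a.
  have [f cf wf] : exists2 f, col f = 2 & w f != 0.
    have cL : col (left_face u0 (nz u0)) = 2 /\ col (right_face u0 (nz u0)) = 2.
      have hs := hstep_nz zC u0z; case/orP: (hstep_col hs) => /eqP cu.
        by rewrite /left_face /right_face cu /= col_Lf // col_Rf.
      have [E cv] := hstep_odd hs cu; by rewrite /left_face /right_face cu /= col_Lf // col_Rf.
    have := winding_sides u0z; have [e|] := eqVneq (w (left_face u0 (nz u0))) 0; last by exists (left_face u0 (nz u0)); case: cL.
    by move=> h; exists (right_face u0 (nz u0)); case: cL => //; lia.
  have [g [cg fg _ [/winding_of_far|Z]]] := row_walk cf.
    by rewrite -(reach_winding fg) => e; rewrite e eqxx in wf.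
  by exists (sh T1 g) => //; rewrite col_sh cg.
have [M hM] := in_box_ex z.
have [m hm] : exists m, (`|(M - a0.2)%R| <= m)%N by exists `|(M - a0.2)%R|%N.
elim: m a0 ca0 Za0 hm => [|m IH] a ca Za hm.
all: have aM : a.2 <= M by case/orP: (Za) => /andP[az _]; move: (allP hM _ az); rewrite /in_box /sh /=; lia.
all: have [g [cg ag ag2 [fg|Zg]]] := row_walk (col_Rf T0 ca); first by exists a => //; split=> //; exists g.
all: have la : a.2 + 2 <= (sh T1 g).2 by move: ag2; rewrite /Rf /us /sh /=; lia.
all: have lM : (sh T1 g).2 <= M by case/orP: (Zg) => /andP[az _]; move: (allP hM _ az); rewrite /in_box /sh /=; lia.
  lia.
by apply: (IH (sh T1 g)) => //; [rewrite col_sh cg|lia].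
Qed.

(** All left faces of [z] reach each other, and so do all right faces, whose winding number is one
    less. By [row_walk] every face reaches one of these two classes or a far face. The class
    containing the outer face of the rightmost vertical edge reaches a far face and has winding
    number 0, so the other class has 1 or -1. The last clause says that the faces of winding number
    0 have no second component. *)
Lemma jordan : exists sg : int, [/\ sg = 1 \/ sg = -1,
  (forall f, col f = 2 -> w f = 0 \/ w f = sg),
  (forall u, u \in z -> w (left_face u (nz u)) = if sg == 1 then 1 else 0) &
  (forall f, col f = 2 -> w f = 0 -> exists2 g, reach f g & far g /\ col g = 2)].
Proof.
have [a ca [Za [g [fg cg ag]]]] := rightmost.
have wR : w (Rf T0 a) = 0 by rewrite (reach_winding ag) winding_of_far.
have [u uz Hu] := Zedge_sides ca Za.
have nearest f : col f = 2 -> (exists2 g, reach f g & far g /\ col g = 2) \/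
    (exists2 v, v \in z & reach f (left_face v (nz v)) \/ reach f (right_face v (nz v))).
  move=> cf; have [k [ck fk _ [fak|Zk]]] := row_walk cf; first by left; exists k.
  have [|v vz] := Zedge_sides _ Zk; first by rewrite col_sh ck.
  rewrite /Lf us_sh => -[[e _]|[_ e]]; right; exists v => //; rewrite e; auto.
have wL := winding_sides uz.
case: Hu => -[e1 e2].
  have wr v : v \in z -> w (right_face v (nz v)) = 0.
    by move=> vz; rewrite -(reach_winding (reach_sides uz vz).2) e2.
  exists 1; split; [by left| | |].
  - move=> f /nearest[[h fh [/winding_of_far e _]]|[v vz H]]; first by rewrite (reach_winding fh); left.
    have := winding_sides vz; rewrite wr //.
    by case: H => /reach_winding->; rewrite ?wr //; auto.
  - by move=> v vz; rewrite (winding_sides vz) wr.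
  move=> f /nearest[//|[v vz H]] wf; exists g => //.
  have := winding_sides vz; rewrite wr //; case: H => H.
    by rewrite -(reach_winding H) wf.
  by move=> _; apply: reach_trans ag; rewrite -e2; apply: reach_trans H _; case: (reach_sides vz uz).
have wl v : v \in z -> w (left_face v (nz v)) = 0.
  by move=> vz; rewrite -(reach_winding (reach_sides uz vz).1) e1.
exists (-1); split; [by right| | |].
- move=> f /nearest[[h fh [/winding_of_far e _]]|[v vz H]]; first by rewrite (reach_winding fh); left.
  have := winding_sides vz; rewrite wl // => e.
  by case: H => /reach_winding->; rewrite ?wl //; [left|right; lia].
- by move=> v vz; rewrite wl.
move=> f /nearest[//|[v vz H]] wf; exists g => //.
have := winding_sides vz; rewrite wl //; case: H => H; last first.
  by rewrite -(reach_winding H) wf.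
by move=> _; apply: reach_trans ag; rewrite -e1; apply: reach_trans H _; case: (reach_sides vz uz).
Qed.

End Jordan.

Local Open Scope fset_scope.
Local Open Scope nat_scope.

(** * Cuts of graphs *)

Section Dist.
Variables (V : choiceType) (E : {fset V * V}).
Notation adj := (gadj E).
Notation d := (gdist E).

Lemma gadjC u v : adj u v = adj v u.
Proof. by rewrite /gadj /= orbC. Qed.

Lemma walk0 u : walk E u u 0. Proof. by exists [::]. Qed.
Lemma walk1 u v : adj u v -> walk E u v 1.
Proof. by move=> h; exists [:: v]; rewrite /= h. Qed.
Lemma walk_cat u v x m n : walk E u v m -> walk E v x n -> walk E u x (m + n).
Proof.
case=> p [hp <- <-] [q [hq <- <-]]; exists (p ++ q).
by rewrite cat_path hp hq last_cat size_cat.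
Qed.
Lemma walk_sym u v n : walk E u v n -> walk E v u n.
Proof.
case=> p [hp <- <-]; exists (rev (belast u p)); split.
- rewrite rev_path; congr (is_true _): hp; apply: eq_path => a b; exact: gadjC.
- by case: p {hp} => //= a p; rewrite rev_cons last_rcons.
- by rewrite size_rev size_belast.
Qed.

Definition conn u v : Prop := exists n, walk E u v n.

Lemma conn_sym u v : conn u v -> conn v u.
Proof. by case=> n /walk_sym h; exists n. Qed.
Lemma conn_trans u v x : conn u v -> conn v x -> conn u x.
Proof. by case=> m h1 [n h2]; exists (m + n); apply: walk_cat h1 h2. Qed.

Lemma gdistP u v : conn u v -> walk E u v (d u v) /\ forall m, walk E u v m -> d u v <= m.
Proof.
case=> n hn.
have ex : exists n, `[< walk E u v n >] by exists n; apply/asboolP.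
case: (ex_minnP ex) => m /asboolP hm hmin.
have := @xgetPex _ 0 [set n | walk E u v n /\ forall m, walk E u v m -> (n <= m)%N]%classic.
apply; exists m; split=> // k hk; apply: hmin; exact/asboolP.
Qed.

Lemma gdist_le u v m : walk E u v m -> d u v <= m.
Proof. by move=> h; have [_] := gdistP (ex_intro _ m h : conn u v); exact. Qed.

Lemma gdist_walk u v : conn u v -> walk E u v (d u v).
Proof. by move=> /gdistP[]. Qed.

Lemma gdist_eq u v m : walk E u v m -> (forall k, walk E u v k -> m <= k) -> d u v = m.
Proof.
move=> h hm; apply/eqP; rewrite eqn_leq gdist_le // hm //; apply: gdist_walk; by exists m.
Qed.

End Dist.

Definition adist (i j : nat) := (i - j) + (j - i).

(* The edges [p i -- q i], for [i <= r], form a cut, and distances along each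
   side of the cut are attained by the zigzag that follows it; the distances of
   any edge to the two ends of a cut edge then differ unless that edge is itself
   in the cut. *)
Record cut_ok (V : choiceType) (E : {fset V * V}) (h : V -> bool) (p q : nat -> V) (r : nat) := CutOk {
  c_edge : forall j, j <= r -> gadj E (p j) (q j);
  c_p : forall j, j <= r -> ~~ h (p j);
  c_q : forall j, j <= r -> h (q j);
  c_cross : forall x y, gadj E x y -> ~~ h x -> h y -> exists2 j, j <= r & x = p j /\ y = q j;
  c_zigp : forall i j, i <= r -> j <= r -> walk E (p i) (p j) (2 * adist i j);
  c_zigq : forall i j, i <= r -> j <= r -> walk E (q i) (q j) (2 * adist i j);
  c_lowp : forall i j m, i <= r -> j <= r -> walk E (p i) (p j) m -> 2 * adist i j <= m;
  c_lowq : forall i j m, i <= r -> j <= r -> walk E (q i) (q j) m -> 2 * adist i j <= m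
}.

Section Cut.
Variables (V : choiceType) (E : {fset V * V}).
Notation d := (gdist E).

Lemma cut_swap h p q r : cut_ok E h p q r -> cut_ok E (fun x => ~~ h x) q p r.
Proof.
case=> ce cp cq cc *; split=> //.
- by move=> j /ce; rewrite gadjC.
- by move=> j /cq ->.
- move=> x y; rewrite gadjC negbK => /cc H hx hy.
  by have [j hj [-> ->]] := H hy hx; exists j.
Qed.

(** A shortest walk from [q i] to [v] crosses the cut at some edge [j]. Its part before the crossing
    has length at least [2 * adist i j] and can be replaced by the zigzag from [p i] to [p j] on the
    side of [v], which saves the crossing. *)
Lemma cut_gdist h p q r i v : cut_ok E h p q r -> i <= r -> ~~ h v -> conn E (q i) v ->
  d (q i) v = (d (p i) v).+1.
Proof.
move=> C ir hv cv.
have cross x l : path (gadj E) x l -> last x l = v -> h x ->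
    exists j m1 m2, [/\ j <= r, walk E x (q j) m1, walk E (p j) v m2 & m1 + m2 + 1 = size l].
  elim: l x => [|y l IH] x /=; first by move=> _ e; rewrite e (negPf hv).
  case/andP=> xy hp hl hx.
  have [hy|hy] := boolP (h y).
    have [j [m1 [m2 [jr w1 w2 e]]]] := IH _ hp hl hy.
    exists j, m1.+1, m2; split=> //; last lia.
    by rewrite -add1n; apply: walk_cat w1; apply: walk1.
  have yx : gadj E y x by rewrite gadjC.
  have [j jr [ey ex]] := c_cross C yx hy hx.
  exists j, 0, (size l); split=> //; last lia; first by rewrite ex; apply: walk0.
  by exists l; rewrite -ey.
have cpv : conn E (p i) v.
  by apply: conn_trans cv; exists 1; apply: walk1; exact: (c_edge C ir).
apply/eqP; rewrite eqn_leq; apply/andP; split.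
  rewrite -add1n; apply: gdist_le; apply: walk_cat (gdist_walk cpv).
  by apply: walk1; rewrite gadjC; exact: (c_edge C ir).
have [l [hp hl <-]] := gdist_walk cv.
have [j [m1 [m2 [jr w1 w2 <-]]]] := cross _ _ hp hl (c_q C ir).
rewrite addn1 ltnS; apply: leq_trans (leq_add (c_lowq C ir jr w1) (leqnn m2)).
by apply: gdist_le; apply: walk_cat w2; exact: (c_zigp C).
Qed.

Lemma cut_M h p q r i : cut_ok E h p q r -> i <= r ->
  (forall f, f \in E -> conn E (q i) f.1) ->
  M1 E (p i, q i) = [fset f in E | ~~ h f.1 && ~~ h f.2] /\
  M2 E (p i, q i) = [fset f in E | h f.1 && h f.2].
Proof.
move=> C ir cE.
have dq v : ~~ h v -> conn E (q i) v -> d (q i) v = (d (p i) v).+1 by apply: cut_gdist C ir.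
have dp v : h v -> conn E (q i) v -> d (p i) v = (d (q i) v).+1.
  move=> hv cv; apply: (cut_gdist (cut_swap C)) => //; first by rewrite negbK.
  by apply: conn_trans cv; exists 1; apply: walk1; exact: (c_edge C ir).
have key f : f \in E ->
   (edist E (p i) f < edist E (q i) f) = ~~ h f.1 && ~~ h f.2 /\
   (edist E (q i) f < edist E (p i) f) = h f.1 && h f.2.
  case: f => a b fE; have /= ca := cE _ fE.
  have ab : gadj E a b by rewrite /gadj /= fE.
  have cb : conn E (q i) b by apply: conn_trans ca _; exists 1; apply: walk1.
  rewrite /edist /=.
  (* These give both ends of edge [i] the distance [2 * adist i j] to edge [j] of the cut, which
     therefore belongs to neither set. *)
  have dpp j : j <= r -> d (p i) (p j) = 2 * adist i j.
    by move=> jr; apply: gdist_eq; [exact: (c_zigp C) | move=> k; exact: (c_lowp C)].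
  have dqq j : j <= r -> d (q i) (q j) = 2 * adist i j.
    by move=> jr; apply: gdist_eq; [exact: (c_zigq C) | move=> k; exact: (c_lowq C)].
  case ha : (h a); case hb : (h b) => /=.
  - by rewrite !dp //; lia.
  - rewrite gadjC in ab; have [j jr [eb ea]] := c_cross C ab (negbT hb) ha.
    by rewrite (dp a) // (dq b) ?hb // ea eb dpp // dqq //; lia.
  - have [j jr [ea eb]] := c_cross C ab (negbT ha) hb.
    by rewrite (dp b) // (dq a) // ?ha // ea eb dpp // dqq //; lia.
  - by rewrite !dq // ?ha ?hb //; lia.
by split; apply/fsetP => f; rewrite !inE /=; case fE : (f \in E) => //=; have [k1 k2] := key _ fE; rewrite ?k1 ?k2.
Qed.

End Cut.

(** * Invariance of the index under injective relabelling *)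

Section Transport.
Variables (V W : choiceType) (f : V -> W).
Hypothesis finj : injective f.
Variable E : {fset V * V}.

Definition map_edge (e : V * V) := (f e.1, f e.2).
Definition map_edges : {fset W * W} := map_edge @` E.

Lemma map_edge_inj : injective map_edge.
Proof. by move=> [a b] [c e'] [/finj-> /finj->]. Qed.

Lemma mem_map_edges e : (map_edge e \in map_edges) = (e \in E).
Proof. by apply/imfsetP/idP => /= [[e' ? /map_edge_inj->//]|?]; exists e. Qed.

Lemma gadj_map u v : gadj map_edges (f u) (f v) = gadj E u v.
Proof. by rewrite /gadj /= -!/(map_edge (_, _)) !mem_map_edges. Qed.

Lemma gadj_mapP u x : gadj map_edges (f u) x -> exists v, x = f v.
Proof.
by rewrite /gadj /= => /orP[]/imfsetP[/= [a b] _ [e1 e2]]; [exists b|exists a].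
Qed.

Lemma walk_map u v n : walk map_edges (f u) (f v) n <-> walk E u v n.
Proof.
split; last first.
  case=> p [hp hl <-]; exists (map f p); rewrite size_map last_map hl; split=> //.
  by elim: p u hp {hl} => //= a p IH u /andP[h /IH->]; rewrite gadj_map h.
case=> p [hp hl hs]; suff [q qE] : exists q, p = map f q.
  exists q; move: hp hl hs; rewrite qE last_map size_map => hp /finj hl hs; split=> //.
  by elim: (q) (u) hp => //= a p' IH u' /andP[]; rewrite gadj_map => -> /IH.
elim: p u hp {hl hs} => [|a p IH] u /=; first by exists [::].
case/andP=> /gadj_mapP[b ->] /IH[q ->]; by exists (b :: q).
Qed.

Lemma gdist_map u v : gdist map_edges (f u) (f v) = gdist E u v.
Proof.
rewrite /gdist; congr (xget _ _); apply/funext => n /=; apply/propext.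
by split=> -[/walk_map h1 h2]; split=> // m /walk_map; apply: h2.
Qed.

Lemma edist_map x e : edist map_edges (f x) (map_edge e) = edist E x e.
Proof. by rewrite /edist /= !gdist_map. Qed.

Lemma Sz_e_map : Sz_e map_edges = Sz_e E.
Proof.
rewrite /Sz_e /map_edges.
have -> : \sum_(e <- map_edge @` E) (#|` M1 map_edges e| * #|` M2 map_edges e|)%N =
   \sum_(e <- map map_edge E) (#|` M1 map_edges e| * #|` M2 map_edges e|)%N.
  apply: perm_big; apply: uniq_perm; [exact: fset_uniq|by rewrite (map_inj_uniq map_edge_inj) fset_uniq|move=> x].
  apply/imfsetP/mapP => /= -[e eE ->]; by exists e.
rewrite big_map; apply: eq_bigr => e _; congr (_ * _).
  suff -> : M1 map_edges (map_edge e) = map_edge @` M1 E e by rewrite card_imfset //; exact: map_edge_inj.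
  apply/fsetP => x; rewrite !inE /=.
  apply/andP/imfsetP => /= [[/imfsetP[/= e' e'E ->]]|[e' + ->]].
    by rewrite /= !edist_map => h; exists e' => //; rewrite !inE /= e'E.
  by rewrite !inE /= mem_map_edges !edist_map => /andP[].
suff -> : M2 map_edges (map_edge e) = map_edge @` M2 E e by rewrite card_imfset //; exact: map_edge_inj.
apply/fsetP => x; rewrite !inE /=.
apply/andP/imfsetP => /= [[/imfsetP[/= e' e'E ->]]|[e' + ->]].
  by rewrite /= !edist_map => h; exists e' => //; rewrite !inE /= e'E.
by rewrite !inE /= mem_map_edges !edist_map => /andP[].
Qed.

End Transport.

Local Open Scope fset_scope.
Local Open Scope ring_scope.

(** No edge of [z] lies to the right of a far face, so the walk along its row is never stopped. *)
Lemma far_reach (z : seq pt) (M : int) (g : pt) : col g = 2 -> far z g ->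
  exists g', [/\ col g' = 2, reach z g g', far z g' & M <= g'.2].
Proof.
have [m hm] : exists m, (`|(M + 1 - g.2)%R| <= m)%N by exists `|(M + 1 - g.2)%R|%N.
elim: m g hm => [|m IH] g hm cg fg; first by exists g; split=> //; lia.
have [le|lt] := leP M g.2; first by exists g; split.
have ca : col (sh T1 g) = 0 by rewrite col_sh cg.
pose g' := Rf T0 (sh T1 g).
have g2 : g'.2 = g.2 + 2 by rewrite /g' /Rf /sh /us /=; lia.
have nZ : ~~ Zedge z T0 (sh T1 g).
  apply/negP => /orP[]/andP[az _]; have := fg _ az; rewrite /sh /=; lia.
have fg' : far z g' by move=> u uz; apply: lt_trans (fg _ uz) _; lia.
have gg' : reach z g g'.
  by apply: reach_adj; exists T0, (sh T1 g); split=> //; left; rewrite /Lf us_sh.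
have [|||k [ck gk fk Mk]] := IH g' => //; [lia|exact: col_Rf|].
by exists k; split=> //; apply: reach_trans gg' gk.
Qed.

Definition ed t a : pt * pt := (a, sh t a).

Lemma ed_inj t t' a a' : ed t a = ed t' a' -> t = t' /\ a = a'.
Proof.
move=> H; have e : a = a' := congr1 fst H; split=> //.
by have := congr1 (fun e => dir_of a e.2) H; rewrite /= dir_of_sh -e dir_of_sh.
Qed.

Lemma sh_sh t f : sh t (sh (nx t) f) = us (nx (nx t)) f.
Proof. by case: f => a b; case: t; rewrite /sh /us /=; congr pair; lia. Qed.
Lemma sh_sh2 t f : sh t (sh (nx (nx t)) f) = us (nx t) f.
Proof. by case: f => a b; case: t; rewrite /sh /us /=; congr pair; lia. Qed.

Definition corners f := [:: sh T0 f; sh T1 f; sh T2 f; us T0 f; us T1 f; us T2 f].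

Lemma wsum_sum (I : Type) (r : seq I) (g : I -> pt -> pt -> int) x l :
  wsum (fun x y => \sum_(i <- r) g i x y) x l = \sum_(i <- r) wsum (g i) x l.
Proof.
elim: l x => [|y l IH] x /=; first by rewrite big1.
by rewrite IH big_split.
Qed.

(** * Connectedness and closed walks of the benzenoid *)

Section Graph.
Variable z : seq pt.
Hypotheses (z2 : (2 < size z)%N) (zU : uniq z) (zC : cycle hstep z).
Notation nz := (next z).
Notation w := (winding z).

(** The edges on [z] or inside it, in terms of winding numbers. An abstract edge set [E] with this
    property is used until [EzP] supplies the geometric one. *)
Definition inG t a := (col a == 0) && ((w (Lf t a) != 0) || (w (Rf t a) != 0)).

Variable E : {fset pt * pt}.
Hypothesis inGP : forall t a, (ed t a \in E) = inG t a.
Hypothesis E_ed : forall e, e \in E -> exists t a, e = ed t a.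

Notation adj := (gadj E).

Lemma winding_off_edge t a : col a = 0 -> ~~ Zedge z t a -> w (Lf t a) = w (Rf t a).
Proof. by move=> ca nZ; have := winding_flow z2 zU zC t ca; rewrite edge_flow_off //; lia. Qed.

Lemma winding_on_edge t a : col a = 0 -> Zedge z t a ->
  w (Lf t a) = w (Rf t a) + 1 \/ w (Lf t a) = w (Rf t a) - 1.
Proof. by move=> ca Z; have := winding_flow z2 zU zC t ca; case: (edge_flow_on z2 zU Z) => ->; lia. Qed.

Lemma Zedge_inE t a : col a = 0 -> Zedge z t a -> inG t a.
Proof. by move=> ca Z; rewrite /inG ca /=; case: (winding_on_edge ca Z); lia. Qed.

Lemma adj_ed t a : inG t a -> adj a (sh t a).
Proof. by rewrite /gadj /= -/(ed t a) inGP => ->. Qed.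

Lemma adjP x y : adj x y -> exists t, (inG t x /\ y = sh t x) \/ (inG t y /\ x = sh t y).
Proof.
rewrite /gadj /= => /orP[] h; have [t [a e]] := E_ed h; rewrite e inGP in h;
  have [ex ey] := (congr1 fst e : _ = a, congr1 snd e : _ = sh t a); rewrite /= in ex ey;
  exists t; [left|right]; by rewrite ey ex.
Qed.

Lemma inG_col t a : inG t a -> col a = 0. Proof. by case/andP => /eqP. Qed.

Lemma adj_hstep x y : adj x y -> hstep x y.
Proof.
by move=> /adjP[t H]; apply/hstepP; exists t; case: H => -[/inG_col c ->]; [left|right];
  rewrite /up_step c !eqxx.
Qed.

Lemma path_hstep x l : path adj x l -> path hstep x l.
Proof. by apply: sub_path => a b; apply: adj_hstep. Qed.

Lemma conn_adj1 t a : inG t a -> conn E a (sh t a).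
Proof. by move=> /adj_ed h; exists 1%N; apply: walk1. Qed.

Lemma conn_refl a : conn E a a. Proof. by exists 0%N; apply: walk0. Qed.

Lemma face_inE f t : col f = 2 -> w f != 0 -> inG t (sh (nx t) f) /\ inG t (sh (nx (nx t)) f).
Proof.
move=> cf wf; rewrite /inG !col_sh cf /= /Lf /Rf !us_sh wf ?orbT; auto.
Qed.

Lemma hex_conn f : col f = 2 -> w f != 0 -> forall c, c \in corners f -> conn E (sh T0 f) c.
Proof.
move=> cf wf.
have H t : conn E (sh (nx t) f) (us (nx (nx t)) f) by rewrite -sh_sh; apply: conn_adj1; case: (face_inE t cf wf).
have H' t : conn E (sh (nx (nx t)) f) (us (nx t) f) by rewrite -sh_sh2; apply: conn_adj1; case: (face_inE t cf wf).
have c02 := H' T1; have c01 := H T2; have c12 := H T0; have c10 := H' T2; have c20 := H T1.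
rewrite /= in c02 c01 c12 c10 c20.
have c1 := conn_trans c02 (conn_sym c12).
move=> c; rewrite !inE => /orP[/eqP->|]; first exact: conn_refl.
case/orP=> [/eqP->//|].
case/orP=> [/eqP->|]; first exact: conn_trans c1 (conn_trans c10 (conn_sym c20)).
case/orP=> [/eqP->|]; first exact: conn_trans c1 c10.
by case/orP=> /eqP->.
Qed.

Lemma Lf_corners t a : a \in corners (Lf t a) /\ sh t a \in corners (Lf t a).
Proof.
split; rewrite -[X in X \in _](sh_us (nx t)) -/(Lf t a); first by case: t; rewrite !inE eqxx ?orbT.
rewrite sh_us -{1}(sh_us (nx t) a) sh_sh -/(Lf t a); by case: t; rewrite !inE eqxx ?orbT.
Qed.
Lemma Rf_corners t a : a \in corners (Rf t a) /\ sh t a \in corners (Rf t a).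
Proof.
split; rewrite -[X in X \in _](sh_us (nx (nx t))) -/(Rf t a); first by case: t; rewrite !inE eqxx ?orbT.
rewrite sh_us -{1}(sh_us (nx (nx t)) a) sh_sh2 -/(Rf t a); by case: t; rewrite !inE eqxx ?orbT.
Qed.

Lemma z_conn u v : u \in z -> v \in z -> conn E u v.
Proof.
move=> uz; move: v; apply: (next_ind zU uz); first exact: conn_refl.
move=> x xz ux; apply: conn_trans ux _.
case/hstepP: (hstep_nz zC xz) => t [] /andP[/eqP cx /eqP e].
  by rewrite e; apply: conn_adj1; apply: Zedge_inE => //; rewrite /Zedge e xz eqxx.
apply: conn_sym; rewrite {2}e; apply: conn_adj1; apply: Zedge_inE => //.
by rewrite /Zedge -e xz eqxx orbT.
Qed.

(** From an inside face the walk to the right along its row meets only inside faces, the winding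
    number being constant, until it is stopped by an edge of [z]. Neighbouring faces on the way
    share the ends of an edge, and the corners of an inside face are connected by its sides. *)
Lemma face_conn u f : u \in z -> col f = 2 -> w f != 0 ->
  forall c, c \in corners f -> conn E u c.
Proof.
move=> uz cf wf.
pose Q f := col f = 2 -> w f != 0 -> forall c, c \in corners f -> conn E u c.
suff: Q f by apply.
have Qc g c : col g = 2 -> w g != 0 -> c \in corners g -> conn E u c -> Q g.
  move=> cg wg cc uc _ _ c' cc'; apply: conn_trans uc _.
  by apply: conn_trans (conn_sym (hex_conn cg wg cc)) (hex_conn cg wg cc').
have QS g g' : face_adj z g g' -> Q g -> Q g'.
  move=> [t [a [ca nZ H]]] Qg cg' wg'.
  have := winding_off_edge ca nZ => ww.
  have [cl cr] : a \in corners g /\ a \in corners g'.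
    by case: H => -[-> ->]; split; case: (Lf_corners t a); case: (Rf_corners t a).
  apply: (Qc _ a) => //; apply: Qg => //.
    by case: H => -[-> _]; rewrite (col_Lf, col_Rf).
  by case: H wg' => -[-> ->]; rewrite ww.
have [g [cg fg _ [fag|Zg]]] := row_walk z2 zU zC cf.
  by move: wf; rewrite (reach_winding z2 zU zC fg) winding_of_far // eqxx.
have QQ : Q g -> Q f by exact: (reach_sym fg QS).
apply: QQ.
move=> _ wg; apply: (Qc _ (sh T1 g)) => //; first by rewrite !inE eqxx orbT.
case/orP: Zg => /andP[az /eqP e]; first exact: z_conn.
by apply: z_conn => //; rewrite -e mem_nz.
Qed.

Lemma G_conn u t a : u \in z -> inG t a -> conn E u a /\ conn E u (sh t a).
Proof.
move=> uz /andP[/eqP ca /orP[] wf]; have := face_conn uz _ wf.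
  by move=> H; case: (Lf_corners t a) => h1 h2; split; apply: H; rewrite ?col_Lf.
by move=> H; case: (Rf_corners t a) => h1 h2; split; apply: H; rewrite ?col_Rf.
Qed.

Lemma adj_conn x y u : u \in z -> adj x y -> conn E u x.
Proof. by move=> uz /adjP[t [[h _]|[h ->]]]; case: (G_conn uz h). Qed.

Lemma stepf_nE t a x l : path adj x l -> col a = 0 -> ~~ inG t a -> wsum (stepf t a) x l = 0.
Proof.
move=> + ca nE; elim: l x => //= y l IH x /andP[xy /IH->]; rewrite addr0 /stepf.
have [t' [[h ->]|[h ->]]] := adjP xy.
  case: eqP => [e|_] /=; last first.
    case: eqP => //= e; have := inG_col h; by rewrite e col_sh ca.
  rewrite e; case: eqP => /= [e'|_].
    have := congr1 (dir_of a) e'; rewrite !dir_of_sh => tt; by rewrite -tt -e h in nE.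
  by case: eqP => // e'; have := congr1 col e'; rewrite !col_sh ca.
rewrite andbC; case: eqP => [e|_] /=.
  by have := congr1 col e; rewrite !col_sh ca (inG_col h).
rewrite andbC; case: eqP => //= e; rewrite e.
case: eqP => //= e'; have := congr1 (dir_of a) e'; rewrite !dir_of_sh => tt; by rewrite -tt -e h in nE.
Qed.

(** The face [f] is moved to a face far to the right of the walk, where the ray is not met. Every
    edge passed on the way lies off [z] and between two outside faces, so it is not in [E], the walk
    does not use it, and the winding number of the walk does not change. *)
Lemma closed_out x l f : path adj x l -> last x l = x -> col f = 2 -> w f = 0 ->
  wsum (ray_cross f) x l = 0.
Proof.
move=> hp hl cf wf; have beyond := path_hstep hp.
have [sg [_ _ _ J]] := jordan z2 zU zC.
have [g fg [farg cg]] := J _ cf wf.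
have [M hM] := in_box_ex (x :: l).
have [g' [cg' gg' fg' Mg]] := far_reach M cg farg.
have : reach z g' f by apply: reach_sym; apply: reach_trans fg gg'.
move=> H; suff: w f = 0 /\ wsum (ray_cross f) x l = 0 by case.
apply: (H (fun f => w f = 0 /\ wsum (ray_cross f) x l = 0)); last first.
  split; first exact: winding_of_far.
  apply: wsum_far_right; apply: sub_all hM => a; rewrite /in_box; lia.
move=> f1 f2 [t [a [ca nZ K]]] [w1 s1].
have ww := winding_off_edge ca nZ.
have nE : ~~ inG t a.
  by case: K => -[e _]; rewrite e in w1; rewrite /inG ca ww ?w1 ?eqxx // -ww w1.
have := wsum_flow t ca beyond; rewrite hl subrr (stepf_nE hp ca nE).
by case: K => -[e ->]; rewrite e in w1 s1; split; lia.
Qed.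

End Graph.

(** * Runs of parallel edges *)

(* [ash t k a] is the [k]th edge after [a] in the row of parallel edges of
   direction [t]. *)
Definition ash t (k : int) (a : pt) : pt :=
  (a.1 + k * (du (nx t) - du (nx (nx t))), a.2 + k * (dv (nx t) - dv (nx (nx t)))).

Lemma ash0 t a : ash t 0 a = a.
Proof. by case: a => u v; rewrite /ash !mul0r !addr0. Qed.

Lemma ashD t j k a : ash t j (ash t k a) = ash t (j + k) a.
Proof. by case: a => u v; rewrite /ash /=; congr pair; lia. Qed.

Lemma col_ash t k a : col (ash t k a) = col a.
Proof. by case: a => u v; rewrite /ash /col; case: t => /=; lia. Qed.

Lemma Rf_ash t k a : Rf t (ash t k a) = Lf t (ash t (k + 1) a).
Proof. by case: a => u v; rewrite /ash /Rf /Lf /us; case: t => /=; congr pair; lia. Qed.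

Lemma ash_inj t a : injective (ash t ^~ a).
Proof. by move=> j k [] ; case: t => /=; lia. Qed.

Lemma shC s t p : sh s (sh t p) = sh t (sh s p).
Proof. by case: p => u v; rewrite /sh /=; congr pair; lia. Qed.

Lemma sh_sh_ash t a : sh (nx (nx t)) (ash t 1 a) = sh (nx t) a.
Proof. by case: a => u v; case: t; rewrite /ash /sh /=; congr pair; lia. Qed.

Lemma Rf_sh t a : sh (nx (nx t)) (Rf t a) = a /\ sh (nx t) (Rf t a) = ash t 1 a.
Proof. by case: a => u v; case: t; split; rewrite /ash /sh /Rf /us /=; congr pair; lia. Qed.

(** The coordinate that edges of direction [t] preserve and all other edges change by one. It grows
    by 2 from each edge of a row to the next, which bounds distances along a run from below by the
    length of the zigzag. *)
Definition level t (p : pt) : int := match t with T0 => p.2 | T1 => - p.1 - p.2 | T2 => p.1 end.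

Lemma level_sh t t' p : level t (sh t' p) = level t p + match t, t' with
  | T0, T0 | T1, T1 | T2, T2 => 0 | T0, T1 | T1, T2 | T2, T0 => 1 | _, _ => -1 end.
Proof. by case: p => u v; case: t t' => -[]; rewrite /level /sh /=; lia. Qed.

Lemma level_ash t k p : level t (ash t k p) = level t p + 2 * k.
Proof. by case: p => u v; case: t; rewrite /level /ash /=; lia. Qed.

Lemma level_path t x l : path hstep x l -> `|level t (last x l) - level t x| <= (size l)%:Z.
Proof.
elim: l x => [|y l IH] x /=; first by rewrite subrr.
case/andP=> /hstepP[t' H] /IH.
have : `|level t y - level t x| <= 1.
  by case: H => /andP[_ /eqP->]; rewrite level_sh; case: (t) (t') => -[] /=; lia.
lia.
Qed.

Lemma stepf_neq t t' a b : t <> t' -> col a = 0 -> col b = 0 -> stepf t a b (sh t' b) = 0 /\ stepf t a (sh t' b) b = 0.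
Proof.
move=> tt ca cb; rewrite /stepf.
have h1 : (b == a) && (sh t' b == sh t a) = false.
  by apply/negP => /andP[/eqP-> /eqP/(congr1 (dir_of a))]; rewrite !dir_of_sh => e; apply: tt.
have h2 : (b == sh t a) = false by apply/eqP => /(congr1 col); rewrite col_sh ca cb.
have h3 : (sh t' b == a) = false by apply/eqP => /(congr1 col); rewrite col_sh ca cb.
have h4 : (sh t' b == sh t a) && (b == a) = false by rewrite andbC.
by rewrite h1 h2 h3 h4.
Qed.

Section Run.
Variable z : seq pt.
Hypotheses (z2 : (2 < size z)%N) (zU : uniq z) (zC : cycle hstep z).
Notation w := (winding z).
Variable E : {fset pt * pt}.
Hypothesis inGP : forall t a, (ed t a \in E) = inG z t a.
Hypothesis E_ed : forall e, e \in E -> exists t a, e = ed t a.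
Notation adj := (gadj E).

(* A maximal row of parallel edges of [G], namely the edges [ash t k a] for
   [k <= r]; only the first and the last one lie on [z]. *)
Record is_run t a r : Prop := IsRun {
  run_col : col a = 0;
  run_pos : (0 < r)%N;
  run_L : w (Lf t a) = 0;
  run_R : w (Rf t (ash t r%:Z a)) = 0;
  run_in : forall k, (k < r)%N -> w (Rf t (ash t k%:Z a)) != 0
}.

Variables (t : dir) (a0 : pt) (r : nat).
Hypothesis run : is_run t a0 r.
Notation A k := (ash t k%:Z a0).

Lemma colA (k : int) : col (ash t k a0) = 0. Proof. by rewrite col_ash (run_col run). Qed.

Lemma run_inG k : (k <= r)%N -> inG z t (A k).
Proof.
rewrite leq_eqVlt => /orP[/eqP->|kr]; last by rewrite /inG colA (run_in run kr) orbT.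
case: r (run_pos run) run => // r' _ [_ _ _ _ H].
rewrite /inG colA /=; have := H r' (ltnSn _); rewrite Rf_ash.
by rewrite -[r'.+1]addn1 PoszD => ->.
Qed.

(** These are the four sides of a hexagon of the run that are not in the cut: they form the two
    zigzags beside it. *)
Lemma run_zig k : (k < r)%N ->
  [/\ inG z (nx t) (A k), inG z (nx (nx t)) (A k.+1) &
      inG z (nx (nx t)) (sh t (Rf t (A k))) /\ inG z (nx t) (sh t (Rf t (A k)))].
Proof.
move=> kr; have wf := run_in run kr; have cf := col_Rf t (colA k%:Z).
have [e1 e2] := Rf_sh t (A k); rewrite ashD (_ : 1 + k%:Z = k.+1%:Z) // in e2.
have H s := face_inE s cf wf.
split.
- by rewrite -[X in inG _ _ X]e1; case: (t) H => H; case: (H T0); case: (H T1); case: (H T2).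
- by rewrite -[X in inG _ _ X]e2; case: (t) H => H; case: (H T0); case: (H T1); case: (H T2).
- by case: (t) H => H; case: (H T0); case: (H T1); case: (H T2).
Qed.

Definition cut_crossing (x y : pt) : int := \sum_(k <- iota 0 r.+1) stepf t (A k) x y.

(** Since [Rf t (A k)] is [Lf t (A k.+1)], the flows through the edges of the run telescope to the
    difference of the winding numbers of the walk around the two outside hexagons at the ends, and
    both are 0 by [closed_out]. *)
Lemma closed_cross x l : path adj x l -> last x l = x -> wsum cut_crossing x l = 0.
Proof.
move=> hp hl; rewrite wsum_sum.
have F k : wsum (stepf t (A k)) x l = wsum (ray_cross (Lf t (A k))) x l - wsum (ray_cross (Lf t (A k.+1))) x l.
  have := wsum_flow t (colA k%:Z) (path_hstep inGP E_ed hp); rewrite hl subrr Rf_ash.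
  by rewrite -[(k : int) + 1]/(Posz (k + 1)) addn1; lia.
have tel n : \sum_(k <- iota 0 n) wsum (stepf t (A k)) x l =
   wsum (ray_cross (Lf t (A 0))) x l - wsum (ray_cross (Lf t (A n))) x l.
  elim: n => [|n IH]; first by rewrite big_nil subrr.
  by rewrite -addn1 iotaD big_cat /= IH big_seq1 add0n F -addn1 ; lia.
rewrite tel ash0.
have c0 := col_Lf t (run_col run); rewrite (closed_out z2 zU zC inGP E_ed hp hl c0 (run_L run)).
have c1 := col_Rf t (colA r%:Z).
have := closed_out z2 zU zC inGP E_ed hp hl c1 (run_R run).
by rewrite Rf_ash -[(r : int) + 1]/(Posz (r + 1)) addn1 => ->.
Qed.

(* The number of signed crossings of the run on a way to [a0].  It does not
   depend on the way by [closed_cross], since both hexagons next to the ends of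
   the run lie outside [z], and it tells the two sides of the run apart. *)
Definition pot (v : pt) : int :=
  wsum cut_crossing v (xget [::] [set l | path adj v l /\ last v l = a0]%classic).

Lemma conn_a0 x y : adj x y -> conn E x a0.
Proof.
move=> xy; have [u uz] := z_in z2.
have h := adj_conn z2 zU zC inGP E_ed uz xy.
have ia : inG z t a0 by have := run_inG (leq0n r); rewrite ash0.
by have [h' _] := G_conn z2 zU zC inGP uz ia; apply: conn_trans (conn_sym h) h'.
Qed.

Lemma pot_path v l : path adj v l -> last v l = a0 -> wsum cut_crossing v l = pot v.
Proof.
move=> hp hl; rewrite /pot.
have := @xgetPex _ [::] [set l | path adj v l /\ last v l = a0]%classic.
case; first by exists l.
set m := xget _ _ => mp ml.
have [q [qp ql _]] : walk E a0 v (size l) by apply: walk_sym; exists l.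
have c1 := @closed_cross a0 (q ++ l); have c2 := @closed_cross a0 (q ++ m).
rewrite cat_path qp ql hp last_cat ql hl in c1; rewrite cat_path qp ql mp last_cat ql ml in c2.
by move: (c1 isT erefl) (c2 isT erefl); rewrite !wsum_cat ql; lia.
Qed.

Lemma pot_adj x y : adj x y -> pot x = cut_crossing x y + pot y.
Proof.
move=> xy; have yx := xy; rewrite gadjC in yx.
have [n [l [lp ll _]]] := conn_a0 yx.
by rewrite -(pot_path lp ll) -(@pot_path x (y :: l)) //= xy.
Qed.

Lemma pot_a0 : pot a0 = 0.
Proof. by rewrite -(@pot_path a0 [::]). Qed.

Lemma cut_crossing_neq t' b : t <> t' -> col b = 0 -> cut_crossing b (sh t' b) = 0 /\ cut_crossing (sh t' b) b = 0.
Proof.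
move=> tt cb; rewrite /cut_crossing; split; apply: big1_seq => k _;
  by case: (stepf_neq tt (colA k%:Z) cb).
Qed.

Lemma pot_neq t' b : inG z t' b -> t <> t' -> pot b = pot (sh t' b).
Proof.
move=> iG tt; rewrite (pot_adj (adj_ed inGP iG)).
by case: (cut_crossing_neq tt (inG_col iG)) => -> _; rewrite add0r.
Qed.

Lemma cut_crossing_val x y : hstep x y ->
  [\/ cut_crossing x y = 0,
      cut_crossing x y = 1 /\ exists2 k : nat, (k <= r)%N & x = A k /\ y = sh t (A k) |
      cut_crossing x y = -1 /\ exists2 k : nat, (k <= r)%N & y = A k /\ x = sh t (A k)].
Proof.
move=> _; rewrite /cut_crossing.
have S k : stepf t (A k) x y = 0 \/
    (stepf t (A k) x y = 1 /\ x = A k /\ y = sh t (A k)) \/ (stepf t (A k) x y = -1 /\ y = A k /\ x = sh t (A k)).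
  rewrite /stepf; case: eqP => [->|_] /=.
    have -> : (A k == sh t (A k)) = false by apply/eqP => /(congr1 col); rewrite col_sh colA.
    by case: eqP => [->|_] /=; [right; left|left].
  by case: eqP => [->|_] /=; [case: eqP => [->|_] /=; [right; right|left]|left].
have inj k k' : A k = A k' -> k = k' by move=> /ash_inj [].
have col01 k k' : A k = sh t (A k') -> False.
  by move=> /(congr1 col); rewrite col_sh !colA.
have [[k kr nz]|H] := pselect (exists2 k, k \in iota 0 r.+1 & stepf t (A k) x y != 0); last first.
  constructor 1; apply: big1_seq => k /= kr; apply/eqP/negPn/negP => h; by apply: H; exists k.
have other i : (i \in iota 0 r.+1) && (i != k) -> stepf t (A i) x y = 0.
  move=> /andP[_ /eqP ik]; case: (S i) => // K; exfalso; move: nz; case: (S k) => [->//|L] _.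
  case: K L => -[_ [e1 e2]] [] [_ [e3 e4]].
  - by apply: ik; apply: inj; rewrite -e1 -e3.
  - by apply: (col01 i k); rewrite -e1 -e4.
  - by apply: (col01 i k); rewrite -e1 -e4.
  - by apply: ik; apply: inj; rewrite -e1 -e3.
rewrite (bigD1_seq k) ?iota_uniq //= big_seq_cond big1 ?addr0; last by move=> i; apply: other.
move: kr; rewrite mem_iota add0n ltnS => /= kr.
case: (S k) nz => [->//|[[-> e]|[-> e]]] _; first by constructor 2; split=> //; exists k.
by constructor 3; split=> //; exists k.
Qed.

Lemma cut_crossing_A k : (k <= r)%N -> cut_crossing (A k) (sh t (A k)) = 1.
Proof.
have km : k \in iota 0 r.+1 -> cut_crossing (A k) (sh t (A k)) = 1; last by move=> kr; apply: km; rewrite mem_iota.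
move=> kr; rewrite /cut_crossing (bigD1_seq k kr (iota_uniq _ _)) /=.
have ns i j : (A i == sh t (A j)) = false.
  by apply/eqP => /(congr1 col); rewrite col_sh !colA.
rewrite big1 ?addr0; first by rewrite /stepf !eqxx ns.
move=> i ik; rewrite /stepf ns /=; case: eqP => //= /ash_inj [e]; by rewrite e eqxx in ik.
Qed.

Lemma zig_step k : (k < r)%N ->
  [/\ pot (A k) = pot (A k.+1), pot (sh t (A k)) = pot (sh t (A k.+1)),
      walk E (A k) (A k.+1) 2 & walk E (sh t (A k)) (sh t (A k.+1)) 2].
Proof.
move=> kr; have [i1 i2 [i3 i4]] := run_zig kr.
have tn : t <> nx t by case: (t).
have tnn : t <> nx (nx t) by case: (t).
have e1 : sh (nx (nx t)) (A k.+1) = sh (nx t) (A k).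
  by rewrite -(sh_sh_ash t (A k)) ashD.
have e3 : sh (nx (nx t)) (sh t (Rf t (A k))) = sh t (A k).
  by rewrite shC (Rf_sh t (A k)).1.
have e4 : sh (nx t) (sh t (Rf t (A k))) = sh t (A k.+1).
  by rewrite shC (Rf_sh t (A k)).2 ashD.
split.
- by rewrite (pot_neq i1 tn) (pot_neq i2 tnn) e1.
- by rewrite -e3 -e4 -(pot_neq i3 tnn) -(pot_neq i4 tn).
- apply: (@walk_cat _ _ _ (sh (nx t) (A k)) _ 1 1); apply: walk1; first exact: adj_ed i1.
  by rewrite gadjC -e1; exact: adj_ed i2.
- apply: (@walk_cat _ _ _ (sh t (Rf t (A k))) _ 1 1); apply: walk1.
    by rewrite gadjC -e3; exact: adj_ed i3.
  by rewrite -e4; exact: adj_ed i4.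
Qed.

Lemma pot_A k : (k <= r)%N -> pot (A k) = 0 /\ pot (sh t (A k)) = -1.
Proof.
move=> kr; have pA : pot (A k) = 0.
  elim: k kr => [|k IH] kr; first by rewrite ash0 pot_a0.
  by have [<- _ _ _] := zig_step kr; apply: IH; apply: ltnW.
split=> //; have := pot_adj (adj_ed inGP (run_inG kr)); rewrite pA cut_crossing_A //; lia.
Qed.

(** On the way to [a0] the potential changes only across an edge of the run, and there [pot_A] gives
    it at both ends. *)
Lemma pot01 v : conn E v a0 -> pot v = 0 \/ pot v = -1.
Proof.
case=> n [l [lp ll _]]; elim: l v lp ll => [|y l IH] v /=; first by move=> _ ->; left; rewrite pot_a0.
case/andP=> vy lp ll; rewrite (pot_adj vy).
case: (cut_crossing_val (adj_hstep inGP E_ed vy)).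
- by move=> ->; rewrite add0r; apply: IH.
- by case=> -> [k kr [_ ->]]; case: (pot_A kr) => _ ->; left.
- by case=> -> [k kr [-> _]]; case: (pot_A kr) => -> _; right.
Qed.

Definition beyond (v : pt) : bool := pot v == -1.

Lemma zig_walk (p : nat -> pt) : (forall k, (k < r)%N -> walk E (p k) (p k.+1) 2) ->
  forall i j, (i <= r)%N -> (j <= r)%N -> walk E (p i) (p j) (2 * adist i j).
Proof.
move=> H; have up i k : (i + k <= r)%N -> walk E (p i) (p (i + k)%N) (2 * k).
  elim: k => [|k IH] h; first by rewrite addn0; apply: walk0.
  by rewrite addnS mulnSr; apply: walk_cat (IH _) (H _ _); lia.
move=> i j ir jr; rewrite /adist; have [ij|ji] := leqP i j.
  by have := up i (j - i)%N; rewrite subnKC // (eqP ij) add0n; apply.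
have ji' := ltnW ji; rewrite (eqP ji') addn0; apply: walk_sym.
by have := up j (i - j)%N; rewrite subnKC //; apply.
Qed.

Lemma run_cut : cut_ok E beyond (fun k => A k) (fun k => sh t (A k)) r.
Proof.
split.
- by move=> j jr; apply: (adj_ed inGP (run_inG jr)).
- by move=> j jr; rewrite /beyond; case: (pot_A jr) => -> _.
- by move=> j jr; rewrite /beyond; case: (pot_A jr) => _ ->.
- move=> x y xy; rewrite /beyond => hx /eqP hy.
  have := pot_adj xy; case: (pot01 (conn_a0 xy)) => e; last by rewrite e in hx.
  rewrite e hy => h; case: (cut_crossing_val (adj_hstep inGP E_ed xy)) => [e'|[_ //]|[e' _]]; lia.
- by apply: zig_walk => k kr; case: (zig_step kr).
- by apply: zig_walk => k kr; case: (zig_step kr).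
- move=> i j m _ _ [l [lp ll <-]].
  have := level_path t (path_hstep inGP E_ed lp); rewrite ll !level_ash /adist; move: (level t a0) (size l) => L s; clear; lia.
- move=> i j m _ _ [l [lp ll <-]].
  by have := level_path t (path_hstep inGP E_ed lp); rewrite ll !level_sh !level_ash /adist; move: (level t a0) (size l) => L s; clear; case: (t); lia.
Qed.

Lemma beyond_edge t' a : inG z t' a -> ~ (t' = t /\ exists2 k : nat, (k <= r)%N & a = A k) -> beyond a = beyond (sh t' a).
Proof.
move=> ia nC; have xy := adj_ed inGP ia; rewrite /beyond (pot_adj xy).
case: (cut_crossing_val (adj_hstep inGP E_ed xy)) => [->|[_ [k kr [e1 e2]]]|[_ [k kr [e1 e2]]]]; first by rewrite add0r.
  exfalso; apply: nC; split; last by exists k.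
  by rewrite -(dir_of_sh t' a) e2 -e1 dir_of_sh.
by exfalso; have := congr1 col e1; rewrite col_sh (inG_col ia) colA.
Qed.

Definition side (c : bool) : {fset pt * pt} := [fset e in E | (beyond e.1 == c) && (beyond e.2 == c)].

Lemma run_M k : (k <= r)%N ->
  M1 E (ed t (A k)) = side false /\ M2 E (ed t (A k)) = side true.
Proof.
move=> kr; have [|-> ->] := cut_M run_cut kr.
  move=> f fE; have [t' [a e]] := E_ed fE; move: fE; rewrite e inGP => ia.
  have h1 := conn_a0 (adj_ed inGP ia); apply: conn_sym; apply: conn_trans h1 _.
  have h2 := adj_ed inGP (run_inG kr); rewrite gadjC in h2.
  exact: conn_sym (conn_a0 h2).
by split; apply/fsetP => e; rewrite !inE /=; do 2?case: (beyond _).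
Qed.

End Run.

(** * Counting the edges of a side *)

Lemma sum_sub (T : eqType) (E S : seq T) (P : pred T) (H : T -> int) :
  uniq E -> uniq S -> (forall e, (e \in E) && P e = (e \in S)) ->
  \sum_(e <- E | P e) H e = \sum_(e <- S) H e.
Proof.
move=> uE uS EP; rewrite -big_filter; apply: perm_big; apply: uniq_perm => //.
  exact: filter_uniq.
by move=> e; rewrite mem_filter andbC EP.
Qed.

Lemma sum_pick (T : eqType) (S : seq T) (x : T) (H : T -> int) : uniq S ->
  \sum_(f <- S) ib (f == x) * H f = ib (x \in S) * H x.
Proof.
move=> uS; have [xS|xS] := boolP (x \in S).
  rewrite (bigD1_seq x) //= eqxx big1 ?addr0 // => f fx; by rewrite (negPf fx) mul0r.
rewrite mul0r big1_seq // => f /= fS; case: eqP => [e|_]; last by rewrite mul0r.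
by rewrite -e fS in xS.
Qed.

Lemma card_sum (T : choiceType) (E : {fset T}) (P : pred T) :
  (#|` [fset e in E | P e]|%:Z = \sum_(e <- E) ib (P e)).
Proof.
have -> : \sum_(e <- E) ib (P e) = \sum_(e <- E | P e) 1.
  by rewrite [RHS]big_mkcond; apply: eq_bigr => e _; case: (P e).
rewrite -big_filter big_const_seq count_predT iter_addr addr0.
have -> : #|` [fset e in E | P e]| = size [seq e <- E | P e].
  apply: perm_size; apply: uniq_perm; rewrite ?fset_uniq ?filter_uniq ?fset_uniq //.
  by move=> x; rewrite mem_filter !inE andbC.
by rewrite natz.
Qed.

Definition eqd (t t' : dir) : bool :=
  match t, t' with T0, T0 | T1, T1 | T2, T2 => true | _, _ => false end.
Lemma eqdP t t' : reflect (t = t') (eqd t t').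
Proof. by case: t t' => -[]; constructor. Qed.

Section Count.
Variable z : seq pt.
Hypotheses (z2 : (2 < size z)%N) (zU : uniq z) (zC : cycle hstep z).
Notation w := (winding z).
Notation nz := (next z).
Variable E : {fset pt * pt}.
Hypothesis inGP : forall t a, (ed t a \in E) = inG z t a.
Hypothesis E_ed : forall e, e \in E -> exists t a, e = ed t a.
Variable sg : int.
Hypothesis sg1 : sg = 1 \/ sg = -1.
Hypothesis wsg : forall f, col f = 2 -> w f = 0 \/ w f = sg.

Lemma DS_ex : exists DS : seq pt, uniq DS /\
  forall f, (f \in DS) = (col f == 2) && (w f != 0).
Proof.
have [M hM] := winding_bounded z2 zU zC.
pose rg := [seq (Posz i) - `|M| | i <- iota 0 `|(2 * M + 1)%R|%N.+1].
have rgP x : `|x| <= M -> x \in rg.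
  move=> h; apply/mapP; exists `|(x + `|M|)%R|%N; last lia.
  rewrite mem_iota; lia.
exists (undup [seq f <- [seq ((x, y) : pt) | x <- rg, y <- rg] | (col f == 2) && (w f != 0)]).
split; first exact: undup_uniq.
move=> f; rewrite mem_undup mem_filter; apply/andP/idP => [[]//|fD]; split=> //.
have /andP[/eqP cf wf] := fD; have /andP[h1 h2] := hM _ cf wf.
apply/allpairsP; exists (f.1, f.2); split; [exact: rgP|exact: rgP|by case: (f)].
Qed.

Definition lface (e : pt * pt) := Lf (dir_of e.1 e.2) e.1.
Definition rface (e : pt * pt) := Rf (dir_of e.1 e.2) e.1.

Lemma lface_ed t a : lface (ed t a) = Lf t a. Proof. by rewrite /lface dir_of_sh. Qed.
Lemma rface_ed t a : rface (ed t a) = Rf t a. Proof. by rewrite /rface dir_of_sh. Qed.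

(** An exchange of the sums over edges and faces: for each direction [t] an inside face lies to the
    left of exactly one edge, the one from [sh (nx t) f], and this edge is in [E]. *)
Lemma flux_L (DS : seq pt) (G : pt * pt -> int) (F : pt -> int) :
  uniq DS -> (forall f, (f \in DS) = (col f == 2) && (w f != 0)) ->
  \sum_(e <- E) G e * (F (lface e) * ib (w (lface e) != 0)) =
  \sum_(f <- DS) F f * (G (ed T0 (sh T1 f)) + G (ed T1 (sh T2 f)) + G (ed T2 (sh T0 f))).
Proof.
move=> uD DP.
transitivity (\sum_(e <- E) \sum_(f <- DS) ib (f == lface e) * (G e * F f)).
  apply: eq_big_seq => e eE; rewrite (sum_pick _ (fun f => G e * F f)) // DP.
  have [t [a ee]] := E_ed eE; have ca : col a = 0 by move: eE; rewrite ee inGP => /inG_col.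
  by rewrite ee lface_ed col_Lf //=; lia.
rewrite exchange_big; apply: eq_big_seq => f fD.
have /andP[/eqP cf wf] : (col f == 2) && (w f != 0) by rewrite -DP.
transitivity (\sum_(e <- E | f == lface e) G e * F f).
  by rewrite [RHS]big_mkcond; apply: eq_bigr => e _; case: eqP; rewrite ?mul1r ?mul0r.
rewrite (@sum_sub _ _ [:: ed T0 (sh T1 f); ed T1 (sh T2 f); ed T2 (sh T0 f)]) ?fset_uniq //.
- by rewrite !big_cons big_nil addr0; lia.
- rewrite /= !inE !negb_or; do !(apply/andP; split=> //); apply/eqP => /ed_inj[]; by [].
- move=> e; rewrite !inE; apply/andP/idP.
    case=> eE /eqP map_edge; have [t [a ee]] := E_ed eE.
    have : a = sh (nx t) f by rewrite map_edge ee lface_ed /Lf sh_us.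
    by rewrite ee => ->; case: (t) => /=; rewrite eqxx ?orbT.
  have H t : ed t (sh (nx t) f) \in E /\ f == lface (ed t (sh (nx t) f)).
    by rewrite inGP lface_ed /Lf us_sh eqxx; case: (face_inE t cf wf).
  by case/or3P => /eqP->; [case: (H T0)|case: (H T1)|case: (H T2)].
Qed.

Lemma flux_R (DS : seq pt) (G : pt * pt -> int) (F : pt -> int) :
  uniq DS -> (forall f, (f \in DS) = (col f == 2) && (w f != 0)) ->
  \sum_(e <- E) G e * (F (rface e) * ib (w (rface e) != 0)) =
  \sum_(f <- DS) F f * (G (ed T0 (sh T2 f)) + G (ed T1 (sh T0 f)) + G (ed T2 (sh T1 f))).
Proof.
move=> uD DP.
transitivity (\sum_(e <- E) \sum_(f <- DS) ib (f == rface e) * (G e * F f)).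
  apply: eq_big_seq => e eE; rewrite (sum_pick _ (fun f => G e * F f)) // DP.
  have [t [a ee]] := E_ed eE; have ca : col a = 0 by move: eE; rewrite ee inGP => /inG_col.
  by rewrite ee rface_ed col_Rf //=; lia.
rewrite exchange_big; apply: eq_big_seq => f fD.
have /andP[/eqP cf wf] : (col f == 2) && (w f != 0) by rewrite -DP.
transitivity (\sum_(e <- E | f == rface e) G e * F f).
  by rewrite [RHS]big_mkcond; apply: eq_bigr => e _; case: eqP; rewrite ?mul1r ?mul0r.
rewrite (@sum_sub _ _ [:: ed T0 (sh T2 f); ed T1 (sh T0 f); ed T2 (sh T1 f)]) ?fset_uniq //.
- by rewrite !big_cons big_nil addr0; lia.
- rewrite /= !inE !negb_or; do !(apply/andP; split=> //); apply/eqP => /ed_inj[]; by [].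
- move=> e; rewrite !inE; apply/andP/idP.
    case=> eE /eqP map_edge; have [t [a ee]] := E_ed eE.
    have : a = sh (nx (nx t)) f by rewrite map_edge ee rface_ed /Rf sh_us.
    by rewrite ee => ->; case: (t) => /=; rewrite eqxx ?orbT.
  have H t : ed t (sh (nx (nx t)) f) \in E /\ f == rface (ed t (sh (nx (nx t)) f)).
    by rewrite inGP rface_ed /Rf us_sh eqxx; case: (face_inE t cf wf).
  by case/or3P => /eqP->; [case: (H T0)|case: (H T1)|case: (H T2)].
Qed.

Definition ez (u : pt) : pt * pt := if col u == 0 then (u, nz u) else (nz u, u).
Definition sgn (u : pt) : int := if col u == 0 then 1 else -1.

Lemma ez_ed u : u \in z -> exists t, ez u = ed t (ez u).1 /\ Zedge z t (ez u).1 /\ col (ez u).1 = 0.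
Proof.
move=> uz; have hs := hstep_nz zC uz; rewrite /ez /Zedge; case/orP: (hstep_col hs) => /eqP cu; rewrite cu /=.
  by have [e c] := hstep_even hs cu; exists (dir_of u (nz u)); rewrite /ed -e uz eqxx.
by have [e c] := hstep_odd hs cu; exists (dir_of (nz u) u); rewrite /ed -e uz eqxx orbT.
Qed.

Lemma ez_E u : u \in z -> ez u \in E.
Proof.
move=> uz; have [t [e [Z c]]] := ez_ed uz; rewrite e inGP; exact: (Zedge_inE z2 zU zC).
Qed.

Lemma stepf_ez t a u : u \in z -> col a = 0 ->
  stepf t a u (nz u) = sgn u * ib (ez u == ed t a) /\
  ib ((u == a) && (nz u == sh t a)) + ib ((u == sh t a) && (nz u == a)) = ib (ez u == ed t a).
Proof.
move=> uz ca; have cs : col (sh t a) = 1 by rewrite col_sh ca.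
rewrite /stepf /sgn /ez /ed; case: (hstep_col (hstep_nz zC uz)) => /orP[]/eqP cu; rewrite cu /=.
  have -> : (u == sh t a) = false by apply/eqP => e; rewrite e cs in cu.
  by rewrite xpair_eqE /=; lia.
have -> : (u == a) = false by apply/eqP => e; rewrite e ca in cu.
by rewrite xpair_eqE andbC /=; lia.
Qed.

Lemma flow_ez e : e \in E -> w (lface e) - w (rface e) = \sum_(u <- z) sgn u * ib (ez u == e).
Proof.
move=> eE; have [t [a ee]] := E_ed eE; have ca : col a = 0 by move: eE; rewrite ee inGP => /inG_col.
rewrite ee lface_ed rface_ed (winding_flow z2 zU zC t ca) /edge_flow; apply: eq_big_seq => u uz.
by case: (stepf_ez t uz ca).
Qed.

(** An edge of [E] off [z] has two inside faces, an edge on [z] has exactly one, and [z] traverses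
    no edge twice. *)
Lemma two_faces e : e \in E -> 2 = ib (w (lface e) != 0) + ib (w (rface e) != 0) + \sum_(u <- z) ib (ez u == e).
Proof.
move=> eE; have [t [a ee]] := E_ed eE; have ia : inG z t a by rewrite -inGP -ee.
have ca := inG_col ia.
have -> : \sum_(u <- z) ib (ez u == e) = ib (Zedge z t a).
  transitivity (\sum_(u <- z) (ib ((u == a) && (nz u == sh t a)) + ib ((u == sh t a) && (nz u == a)))).
    by apply: eq_big_seq => u uz; rewrite ee; case: (stepf_ez t uz ca).
  rewrite big_split /= (sum_ib zU (fun u => nz u == sh t a)) (sum_ib zU (fun u => nz u == a)) /Zedge.
  case: andP => [[az /eqP na]|_] /=; last by rewrite add0r.
  by rewrite -na (negPf (next2 z2 zU az)) andbF addr0.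
rewrite ee lface_ed rface_ed.
have wl := wsg (col_Lf t ca); have wr := wsg (col_Rf t ca).
have [Z|nZ] := boolP (Zedge z t a).
  have zw := winding_on_edge z2 zU zC ca Z; move: (w (Lf t a)) (w (Rf t a)) sg sg1 wl wr zw => x y s; clear.
  by case: eqP; case: eqP; lia.
by move: ia; rewrite /inG ca /= (winding_off_edge z2 zU zC ca nZ) orbb => ->.
Qed.

Lemma sum_ez (G : pt * pt -> int) (s : pt -> int) :
  \sum_(e <- E) G e * \sum_(u <- z) s u * ib (ez u == e) = \sum_(u <- z) s u * G (ez u).
Proof.
transitivity (\sum_(e <- E) \sum_(u <- z) ib (e == ez u) * (s u * G e)).
  apply: eq_bigr => e _; rewrite mulr_sumr; apply: eq_bigr => u _; rewrite eq_sym.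
  by case: (e == ez u); rewrite ?mul1r ?mulr1 ?mul0r ?mulr0 ?mulr0 // mulrC.
rewrite exchange_big; apply: eq_big_seq => u uz.
by rewrite (sum_pick _ (fun e => s u * G e)) ?fset_uniq // ez_E // mul1r.
Qed.

Section Run.
Variables (t : dir) (a0 : pt) (r : nat).
Hypothesis run : is_run z t a0 r.
Notation A k := (ash t k%:Z a0).
Notation h := (beyond E t a0 r).
Variable c : bool.

Definition U (e : pt * pt) : int := ib ((h e.1 == c) && (h e.2 == c)).
Definition nu f := U (ed t (sh (nx t) f)).
Definition run_faces := [seq Rf t (A k) | k <- iota 0 r].

(** All corners of a hexagon off the run are on one side, so its six edges count alike. A hexagon of
    the run has two edges in the cut, where [U] is 0, so that [nu f] is 0, and two edges on each
    side. *)
Lemma inner_edges_face f : col f = 2 -> w f != 0 ->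
  U (ed t (sh (nx (nx t)) f)) = nu f /\
  U (ed T0 (sh T1 f)) + U (ed T1 (sh T2 f)) + U (ed T2 (sh T0 f)) +
  (U (ed T0 (sh T2 f)) + U (ed T1 (sh T0 f)) + U (ed T2 (sh T1 f))) = 6 * nu f + 2 * ib (f \in run_faces).
Proof.
move=> cf wf.
have he := beyond_edge z2 zU zC inGP E_ed run.
have edU s a : inG z s a -> ~ (s = t /\ exists2 k : nat, (k <= r)%N & a = A k) ->
    U (ed s a) = ib (h a == c).
  by move=> h1 h2; rewrite /U /= -(he _ _ h1 h2) andbb.
have inf s := face_inE s cf wf.
have s1 s := sh_sh s f. have s2 s := sh_sh2 s f.
have pA k (kr : (k <= r)%N) : h (A k) = false /\ h (sh t (A k)) = true.
  by rewrite /beyond; case: (pot_A z2 zU zC inGP E_ed run kr) => -> ->.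
have [fr|fr] := boolP (f \in run_faces).
  case/mapP: (fr) => k; rewrite mem_iota add0n => /= kr fE.
  have [e1 e2] := Rf_sh t (A k); rewrite ashD (_ : 1 + k%:Z = k.+1%:Z) // -fE in e1 e2.
  have [p1 p2] := pA _ (ltnW kr); have [p3 p4] := pA _ kr.
  rewrite -e1 sh_sh2 in p1 p2; rewrite -e2 sh_sh in p3 p4.
  have [i1 i2 [i3 i4]] := run_zig run kr.
  rewrite -fE in i3 i4.
  have nt : nx t <> t by case: (t).
  have nnt : nx (nx t) <> t by case: (t).
  have q1 := he _ _ i1 (fun H => nt H.1); rewrite -e1 p1 in q1.
  have q3 := he _ _ i3 (fun H => nnt H.1).
  have E1 : sh (nx t) (sh (nx (nx t)) f) = us t f by rewrite sh_sh; case: (t).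
  have E3 : sh (nx (nx t)) (sh t f) = us (nx t) f by rewrite -sh_sh2 shC.
  rewrite E1 in q1; rewrite E3 p2 in q3.
  rewrite /nu /U /=; move: (beyond E t a0 r) p1 p2 p3 p4 q1 q3 => h'.
  have a0' := s1 T0; have a1' := s1 T1; have a2' := s1 T2.
  have b0' := s2 T0; have b1' := s2 T1; have b2' := s2 T2.
  rewrite /= in a0' a1' a2' b0' b1' b2'.
  by case: (t) => /=; rewrite ?a0' ?a1' ?a2' ?b0' ?b1' ?b2' => -> -> -> -> <- ->; case: (c).
have nin (a : pt) (k : nat) : (k <= r)%N -> a = A k -> f = Lf t a \/ f = Rf t a -> False.
  move=> kr -> [] fE.
    case: k kr fE => [|k] kr fE; first by move: wf; rewrite fE ash0 (run_L run) eqxx.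
    move/negP: fr; apply; apply/mapP; exists k; first by rewrite mem_iota add0n.
    by rewrite fE Rf_ash; congr (Lf _ (ash _ _ _)); lia.
  move: kr; rewrite leq_eqVlt => /orP[/eqP e|kr].
    by move: wf; rewrite fE e (run_R run) eqxx.
  by move/negP: fr; apply; apply/mapP; exists k => //; rewrite mem_iota add0n.
have nL s : ~ (s = t /\ exists2 k : nat, (k <= r)%N & sh (nx s) f = A k).
  by case=> -> [k kr e]; apply: (nin _ _ kr e); left; rewrite /Lf us_sh.
have nR s : ~ (s = t /\ exists2 k : nat, (k <= r)%N & sh (nx (nx s)) f = A k).
  by case=> -> [k kr e]; apply: (nin _ _ kr e); right; rewrite /Rf us_sh.
have hL s := he _ _ (inf s).1 (@nL s). have hR s := he _ _ (inf s).2 (@nR s).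
rewrite /nu /U /=; move: (beyond E t a0 r) hL hR => h' hL hR.
have a0' := hL T0; have a1' := hL T1; have a2' := hL T2.
have b0' := hR T0; have b1' := hR T1; have b2' := hR T2.
rewrite /= in a0' a1' a2' b0' b1' b2'.
rewrite -!a0' -!a1' -!a2' -!b0' -!b1' -!b2'.
have c0' := s1 T0; have c1' := s1 T1; have c2' := s1 T2.
have d0' := s2 T0; have d1' := s2 T1; have d2' := s2 T2.
rewrite /= in c0' c1' c2' d0' d1' d2'.
have e01 : h' (sh T1 f) = h' (sh T0 f) by rewrite a0' c0' -d1' -b1'.
have e02 : h' (sh T2 f) = h' (sh T0 f) by rewrite b0' d0' -c2' -a2'.
case: (t) => /=; rewrite -?a0' -?a1' -?a2' -?b0' -?b1' -?b2' e01 e02 !andbb; split=> //; by case: (_ == c).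
Qed.

Hypothesis hsg : sg != 0.

(* Twice the number of edges of a side is six times the number of its hexagons,
   plus [2 r] for the hexagons of the run itself, plus the number of its edges
   on [z], as an edge of [G] has two sides, each of which lies in a hexagon or
   is outside [z].  The number of hexagons is expressed by a sum over [z] with
   Green's formula for the function [b]. *)
Lemma run_count (b : pt -> int) : (forall a, b (ash t 1 a) = b a + 1) ->
  2 * #|` side E t a0 r c|%:Z =
  6 * sg * (\sum_(u <- z) sgn u * (ib (eqd (dir_of (ez u).1 (ez u).2) t) * (b (ez u).1 * U (ez u))))
  + 2 * r%:Z + \sum_(u <- z) U (ez u).
Proof.
move=> bS; have [DS [uD DP]] := DS_ex.
have DSw f : f \in DS -> col f = 2 /\ w f != 0 by rewrite DP => /andP[/eqP].
set SZ := \sum_(u <- z) U (ez u).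
have six : 2 * #|` side E t a0 r c|%:Z = \sum_(f <- DS) (6 * nu f + 2 * ib (f \in run_faces)) + SZ.
  rewrite /side (card_sum E (fun e => (h e.1 == c) && (h e.2 == c))) mulr_sumr.
  transitivity (\sum_(e <- E) (U e * (1 * ib (w (lface e) != 0)) + U e * (1 * ib (w (rface e) != 0)) +
      U e * \sum_(u <- z) 1 * ib (ez u == e))).
    apply: eq_big_seq => e eE; rewrite mulrC {1}(two_faces eE) -/(U e) !mulrDr !mul1r.
    by congr (_ + U e * _); apply: eq_bigr => u _; rewrite mul1r.
  set S6 := \sum_(f <- DS) (6 * _ + _).
  rewrite !big_split /= (sum_ez U (fun=> 1)) (flux_L U (fun=> 1) uD DP) (flux_R U (fun=> 1) uD DP).
  rewrite -big_split /SZ /S6 /=; congr (_ + _); last by apply: eq_bigr => u _; rewrite mul1r.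
  by apply: eq_big_seq => f /DSw[cf wf]; rewrite !mul1r; case: (inner_edges_face cf wf).
have runS : \sum_(f <- DS) ib (f \in run_faces) = r%:Z.
  transitivity (\sum_(f <- DS | f \in run_faces) 1 : int).
    by rewrite [RHS]big_mkcond; apply: eq_bigr => e _; case: (e \in run_faces).
  have uR : uniq run_faces.
    rewrite map_inj_uniq ?iota_uniq // => i j e; have [e1 _] := Rf_sh t (A i); have [e2 _] := Rf_sh t (A j).
    by move: e1; rewrite e e2 => /ash_inj[].
  rewrite (@sum_sub _ DS run_faces) //; last first.
    move=> f; apply/andP/idP => [[]//|fr]; split=> //.
    case/mapP: fr => k; rewrite mem_iota add0n => /= kr ->.
    by rewrite DP (run_in run kr) col_Rf ?col_ash ?(run_col run).
  by rewrite big_const_seq count_predT size_map size_iota iter_addr addr0 natz.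
set G := fun e : pt * pt => ib (eqd (dir_of e.1 e.2) t) * (b e.1 * U e).
have area : \sum_(u <- z) sgn u * G (ez u) = sg * \sum_(f <- DS) nu f.
  rewrite -(sum_ez G sgn).
  transitivity (\sum_(e <- E) (G e * (w (lface e) * ib (w (lface e) != 0)) - G e * (w (rface e) * ib (w (rface e) != 0)))).
    apply: eq_big_seq => e eE; rewrite -flow_ez // mulrBr.
    by congr (_ - _); case: eqP => [->|_]; rewrite ?mul0r ?mulr1.
  rewrite sumrB (flux_L G w uD DP) (flux_R G w uD DP) -sumrB mulr_sumr.
  apply: eq_big_seq => f /DSw[cf wf].
  have -> : w f = sg by case: (wsg cf) => // e; rewrite e eqxx in wf.
  have [e1 _] := inner_edges_face cf wf; rewrite -mulrBr; congr (_ * _).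
  have bb : b (sh (nx t) f) = b (sh (nx (nx t)) f) + 1.
    rewrite -bS; congr b; case: (f) => u v; case: (t); rewrite /ash /sh /=; congr pair; lia.
  have GE s a : G (ed s a) = if eqd s t then b a * U (ed s a) else 0.
    by rewrite /G /= dir_of_sh; case: eqd; rewrite ?mul1r ?mul0r.
  rewrite !GE; move: e1 bb; rewrite /nu; case: (t) => /= -> ->; rewrite !(add0r, addr0, sub0r) -mulrBl; lia.
rewrite six /SZ area big_split /= -!mulr_sumr runS.
have -> : 6 * sg * (sg * \sum_(f <- DS) nu f) = 6 * \sum_(f <- DS) nu f.
  by case: sg1 => ->; lia.
by [].
Qed.
End Run.
End Count.

(* Three times the position of an edge in its row, and three times the number of
   its row, up to constants. *)
Definition lpos t (p : pt) : int :=
  match t with T0 => p.2 - p.1 | T1 => - p.1 - 2 * p.2 | T2 => 2 * p.1 + p.2 end.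
Definition lrow t (p : pt) : int :=
  match t with T0 => - 2 * p.1 - p.2 | T1 => p.1 - p.2 | T2 => p.1 + 2 * p.2 end.

Lemma lpos_ash t k a : lpos t (ash t k a) = lpos t a + 3 * k.
Proof. by case: a => u v; case: t; rewrite /lpos /ash /=; lia. Qed.
Lemma lrow_ash t k a : lrow t (ash t k a) = lrow t a.
Proof. by case: a => u v; case: t; rewrite /lrow /ash /=; lia. Qed.
Lemma lpos_mod t a : col a = 0 -> (lpos t a %% 3)%Z = 0.
Proof. by case: a => u v; rewrite /col; case: t; rewrite /lpos /=; lia. Qed.
Lemma lrow_inj t a a' : lrow t a = lrow t a' -> a' = ash t ((lpos t a' - lpos t a) %/ 3)%Z a.
Proof.
case: a a' => u v [u' v']; case: t; rewrite /lrow /lpos /ash /= => h; congr pair; lia.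
Qed.

Lemma arc_bool (H : nat -> bool) i j n : (i < j)%N -> (j < n)%N ->
  (forall k, (k < n)%N -> k <> i -> k <> j -> H k = H k.+1) ->
  H i.+1 = ~~ H i -> H j.+1 = ~~ H j -> forall k, (k < n)%N ->
  (H k == H i.+1) && (H k.+1 == H i.+1) = (i < k)%N && (k < j)%N /\
  (H k == ~~ H i.+1) && (H k.+1 == ~~ H i.+1) = (k < i)%N || (j < k)%N.
Proof.
move=> ij jn hsame hi hj; set c := H i.+1.
have hin m : (i < m <= j)%N -> H m = c.
  elim: m => [//|m IH] /andP[im mj]; have [e|ne] := eqVneq m i; first by rewrite e.
  by rewrite -hsame ?IH //; lia.
have h0 m : (m <= i)%N -> H m = H 0%N.
  by elim: m => [//|m IH] mi; rewrite -hsame ?IH //; lia.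
have {}hi : H i = ~~ c by rewrite /c hi negbK.
have hlow m : (m <= i)%N -> H m = ~~ c by move=> mi; rewrite h0 // -(h0 i) // hi.
have {}hj : H j.+1 = ~~ c by rewrite hj hin // ij leqnn.
have hhigh m : (j < m <= n)%N -> H m = ~~ c.
  elim: m => [//|m IH] /andP[jm mn]; have [e|ne] := eqVneq m j; first by rewrite e.
  by rewrite -hsame ?IH //; lia.
have cN : (c == ~~ c) = false by case: (c).
have Nc : (~~ c == c) = false by case: (c).
move=> k kn; have [ki|ik|ek] := ltngtP k i.
- by rewrite !hlow // ?eqxx ?Nc //; lia.
- have [kj|jk|ek] := ltngtP k j; first by rewrite !hin ?eqxx ?cN //; lia.
    by rewrite !hhigh ?eqxx ?Nc //; lia.
  by rewrite ek hj hin ?eqxx ?Nc ?cN ?ij ?leqnn.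
by rewrite ek hi -/c eqxx Nc cN; split=> //; lia.
Qed.

(** * The sides of a run and the arcs of the cycle *)

Section Arc.
Variable z : seq pt.
Hypotheses (z2 : (2 < size z)%N) (zU : uniq z) (zC : cycle hstep z).
Notation w := (winding z).
Notation nz := (next z).
Notation n := (size z).

Definition zn (k : nat) : pt := nth (0, 0) z (k %% n).

Lemma n_gt0 : (0 < n)%N. Proof. by apply: leq_trans z2. Qed.
Lemma zn_in k : zn k \in z. Proof. by rewrite mem_nth // ltn_mod n_gt0. Qed.

Lemma nz_zn k : nz (zn k) = zn k.+1.
Proof.
have hk : (k %% n < n)%N by rewrite ltn_mod n_gt0.
rewrite /zn next_nth mem_nth //.
case E : z => [|x p]; first by move: z2; rewrite E.
rewrite -E index_uniq // -addn1 -modnDml addn1.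
have [lt|ge] := ltnP (k %% n).+1 n.
  by rewrite (modn_small lt) E /=; apply: set_nth_default; move: lt; rewrite E.
have -> : (k %% n).+1 = n by apply/eqP; rewrite eqn_leq hk ge.
by rewrite modnn [in RHS]E /= nth_default //; move: ge; rewrite E.
Qed.

Lemma zn_inj i j : (i < n)%N -> (j < n)%N -> zn i = zn j -> i = j.
Proof. by move=> hi hj /eqP; rewrite /zn !modn_small // nth_uniq // => /eqP. Qed.

(** The only danger is an edge traversed in both directions, which [next2] excludes. *)
Lemma ez_inj u v : u \in z -> v \in z -> ez z u = ez z v -> u = v.
Proof.
move=> uz vz; rewrite /ez; case: ifP => cu; case: ifP => cv.
- by move=> e; exact: (congr1 fst e).
- move=> e; have e1 : u = nz v := congr1 fst e; have e2 : nz u = v := congr1 snd e.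
  by have := next2 z2 zU vz; rewrite -e1 e2 eqxx.
- move=> e; have e1 : nz u = v := congr1 fst e; have e2 : u = nz v := congr1 snd e.
  by have := next2 z2 zU vz; rewrite -e2 e1 eqxx.
- by move=> e; exact: (congr1 snd e).
Qed.

Lemma sum_zn (F : pt -> int) : \sum_(u <- z) F u = \sum_(0 <= k < n) F (zn k).
Proof.
rewrite (big_nth (0, 0)); apply: eq_big_nat => k /andP[_ kn].
by rewrite /zn modn_small.
Qed.

Lemma sum_arc (X : nat -> int) i j : (i < j)%N -> (j < n)%N ->
  \sum_(0 <= k < n) ib ((i < k) && (k < j))%N * X k =
     \sum_(0 <= k < j) X k - \sum_(0 <= k < i.+1) X k /\
  \sum_(0 <= k < n) ib ((k < i) || (j < k))%N * X k =
     \sum_(0 <= k < n) X k - \sum_(0 <= k < j.+1) X k + \sum_(0 <= k < i) X k.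
Proof.
move=> ij jn.
have S (Q : pred nat) (p q : nat) (b : bool) : (forall k, (p <= k < q)%N -> Q k = b) ->
    \sum_(p <= k < q) ib (Q k) * X k = ib b * \sum_(p <= k < q) X k.
  by move=> H; rewrite mulr_sumr; apply: eq_big_nat => k /H ->.
have E (Q : pred nat) : \sum_(0 <= k < n) ib (Q k) * X k =
   \sum_(0 <= k < i) ib (Q k) * X k + ib (Q i) * X i + \sum_(i.+1 <= k < j) ib (Q k) * X k +
   ib (Q j) * X j + \sum_(j.+1 <= k < n) ib (Q k) * X k.
  rewrite (@big_cat_nat _ _ _ i) //=; last by lia.
  rewrite (@big_ltn _ _ _ i n) //=; last by lia.
  rewrite (@big_cat_nat _ _ _ j i.+1 n) //=; last by lia.
  by rewrite (@big_ltn _ _ _ j n) //= !addrA.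
have E1 m (jm : (j.+1 <= m)%N) : \sum_(0 <= k < m) X k = \sum_(0 <= k < i) X k + X i + \sum_(i.+1 <= k < j) X k + X j + \sum_(j.+1 <= k < m) X k.
  rewrite (@big_cat_nat _ _ _ i) //=; last by lia.
  rewrite (@big_ltn _ _ _ i m) //=; last by lia.
  rewrite (@big_cat_nat _ _ _ j i.+1 m) //=; last by lia.
  by rewrite (@big_ltn _ _ _ j m) //= !addrA.
have E2 : \sum_(0 <= k < j) X k = \sum_(0 <= k < i) X k + X i + \sum_(i.+1 <= k < j) X k.
  rewrite (@big_cat_nat _ _ _ i) //=; last by lia.
  by rewrite (@big_ltn _ _ _ i j) //= addrA.
have E3 : \sum_(0 <= k < i.+1) X k = \sum_(0 <= k < i) X k + X i by rewrite big_nat_recr.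
split.
  rewrite (E (fun k => (i < k) && (k < j))%N) ltnn ltnn andbF mul0r mul0r.
  rewrite (S _ 0%N i false) 1?(S _ i.+1 j true) 1?(S _ j.+1 n false); try by move=> k; lia.
  rewrite E2 E3 !(mul0r, mul1r); lia.
rewrite (E (fun k => (k < i) || (j < k))%N) ltnn ltnn orbF.
have -> : (j < i)%N = false by lia.
rewrite (S _ 0%N i true) 1?(S _ i.+1 j false) 1?(S _ j.+1 n true); try by move=> k; lia.
rewrite (E1 n) // (E1 j.+1) // (big_geq (leqnn _)) !(mul0r, mul1r); lia.
Qed.

Variable E : {fset pt * pt}.
Hypothesis inGP : forall t a, (ed t a \in E) = inG z t a.
Hypothesis E_ed : forall e, e \in E -> exists t a, e = ed t a.
Variable sg : int.
Hypothesis sg1 : sg = 1 \/ sg = -1.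
Hypothesis wsg : forall f, col f = 2 -> w f = 0 \/ w f = sg.

Definition is_step t k : bool := eqd (dir_of (ez z (zn k)).1 (ez z (zn k)).2) t.
Definition ak k : pt := (ez z (zn k)).1.
Definition sk k : int := sgn (zn k).

Lemma is_step_ez t k : is_step t k -> [/\ ez z (zn k) = ed t (ak k), col (ak k) = 0 & Zedge z t (ak k)].
Proof.
move=> /eqdP tt; have [t' [e [Z c]]] := ez_ed zC (zn_in k).
by rewrite /ak; move: tt; rewrite {1 2}e /= dir_of_sh => <-.
Qed.

Lemma Z_sides t a : col a = 0 -> Zedge z t a -> (w (Lf t a) != 0) = (w (Rf t a) == 0).
Proof.
move=> ca Z; have := wsg (col_Lf t ca); have := wsg (col_Rf t ca).
move: (winding_on_edge z2 zU zC ca Z); move: (w _) (w _) sg sg1 => x y s; clear.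
by case: eqP; case: eqP; lia.
Qed.

Lemma sg_neq0 : sg != 0. Proof. by case: sg1 => ->. Qed.

(** Along [z] the function [beyond] flips exactly at the steps [kl] and [kr], so the steps of an arc
    between them all lie on one side, and the sums of [run_count] become differences of prefix sums.
    Which side belongs to the arc from [i] to [j] depends on the orientation, whence the [exists c];
    the product of the two counts does not depend on it. *)
Lemma run_arc t r kl kr (b : pt -> int) : (forall a, b (ash t 1 a) = b a + 1) ->
  (kl < n)%N -> (kr < n)%N -> is_step t kl -> is_step t kr -> is_run z t (ak kl) r ->
  ak kr = ash t r%:Z (ak kl) ->
  let PS m := \sum_(0 <= k < m) (ib (is_step t k) * (sk k * b (ak k))) in
  let i := minn kl kr in let j := maxn kl kr in
  exists c, 2 * #|` side E t (ak kl) r c|%:Z = 6 * sg * (PS j - PS i.+1) + 2 * r%:Z + (j%:Z - i%:Z - 1)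
  /\ 2 * #|` side E t (ak kl) r (~~ c)|%:Z = 6 * sg * (PS n - PS j.+1 + PS i) + 2 * r%:Z + (n%:Z - 1 - (j%:Z - i%:Z)).
Proof.
move=> bS kln krn tl tr run akr PS i j.
pose h := beyond E t (ak kl) r.
have [el cl Zl] := is_step_ez tl. have [er cr Zr] := is_step_ez tr.
have rp := run_pos run.
have neq : kl <> kr.
  move=> e; have := akr; rewrite -e -{1}(ash0 t (ak kl)) => /ash_inj [] e0; by rewrite -e0 in rp.
have ij : (i < j)%N by rewrite /i /j; lia.
have jn : (j < n)%N by rewrite /j; lia.
have pA k (kr' : (k <= r)%N) : h (ash t k%:Z (ak kl)) = false /\ h (sh t (ash t k%:Z (ak kl))) = true.
  by rewrite /h /beyond; case: (pot_A z2 zU zC inGP E_ed run kr') => -> ->.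
have hez k : (ez z (zn k) = (zn k, zn k.+1) \/ ez z (zn k) = (zn k.+1, zn k)).
  by rewrite /ez nz_zn; case: ifP; auto.
have hsame k : (k < n)%N -> k <> i -> k <> j -> h (zn k) = h (zn k.+1).
  move=> kn ki kj; have [s [e [Z c]]] := ez_ed zC (zn_in k).
  have iE : inG z s (ez z (zn k)).1 by rewrite -inGP -e; apply: (ez_E z2 zU zC inGP); apply: zn_in.
  have := beyond_edge z2 zU zC inGP E_ed run iE.
  rewrite -/h -[sh s _]/(ed s (ez z (zn k)).1).2 -e.
  move=> H; have {}H : h (ez z (zn k)).1 = h (ez z (zn k)).2.
    apply: H => -[st [q qr eq]]; have ca := run_col run.
    rewrite st eq in Z e.
    (* A middle edge of the run has inside hexagons on both sides, whereas an edge of [z] has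
       exactly one. *)
    have q0 : (q == 0)%N || (q == r).
      case: (posnP q) => [->//|q0]; apply/orP; right; rewrite eqn_leq qr leqNgt; apply/negP => qr'.
      have wR := run_in run qr'; have : w (Lf t (ash t q%:Z (ak kl))) != 0.
        have := run_in run (_ : q.-1 < r)%N; rewrite Rf_ash (_ : q.-1%:Z + 1 = q%:Z); last lia.
        by apply; lia.
      by rewrite (Z_sides _ Z) ?col_ash // (negPf wR).
    case/orP: q0 => /eqP q0.
      have : k = kl by apply: zn_inj => //; apply: ez_inj; rewrite ?zn_in // e q0 ash0 el.
      by move: ki kj; rewrite /i /j; lia.
    have : k = kr by apply: zn_inj => //; apply: ez_inj; rewrite ?zn_in // e q0 -akr er.
    by move: ki kj; rewrite /i /j; lia.
  by case: (hez k) H => -> /=.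
have hflip k : k = kl \/ k = kr -> h (zn k.+1) = ~~ h (zn k).
  move=> kk; have [q [qr e]] : exists q : nat, (q <= r)%N /\ ez z (zn k) = ed t (ash t q%:Z (ak kl)).
    by case: kk => ->; [exists 0%N; rewrite ash0|exists r; rewrite -akr].
  have [p1 p2] := pA q qr.
  by case: (hez k) => e'; move: p1 p2; rewrite e in e'; case: e' => -> -> -> ->.
have ilr : i = kl \/ i = kr by rewrite /i; lia.
have jlr : j = kl \/ j = kr by rewrite /j; lia.
pose c := h (zn i.+1).
have UE c' k : U E t (ak kl) r c' (ez z (zn k)) = ib ((h (zn k) == c') && (h (zn k.+1) == c')).
  by rewrite /U; case: (hez k) => -> //=; rewrite andbC.
have AB := @arc_bool (fun m => h (zn m)) i j n ij jn hsame (hflip i ilr) (hflip j jlr).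
have Uc k : (k < n)%N -> U E t (ak kl) r c (ez z (zn k)) = ib ((i < k) && (k < j))%N.
  by move=> kn; rewrite UE; case: (AB k kn) => ->.
have Unc k : (k < n)%N -> U E t (ak kl) r (~~ c) (ez z (zn k)) = ib ((k < i) || (j < k))%N.
  by move=> kn; rewrite UE; case: (AB k kn) => _ ->.
have one p : \sum_(0 <= k < p) 1 = p%:Z :> int.
  by rewrite big_const_nat subn0 iter_addr addr0 natz.
have [A1 A2] := sum_arc (fun k => ib (is_step t k) * (sk k * b (ak k))) ij jn.
have [B1 B2] := sum_arc (fun k => 1) ij jn.
have main c' (Q : pred nat) : (forall k, (k < n)%N -> U E t (ak kl) r c' (ez z (zn k)) = ib (Q k)) ->
  2 * #|` side E t (ak kl) r c'|%:Z =
  6 * sg * \sum_(0 <= k < n) ib (Q k) * (ib (is_step t k) * (sk k * b (ak k))) + 2 * r%:Z +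
  \sum_(0 <= k < n) ib (Q k) * 1.
  move=> HQ; rewrite (run_count z2 zU zC inGP E_ed sg1 wsg run c' sg_neq0 bS) !sum_zn.
  congr (_ * _ + _ + _); apply: eq_big_nat => k /andP[_ kn]; rewrite HQ ?mulr1 //.
  rewrite -/(is_step t k) -/(sk k) -/(ak k); case: (Q k) => /=; last by rewrite !(mulr0, mul0r).
  by rewrite mulr1 mul1r; case: (is_step t k); rewrite ?mul1r ?mul0r ?mulr0.
exists c; split.
  by rewrite (main c _ Uc) A1 B1 !one -/(PS _); congr (_ + _ + _); lia.
by rewrite (main (~~ c) _ Unc) A2 B2 !one -/(PS _); congr (_ + _ + _); lia.
Qed.
End Arc.

Lemma level_us t t' p : level t (us t' p) = level t p - match t, t' with
  | T0, T0 | T1, T1 | T2, T2 => 0 | T0, T1 | T1, T2 | T2, T0 => 1 | _, _ => -1 end.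
Proof. by case: p => u v; case: t t' => -[]; rewrite /level /us /=; lia. Qed.

Lemma level_box (M : int) t p : in_box M p -> `|level t p| <= 2 * M.
Proof. by case: p => u v; rewrite /in_box; case: t => /=; lia. Qed.

Lemma natS_int (q : nat) : q%:Z + 1 = q.+1%:Z.
Proof. by rewrite -addn1 PoszD. Qed.

(** * Runs as pairs of consecutive steps in a row *)

Section Sweep.
Variable z : seq pt.
Hypotheses (z2 : (2 < size z)%N) (zU : uniq z) (zC : cycle hstep z).
Notation w := (winding z).
Notation nz := (next z).
Notation n := (size z).
Variable E : {fset pt * pt}.
Hypothesis inGP : forall t a, (ed t a \in E) = inG z t a.
Hypothesis E_ed : forall e, e \in E -> exists t a, e = ed t a.
Variable sg : int.
Hypothesis sg1 : sg = 1 \/ sg = -1.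
Hypothesis wsg : forall f, col f = 2 -> w f = 0 \/ w f = sg.
Notation zn := (zn z).
Notation ak := (ak z).
Notation sk := (sk z).
Notation is_step := (is_step z).

(** The level grows without bound along a row in either direction, whereas it is bounded on the
    faces of nonzero winding number. *)
Lemma w_zero t a (s : int) : s = 1 \/ s = -1 -> exists k : nat, w (Lf t (ash t (s * k%:Z) a)) = 0 \/ col a <> 0.
Proof.
move=> s1; have [M hM] := winding_bounded z2 zU zC.
pose k := `|(`|level t a| + `|M| + 2)%R|%N; exists k.
have [ca|] := eqVneq (col a) 0; last by move=> /eqP; right.
left; apply/eqP/negPn/negP => /hM; rewrite col_Lf ?col_ash // => /(_ erefl) /(level_box t).
rewrite /Lf level_us level_ash /k; move: (level t a) s1 => l; clear.
by case: t => /= -[->|->]; lia.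
Qed.

(** The run is followed backwards to the first edge whose left hexagon is outside; minimality makes
    all hexagons in between inside. *)
Lemma run_ex t a : col a = 0 -> Zedge z t a -> w (Lf t a) != 0 ->
  exists r, is_run z t (ash t (- r%:Z) a) r.
Proof.
move=> ca Z wL.
have ex : exists k : nat, w (Lf t (ash t (- k%:Z) a)) == 0.
  by have [k [h|//]] := w_zero t a (or_intror (erefl (-1))); exists k; rewrite mulN1r in h; rewrite h.
case: (ex_minnP ex) => r /eqP wr rmin; exists r.
split.
- by rewrite col_ash.
- by case: r wr {rmin} => // h; move: wL; rewrite -(ash0 t a) -[0]oppr0 h eqxx.
- exact: wr.
- by rewrite ashD subrr ash0; apply/eqP; rewrite -(Z_sides z2 zU zC sg1 wsg ca Z).
move=> k kr; rewrite ashD Rf_ash; apply/negP => h.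
have := rmin (r - k.+1)%N; rewrite (_ : - (r - k.+1)%N%:Z = k%:Z - r%:Z + 1); last by clear -kr; lia.
by move=> /(_ h); clear -kr; lia.
Qed.

Lemma run_uniq t a r r' : is_run z t (ash t (- r%:Z) a) r -> is_run z t (ash t (- r'%:Z) a) r' -> r = r'.
Proof.
have H p q : is_run z t (ash t (- p%:Z) a) p -> is_run z t (ash t (- q%:Z) a) q -> (p < q)%N -> False.
  move=> rp rq pq; have := run_L rp; have := run_in rq (_ : (q - p).-1 < q)%N.
  rewrite ashD Rf_ash (_ : (q - p).-1%:Z - q%:Z + 1 = - p%:Z); last by clear -pq; lia.
  by move=> h1 h2; move: h1; rewrite h2 eqxx => /(_ _) h; apply: notF; apply: h; clear -pq; lia.
by move=> h h'; case: (ltngtP r r') => // lt; [case: (H r r')|case: (H r' r)].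
Qed.

Lemma Z_index t a : col a = 0 -> Zedge z t a -> exists k, [/\ (k < n)%N, is_step t k & ak k = a].
Proof.
move=> ca Z; have cs : col (sh t a) = 1 by rewrite col_sh ca.
have [u uz e] : exists2 u, u \in z & ez z u = ed t a.
  case/orP: Z => /andP[az /eqP na]; first by exists a; rewrite // /ez ca /= na.
  by exists (sh t a); rewrite // /ez cs /= na.
case/(nthP (0, 0)): uz => k kn ku.
have zk : zn k = u by rewrite /zn modn_small.
by exists k; rewrite /is_step /ak zk e /= dir_of_sh; split=> //; case: (t).
Qed.

(** As exactly one hexagon at an edge of [z] is inside, this tells the last edge of a run from the
    first one. *)
Definition left_in t k := w (Lf t (ak k)) != 0.

Lemma row_inj t k k' : (k < n)%N -> (k' < n)%N -> is_step t k -> is_step t k' ->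
  lrow t (ak k) = lrow t (ak k') -> lpos t (ak k) = lpos t (ak k') -> k = k'.
Proof.
move=> kn kn' tk tk' er ep; have := lrow_inj er; rewrite ep subrr div0z ash0 => ea.
have [e1 _ _] := is_step_ez z2 zC tk; have [e2 _ _] := is_step_ez z2 zC tk'.
apply: (zn_inj zU) => //; apply: (ez_inj z2 zU); rewrite ?zn_in //.
by rewrite e1 e2 ea.
Qed.

Lemma nZ_R t a : col a = 0 -> (w (Lf t a) != 0) != (w (Rf t a) != 0) -> Zedge z t a.
Proof.
move=> ca; apply: contraR => nZ; by rewrite (winding_off_edge z2 zU zC ca nZ) eqxx.
Qed.

(** The run that ends with step [k] also begins on [z]. In the sweep this ensures that the last edge
    of a run is never met before its first. *)
Lemma first_end t k : is_step t k -> left_in t k -> exists k', [/\ (k' < n)%N, is_step t k',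
  lrow t (ak k') = lrow t (ak k), lpos t (ak k') < lpos t (ak k) & ~~ left_in t k'].
Proof.
move=> tk iL; have [e c Z] := is_step_ez z2 zC tk.
have [r run_len] := run_ex c Z iL.
have ca := run_col run_len; have rp := run_pos run_len.
have wL := run_L run_len; have wR := run_in run_len rp; rewrite ash0 in wR.
have [|k' [kn' tk' ek']] := Z_index ca (_ : Zedge z t _).
  by apply: nZ_R => //; rewrite wL wR eqxx.
exists k'; split=> //; rewrite ?ek' ?lrow_ash ?lpos_ash //; last by rewrite /left_in ek' wL eqxx.
by clear -rp; lia.
Qed.

Definition Sz_term (e : pt * pt) : nat := (#|` M1 E e| * #|` M2 E e|)%N.
Definition run_len t k : nat := xget 0%N [set r | is_run z t (ash t (- r%:Z) (ak k)) r]%classic.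
(* The edges of a run have equal terms in [Sz_e]; the run is represented by its
   last edge, on step [k] of [z]. *)
Definition run_term t k : int := (run_len t k).+1%:Z * (Sz_term (ez z (zn k)))%:Z.

Lemma run_lenP t k : is_step t k -> left_in t k -> is_run z t (ash t (- (run_len t k)%:Z) (ak k)) (run_len t k).
Proof.
move=> tk iL; have [e c Z] := is_step_ez z2 zC tk.
have [r hr] := run_ex c Z iL.
exact: (@xgetPex _ 0%N [set r | is_run z t (ash t (- r%:Z) (ak k)) r]%classic (ex_intro _ r hr)).
Qed.

(** No edge of [z] lies between the two steps in their row, so the hexagons between them have a
    common winding number: either all are inside and form a run, or all are outside. Thus first and
    last edges of runs alternate in a row, and matching neighbours suffices. *)
Lemma next_end t k k' : (k < n)%N -> (k' < n)%N -> is_step t k -> is_step t k' ->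
  lrow t (ak k) = lrow t (ak k') -> lpos t (ak k) < lpos t (ak k') ->
  (forall l, (l < n)%N -> is_step t l -> lrow t (ak l) = lrow t (ak k) ->
     lpos t (ak k) < lpos t (ak l) -> lpos t (ak l) < lpos t (ak k') -> False) ->
  exists r : nat, [/\ (0 < r)%N, lpos t (ak k') = lpos t (ak k) + 3 * r%:Z, ak k' = ash t r%:Z (ak k),
    left_in t k' = ~~ left_in t k & ~~ left_in t k -> is_run z t (ak k) r /\ run_len t k' = r].
Proof.
move=> kn kn' tk tk' er lt nob.
have [e c Z] := is_step_ez z2 zC tk; have [e' c' Z'] := is_step_ez z2 zC tk'.
have ea := lrow_inj er.
have m1 := lpos_mod t c; have m2 := lpos_mod t c'.
pose r := `|((lpos t (ak k') - lpos t (ak k)) %/ 3)%Z|%N.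
have rE : r%:Z = ((lpos t (ak k') - lpos t (ak k)) %/ 3)%Z.
  by rewrite /r; move: (lpos _ _) (lpos _ _) lt; clear; lia.
rewrite -rE in ea.
have rp : (0 < r)%N.
  by clear ea; clearbody r; move: m1 m2 lt rE; move: (lpos _ _) (lpos _ _) r; clear; lia.
have pE : lpos t (ak k') = lpos t (ak k) + 3 * r%:Z by rewrite ea lpos_ash.
have nZ q : (0 < q < r)%N -> ~~ Zedge z t (ash t q%:Z (ak k)).
  move=> qr; apply/negP => Zq; have [|l [ln tl el]] := Z_index _ Zq; first by rewrite col_ash.
  apply: (nob l ln tl); rewrite el ?lrow_ash // lpos_ash ?pE; clear -qr; lia.
have wq q : (q < r)%N -> w (Rf t (ash t q%:Z (ak k))) = w (Rf t (ak k)).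
  elim: q => [|q IH] qr; first by rewrite ash0.
  rewrite -IH; last exact: ltnW.
  rewrite -(winding_off_edge z2 zU zC _ (nZ q.+1 _)) ?col_ash //.
  by rewrite Rf_ash natS_int.
have LR : w (Lf t (ak k')) = w (Rf t (ak k)).
  rewrite -(wq r.-1); last by clear -rp; lia.
  by rewrite Rf_ash ea natS_int prednK.
have sides := Z_sides z2 zU zC sg1 wsg.
have iLE : left_in t k' = ~~ left_in t k by rewrite /left_in LR (sides _ _ c Z).
exists r; split=> // iL.
have run : is_run z t (ak k) r.
  split=> //.
  - by apply/eqP; rewrite /left_in negbK in iL.
  - by rewrite -ea; apply/eqP; rewrite -(sides _ _ c' Z') -/(left_in t k') iLE.
  - by move=> q /wq ->; rewrite -LR -/(left_in t k') iLE.
split=> //; apply: (@run_uniq t (ak k')).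
  by apply: run_lenP => //; rewrite iLE.
by rewrite {1}ea ashD addNr ash0.
Qed.

Lemma run_term_arc t k k' r (b : pt -> int) : (forall a, b (ash t 1 a) = b a + 1) ->
  (k < n)%N -> (k' < n)%N -> is_step t k -> is_step t k' ->
  is_run z t (ak k) r -> run_len t k' = r -> ak k' = ash t r%:Z (ak k) ->
  let PS m := \sum_(0 <= l < m) (ib (is_step t l) * (sk l * b (ak l))) in
  let i := minn k k' in let j := maxn k k' in
  exists m1 m2 : int, [/\ run_term t k' = (r%:Z + 1) * m1 * m2,
    2 * m1 = 6 * sg * (PS j - PS i.+1) + 2 * r%:Z + (j%:Z - i%:Z - 1) &
    2 * m2 = 6 * sg * (PS n - PS j.+1 + PS i) + 2 * r%:Z + (n%:Z - 1 - (j%:Z - i%:Z))].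
Proof.
move=> bS kn kn' tk tk' run rrE ea PS i j.
have [c [h1 h2]] := run_arc z2 zU zC inGP E_ed sg1 wsg bS kn kn' tk tk' run ea.
have [e' _ _] := is_step_ez z2 zC tk'.
have [M1E M2E] := run_M z2 zU zC inGP E_ed run (leqnn r); rewrite -ea -e' in M1E M2E.
exists #|` side E t (ak k) r c|%:Z, #|` side E t (ak k) r (~~ c)|%:Z; split=> //.
rewrite /run_term rrE /Sz_term M1E M2E PoszM -[r.+1]addn1 PoszD -mulrA; congr (_ * _).
by case: (c) => //=; rewrite mulrC.
Qed.

Definition of_dir t e : bool := eqd (dir_of e.1 e.2) t.

Lemma right_ext t a : inG z t a -> exists k r : nat, [/\ (k < n)%N, is_step t k, left_in t k,
   ak k = ash t r%:Z a & (r <= run_len t k)%N].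
Proof.
move=> ia; have ca := inG_col ia.
have ex : exists k : nat, w (Rf t (ash t k%:Z a)) == 0.
  have [k [h|//]] := w_zero t (ash t 1 a) (or_introl (erefl 1)); last by rewrite col_ash.
  by exists k; rewrite Rf_ash; rewrite mul1r ashD in h; rewrite h.
case: (ex_minnP ex) => r /eqP wr rmin.
have rin q : (q < r)%N -> w (Rf t (ash t q%:Z a)) != 0.
  by move=> qr; apply/negP => /rmin; rewrite leqNgt qr.
have wL : w (Lf t (ash t r%:Z a)) != 0.
  case: r wr rin {rmin} => [|r] wr rin.
    by move: ia; rewrite /inG; rewrite ash0 in wr *; rewrite wr eqxx orbF => /andP[].
  by have := rin r (ltnSn _); rewrite Rf_ash natS_int.
have Zr : Zedge z t (ash t r%:Z a) by apply: nZ_R; rewrite ?col_ash // wL wr eqxx.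
have [|k [kn tk ek]] := Z_index _ Zr; first by rewrite col_ash.
have iL : left_in t k by rewrite /left_in ek.
exists k, r; split=> //; rewrite leqNgt; apply/negP => lt.
have run := run_lenP tk iL; have := run_L run; rewrite ek ashD.
have := rin (r - (run_len t k).+1)%N _; rewrite Rf_ash.
rewrite (_ : (r - (run_len t k).+1)%N%:Z + 1 = - (run_len t k)%:Z + r%:Z); last by clear -lt; lia.
move=> h1 h2; move: h1; rewrite h2 eqxx => h; apply: notF; apply: h; clear -lt; lia.
Qed.

Definition run_edges t k := [seq ed t (ash t (- i%:Z) (ak k)) | i <- iota 0 (run_len t k).+1].

(** The edges of one direction are partitioned into runs: [right_ext] finds the run of an edge by
    going to the right until the hexagons end, and all edges of a run have equal terms by
    [run_M]. *)
Lemma sum_dir t : \sum_(e <- E | of_dir t e) (Sz_term e)%:Z = \sum_(0 <= k < n | is_step t k && left_in t k) run_term t k.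
Proof.
transitivity (\sum_(e <- E | of_dir t e) \sum_(0 <= k < n | is_step t k && left_in t k) ib (e \in run_edges t k) * (Sz_term e)%:Z).
  rewrite big_seq_cond [RHS]big_seq_cond; apply: eq_bigr => e /andP[eE /eqdP et].
  have [t' [a ee]] := E_ed eE; have tt : t' = t by rewrite -et ee /= dir_of_sh.
  rewrite tt in ee; have ia : inG z t a by rewrite -inGP -ee.
  have [k [r [kn tk iL ek rk]]] := right_ext ia.
  rewrite big_mkcond (bigD1_seq k) ?mem_index_iota ?iota_uniq //= tk iL /=.
  rewrite big1_seq ?addr0; first last.
    (* Uniqueness of the run: of two runs through [e], the one that ended first would have its
       outside hexagon among the inside hexagons of the other. *)
    move=> k' /andP[kk']; rewrite mem_index_iota => /= kn'.
    case: (boolP (is_step t k' && left_in t k')) => // /andP[tk' iL'].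
    case: (boolP (e \in _)) => [h|_]; last by rewrite mul0r.
    exfalso; move/eqP: kk'; apply.
    case/mapP: h => i; rewrite mem_iota add0n ltnS => /= ir; rewrite ee => /ed_inj[_ ea].
    have ek' : ak k' = ash t i%:Z a by rewrite ea ashD subrr ash0.
    have run := run_lenP tk iL; have run' := run_lenP tk' iL'.
    have wR : w (Rf t (ak k)) = 0 by have := run_R run; rewrite ashD subrr ash0.
    have wR' : w (Rf t (ak k')) = 0 by have := run_R run'; rewrite ashD subrr ash0.
    have [lt|lt|ri] := ltngtP r i.
    - have := run_in run' (_ : run_len t k' - (i - r) < run_len t k')%N.
      rewrite ashD ek' ashD (_ : (run_len t k' - (i - r))%N%:Z - (run_len t k')%:Z + i%:Z = r%:Z); last by clear -lt ir; lia.
      by rewrite -ek wR eqxx => h; case: notF; apply: h; clear -lt ir; lia.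
    - have := run_in run (_ : run_len t k - (r - i) < run_len t k)%N.
      rewrite ashD ek ashD (_ : (run_len t k - (r - i))%N%:Z - (run_len t k)%:Z + r%:Z = i%:Z); last by clear -lt rk; lia.
      by rewrite -ek' wR' eqxx => h; case: notF; apply: h; clear -lt rk; lia.
    by apply: (@row_inj t) => //; rewrite ek ek' ri.
  have -> : e \in run_edges t k.
    by apply/mapP; exists r; rewrite ?mem_iota ?add0n ?ltnS // ek ashD addNr ash0.
  by rewrite mul1r.
rewrite exchange_big /= big_seq_cond [RHS]big_seq_cond; apply: eq_bigr => k.
rewrite mem_index_iota => /and3P[/= kn tk iL].
have run := run_lenP tk iL.
transitivity (\sum_(e <- E | of_dir t e && (e \in run_edges t k)) (Sz_term e)%:Z).
  rewrite [RHS]big_mkcondr; apply: eq_bigr => e _; by case: (e \in _); rewrite ?mul1r ?mul0r.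
have aE i : (i <= run_len t k)%N -> ed t (ash t (- i%:Z) (ak k)) = ed t (ash t (run_len t k - i)%N%:Z (ash t (- (run_len t k)%:Z) (ak k))).
  by move=> ir; rewrite ashD; congr (ed _ (ash _ _ _)); clear -ir; lia.
rewrite (@sum_sub _ _ (run_edges t k)) ?fset_uniq //; first last.
- move=> e; apply/andP/idP => [[_ /andP[]]//|h]; rewrite h andbT.
  case/mapP: h => i; rewrite mem_iota add0n ltnS => /= ir ->.
  rewrite aE // inGP (run_inG run) ?leq_subr //; split=> //.
  by rewrite /of_dir /= dir_of_sh; case: (t).
- rewrite map_inj_uniq ?iota_uniq // => i j /ed_inj[_ /ash_inj].
  by move=> /eqP; rewrite eqr_opp => /eqP [].
have GE i : (i <= run_len t k)%N -> Sz_term (ed t (ash t (- i%:Z) (ak k))) = Sz_term (ez z (zn k)).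
  move=> ir; have [-> _ _] := is_step_ez z2 zC tk.
  have -> : ed t (ak k) = ed t (ash t (- 0%:Z) (ak k)) by rewrite oppr0 ash0.
  rewrite !aE // /Sz_term.
  have [-> ->] := run_M z2 zU zC inGP E_ed run (leq_subr i _).
  by have [-> ->] := run_M z2 zU zC inGP E_ed run (leq_subr 0 _).
rewrite big_map (eq_big_seq (fun=> (Sz_term (ez z (zn k)))%:Z)); last first.
  by move=> i; rewrite mem_iota add0n ltnS => /= ir; rewrite GE.
by rewrite big_const_seq count_predT size_iota iter_addr addr0 /run_term -mulr_natl natz.
Qed.

Lemma Sz_sum : (Sz_e E)%:Z = \sum_(0 <= k < n | is_step T0 k && left_in T0 k) run_term T0 k +
  \sum_(0 <= k < n | is_step T1 k && left_in T1 k) run_term T1 k + \sum_(0 <= k < n | is_step T2 k && left_in T2 k) run_term T2 k.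
Proof.
rewrite -!sum_dir /Sz_e (big_morph Posz PoszD (erefl 0%:Z)).
rewrite !(big_mkcond (of_dir _)) -!big_split /=; apply: eq_bigr => e _.
by rewrite /of_dir; case: dir_of => /=; rewrite ?addr0 ?add0r.
Qed.
End Sweep.

Local Open Scope ring_scope.

(** * A structured language for the word RAM *)

(* A language with expressions and counted loops, for which termination and the
   running time are immediate.  [compile] compiles it; expressions are evaluated in
   the registers from [K] on, which the source program does not use. *)
Inductive expr : Type :=
| Var of nat | Cst of int
| Plus of expr & expr | Minus of expr & expr | Times of expr & expr
| Get of expr.

Inductive prog : Type :=
| Asg of nat & expr
| Put of expr & expr
| Sq of prog & prog
| If of expr & expr & prog & prog
| For of nat & nat & prog.

Fixpoint eval (s : state) (e : expr) : int :=
  match e with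
  | Var r => reg s r
  | Cst c => c
  | Plus a b => eval s a + eval s b
  | Minus a b => eval s a - eval s b
  | Times a b => eval s a * eval s b
  | Get a => cell s `|eval s a|%N
  end.

Fixpoint esafe (B : nat) (s : state) (e : expr) : Prop :=
  match e with
  | Var r => True
  | Cst c => (`|c| <= B)%N
  | Plus a b | Minus a b | Times a b => esafe B s a /\ esafe B s b /\ (`|eval s e| <= B)%N
  | Get a => esafe B s a /\ 0 <= eval s a
  end.

Fixpoint evars (K : nat) (e : expr) : bool :=
  match e with
  | Var r => (r < K)%N
  | Cst _ => true
  | Plus a b | Minus a b | Times a b => evars K a && evars K b
  | Get a => evars K a
  end.

Fixpoint ecode (d : nat) (e : expr) : cmd :=
  match e with
  | Var r => Copy d r
  | Cst c => Const d c
  | Plus a b => Seq (ecode d a) (Seq (ecode d.+1 b) (Add d d d.+1))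
  | Minus a b => Seq (ecode d a) (Seq (ecode d.+1 b) (Defs.Sub d d d.+1))
  | Times a b => Seq (ecode d a) (Seq (ecode d.+1 b) (Mul d d d.+1))
  | Get a => Seq (ecode d a) (Read d d)
  end.

Fixpoint ecost (e : expr) : nat :=
  match e with
  | Var _ | Cst _ => 1
  | Plus a b | Minus a b | Times a b => ecost a + (ecost b + 1)
  | Get a => ecost a + 1
  end.

Definition sim (K : nat) (s t : state) : Prop :=
  (forall r, (r < K)%N -> reg t r = reg s r) /\ (forall a, cell t a = cell s a).

Lemma reg_set s r v q : reg (set_reg s r v) q = if q == r then v else reg s q.
Proof. by []. Qed.
Lemma cell_set s a v b : cell (set_cell s a v) b = if b == a then v else cell s b.
Proof. by []. Qed.

Lemma sim_tmp K d s t t1 : (K <= d)%N -> sim K s t ->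
  (forall r, (r < d)%N -> reg t1 r = reg t r) -> cell t1 = cell t -> sim K s t1.
Proof.
move=> Kd [sr sc] r1 c1; split=> [r rK|q]; last by rewrite c1 sc.
by rewrite r1 ?sr //; exact: leq_trans rK Kd.
Qed.

Lemma ecode_ok B K e s d t : evars K e -> (K <= d)%N -> sim K s t -> esafe B s e ->
  exists t', [/\ exec B (ecode d e) t t' (ecost e), reg t' d = eval s e,
    forall r, (r < d)%N -> reg t' r = reg t r & cell t' = cell t].
Proof.
elim: e d t => [r|c|a IHa b IHb|a IHa b IHb|a IHa b IHb|a IHa] d t /= ev Kd st sf.
- exists (set_reg t d (reg t r)); split=> //; first exact: ExecCopy.
    by rewrite reg_set eqxx; case: st => -> .
  by move=> q qd; rewrite reg_set ltn_eqF.
- exists (set_reg t d c); split=> //; first exact: ExecConst.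
    by rewrite reg_set eqxx.
  by move=> q qd; rewrite reg_set ltn_eqF.
- case/andP: ev => ea eb; case: sf => sa [sb sab].
  have [t1 [x1 v1 r1 c1]] := IHa d t ea Kd st sa.
  have [t2 [x2 v2 r2 c2]] := IHb d.+1 t1 eb (leqW Kd) (sim_tmp Kd st r1 c1) sb.
  have v1' : reg t2 d = eval s a by rewrite r2.
  exists (set_reg t2 d (reg t2 d + reg t2 d.+1)); split.
  + by apply: ExecSeq x1 (ExecSeq x2 _); apply: ExecAdd; rewrite v1' v2.
  + by rewrite reg_set eqxx v1' v2.
  + by move=> q qd; rewrite reg_set ltn_eqF // r2 ?r1 //; apply: ltnW.
  + by rewrite /= c2 c1.
- case/andP: ev => ea eb; case: sf => sa [sb sab].
  have [t1 [x1 v1 r1 c1]] := IHa d t ea Kd st sa.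
  have [t2 [x2 v2 r2 c2]] := IHb d.+1 t1 eb (leqW Kd) (sim_tmp Kd st r1 c1) sb.
  have v1' : reg t2 d = eval s a by rewrite r2.
  exists (set_reg t2 d (reg t2 d - reg t2 d.+1)); split.
  + by apply: ExecSeq x1 (ExecSeq x2 _); apply: ExecSub; rewrite v1' v2.
  + by rewrite reg_set eqxx v1' v2.
  + by move=> q qd; rewrite reg_set ltn_eqF // r2 ?r1 //; apply: ltnW.
  + by rewrite /= c2 c1.
- case/andP: ev => ea eb; case: sf => sa [sb sab].
  have [t1 [x1 v1 r1 c1]] := IHa d t ea Kd st sa.
  have [t2 [x2 v2 r2 c2]] := IHb d.+1 t1 eb (leqW Kd) (sim_tmp Kd st r1 c1) sb.
  have v1' : reg t2 d = eval s a by rewrite r2.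
  exists (set_reg t2 d (reg t2 d * reg t2 d.+1)); split.
  + by apply: ExecSeq x1 (ExecSeq x2 _); apply: ExecMul; rewrite v1' v2.
  + by rewrite reg_set eqxx v1' v2.
  + by move=> q qd; rewrite reg_set ltn_eqF // r2 ?r1 //; apply: ltnW.
  + by rewrite /= c2 c1.
- case: sf => sa a0; have [t1 [x1 v1 r1 c1]] := IHa d t ev Kd st sa.
  exists (set_reg t1 d (cell t1 `|eval s a|%N)); split.
  + by apply: ExecSeq x1 _; apply: ExecRead; rewrite v1 gez0_abs.
  + by rewrite reg_set eqxx c1; case: st => _ ->.
  + by move=> q qd; rewrite reg_set ltn_eqF // r1.
  + by rewrite /= c1.
Qed.

(** The bound of a [For] is inclusive, as the compiled loop tests with [WhileLe]: this is where the
    [+ 1] comes from, and why the programs set [rM] to one less than the number of rounds. *)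
Fixpoint run (p : prog) (s : state) : state :=
  match p with
  | Asg r e => set_reg s r (eval s e)
  | Put a e => set_cell s `|eval s a|%N (eval s e)
  | Sq p q => run q (run p s)
  | If a b p q => if eval s a <= eval s b then run p s else run q s
  | For r b p => iter `|(reg s b + 1)%R|%N
       (fun s => let s1 := run p s in set_reg s1 r (reg s1 r + 1)) (set_reg s r 0)
  end.

Definition for_step r p (s : state) := let s1 := run p s in set_reg s1 r (reg s1 r + 1).

Fixpoint writes (p : prog) : seq nat :=
  match p with
  | Asg r _ => [:: r]
  | Put _ _ => [::]
  | Sq p q | If _ _ p q => writes p ++ writes q
  | For r _ p => r :: writes p
  end.

Fixpoint wf (K : nat) (p : prog) : bool :=
  match p with
  | Asg r e => (r < K)%N && evars K e
  | Put a e => evars K a && evars K e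
  | Sq p q => wf K p && wf K q
  | If a b p q => [&& evars K a, evars K b, wf K p & wf K q]
  | For r b p => [&& (r < K)%N, (b < K)%N, r != b, r \notin writes p, b \notin writes p & wf K p]
  end.

Fixpoint safe (B L : nat) (p : prog) (s : state) : Prop :=
  match p with
  | Asg r e => esafe B s e
  | Put a e => [/\ esafe B s a, esafe B s e & 0 <= eval s a]
  | Sq p q => safe B L p s /\ safe B L q (run p s)
  | If a b p q => [/\ esafe B s a, esafe B s b &
      if eval s a <= eval s b then safe B L p s else safe B L q s]
  | For r b p => [/\ 0 <= reg s b + 1, (`|(reg s b + 1)%R| <= L)%N, (`|(reg s b + 1)%R| <= B)%N, (1 <= B)%N &
      forall k, (k < `|(reg s b + 1)%R|)%N -> safe B L p (iter k (for_step r p) (set_reg s r 0))]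
  end.

Fixpoint compile (K : nat) (p : prog) : cmd :=
  match p with
  | Asg r e => Seq (ecode K e) (Copy r K)
  | Put a e => Seq (ecode K a) (Seq (ecode K.+1 e) (Write K K.+1))
  | Sq p q => Seq (compile K p) (compile K q)
  | If a b p q => Seq (ecode K a) (Seq (ecode K.+1 b) (IfLe K K.+1 (compile K p) (compile K q)))
  | For r b p => Seq (Const r 0) (WhileLe r b (Seq (compile K p) (Seq (Const K 1) (Add r r K))))
  end.

(* Every loop is assumed to make at most [L] iterations. *)
Fixpoint tbound (L : nat) (p : prog) : nat :=
  match p with
  | Asg _ e => ecost e + 1
  | Put a e => ecost a + (ecost e + 1)
  | Sq p q => tbound L p + tbound L q
  | If a b p q => ecost a + (ecost b + (tbound L p + tbound L q).+1)
  | For _ _ p => 1 + (L * (tbound L p + 4) + 1)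
  end.

Lemma run_writes p s r : r \notin writes p -> reg (run p s) r = reg s r.
Proof.
elim: p s => [q e|a e|p IHp q IHq|a b p IHp q IHq|q b p IHp] s //=.
- by rewrite inE => /negPf ->.
- by rewrite mem_cat negb_or => /andP[rp rq]; rewrite IHq // IHp.
- by rewrite mem_cat negb_or => /andP[rp rq]; case: ifP => _; [exact: IHp|exact: IHq].
- rewrite inE negb_or => /andP[rq rp].
  elim: `|_|%N => [|k IH] /=; first by rewrite (negPf rq).
  by rewrite (negPf rq) IHp.
Qed.

Lemma compile_ok B L K p s t : wf K p -> safe B L p s -> sim K s t ->
  exists t' c, [/\ exec B (compile K p) t t' c, (c <= tbound L p)%N & sim K (run p s) t'].
Proof.
elim: p s t => [r e|a e|p IHp q IHq|a b p IHp q IHq|r b p IHp] s t /=.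
- case/andP=> rK ev sf st; have [t1 [x1 v1 r1 c1]] := ecode_ok ev (leqnn K) st sf.
  exists (set_reg t1 r (reg t1 K)), (ecost e + 1)%N; split=> //.
    by apply: ExecSeq x1 _; exact: ExecCopy.
  case: st => sr sc; split=> [q qK|q]; rewrite ?reg_set ?v1 /=; last by rewrite c1 sc.
  by case: eqP => // _; rewrite r1 ?sr.
- case/andP=> ea ee [sa se a0] st; have [t1 [x1 v1 r1 c1]] := ecode_ok ea (leqnn K) st sa.
  have st1 : sim K s t1 by case: st => sr sc; split=> [q qK|q]; [rewrite r1 ?sr|rewrite c1 sc].
  have [t2 [x2 v2 r2 c2]] := ecode_ok ee (leqnSn K) st1 se.
  exists (set_cell t2 `|eval s a|%N (reg t2 K.+1)), (ecost a + (ecost e + 1))%N; split=> //.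
    apply: ExecSeq x1 (ExecSeq x2 _); apply: ExecWrite; by rewrite r2 // v1 gez0_abs.
  case: st1 => sr sc; split=> [q qK|q] /=; first by rewrite r2 ?sr // ltnS ltnW.
  by rewrite v2 c2 sc.
- case/andP=> wp wq [sp sq] st; have [t1 [c1 [x1 l1 st1]]] := IHp _ _ wp sp st.
  have [t2 [c2 [x2 l2 st2]]] := IHq _ _ wq sq st1.
  by exists t2, (c1 + c2)%N; split=> //; [exact: ExecSeq x1 x2|exact: leq_add].
- case/and4P=> ea eb wp wq [sa sb sf] st; have [t1 [x1 v1 r1 c1]] := ecode_ok ea (leqnn K) st sa.
  have st1 : sim K s t1 by case: st => sr sc; split=> [q' qK|q']; [rewrite r1 ?sr|rewrite c1 sc].
  have [t2 [x2 v2 r2 c2]] := ecode_ok eb (leqnSn K) st1 sb.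
  have st2 : sim K s t2 by case: st1 => sr sc; split=> [q' qK|q']; [rewrite r2 ?sr // ltnS ltnW|rewrite c2 sc].
  have v1' : reg t2 K = eval s a by rewrite r2.
  move: sf; case: ifP => cmp sf.
    have [t3 [c3 [x3 l3 st3]]] := IHp _ _ wp sf st2.
    exists t3, (ecost a + (ecost b + c3.+1))%N; split=> //; last by rewrite !leq_add2l ltnS (leq_trans l3) ?leq_addr.
    by apply: ExecSeq x1 (ExecSeq x2 _); apply: ExecIfTrue x3; rewrite v1' v2.
  have [t3 [c3 [x3 l3 st3]]] := IHq _ _ wq sf st2.
  exists t3, (ecost a + (ecost b + c3.+1))%N; split=> //; last by rewrite !leq_add2l ltnS (leq_trans l3) ?leq_addl.
  by apply: ExecSeq x1 (ExecSeq x2 _); apply: ExecIfFalse x3; rewrite v1' v2 ltNge cmp.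
case/and5P=> rK bK rb rp /andP[bp wp] [b0 bL bB B1 sf] st.
set N := `|(reg s b + 1)%R|%N in bL bB sf *.
have NE : reg s b + 1 = N%:Z by rewrite /N gez0_abs.
rewrite -/(for_step r p).
set S := fun k => iter k (for_step r p) (set_reg s r 0).
have Sr k : reg (S k) r = k%:Z.
  elim: k => [|k IH]; first by rewrite /S /= eqxx.
  by rewrite /S iterS /for_step /= eqxx run_writes // -/(S k) IH -addn1 PoszD.
have Sb k : reg (S k) b = reg s b.
  elim: k => [|k IH]; first by rewrite /S /= eq_sym (negPf rb).
  by rewrite /S iterS /for_step /= eq_sym (negPf rb) run_writes.
have loop m : forall k t1, (k + m = N)%N -> sim K (S k) t1 ->
    exists t' c, [/\ exec B (WhileLe r b (Seq (compile K p) (Seq (Const K 1) (Add r r K)))) t1 t' c,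
       (c <= m * (tbound L p + 4) + 1)%N & sim K (S N) t'].
  elim: m => [|m IH] k t1 km st1.
    exists t1, 1%N; split=> //; last by rewrite -km addn0.
    apply: ExecWhileFalse; case: (st1) => sr _; rewrite !sr // Sr Sb.
    by move: NE; rewrite -km; clear; lia.
  have kN : (k < N)%N by rewrite -km; clear; lia.
  have [t2 [c2 [x2 l2 st2]]] := IHp _ _ wp (sf k kN) st1.
  pose t3 := set_reg t2 K 1.
  pose t4 := set_reg t3 r (reg t3 r + reg t3 K).
  have rK' : (r == K) = false by rewrite ltn_eqF.
  have v3 : reg t3 r + reg t3 K = k.+1%:Z.
    rewrite /t3 !reg_set rK' eqxx; case: st2 => -> // _; rewrite run_writes // -/(S k) Sr; clear; lia.
  have st4 : sim K (S k.+1) t4.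
    case: st2 => sr sc; split=> [q qK|q]; last by rewrite /= sc.
    rewrite /t4 reg_set v3 /S iterS /for_step /= -/(S k).
    case: eqP => _; first by rewrite run_writes // Sr -addn1 PoszD.
    by rewrite ltn_eqF // sr.
  have km' : (k.+1 + m = N)%N by rewrite -km; clear; lia.
  have [t5 [c5 [x5 l5 st5]]] := IH k.+1 t4 km' st4.
  exists t5, ((c2 + (1 + 1)) + c5).+1; split=> //; last by rewrite mulSn; move: l2 l5; clear; lia.
  apply: ExecWhileTrue x5.
    by case: st1 => sr _; rewrite !sr // Sr Sb; move: NE kN; clear; lia.
  apply: ExecSeq x2 _; apply: (@ExecSeq _ _ _ _ t3); first by apply: ExecConst.
  apply: ExecAdd; rewrite v3; move: kN bB; clear; lia.
have [||t' [c [x l st']]] := loop N 0%N (set_reg t r 0).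
- by [].
- by case: st => sr sc; split=> [q qK|q] //; rewrite /S /=; [case: eqP => // _; exact: sr|].
exists t', (1 + c)%N; split=> //; first by apply: ExecSeq x; exact: ExecConst.
rewrite leq_add2l; apply: leq_trans l _; rewrite leq_add2r leq_mul2r bL; exact: orbT.
Qed.

Fixpoint flat (p : prog) : bool :=
  match p with
  | Asg _ _ | Put _ _ => true
  | Sq p q | If _ _ p q => flat p && flat q
  | For _ _ _ => false
  end.
Fixpoint flat1 (p : prog) : bool :=
  match p with
  | Asg _ _ | Put _ _ => true
  | Sq p q | If _ _ p q => flat1 p && flat1 q
  | For _ _ p => flat p
  end.

Lemma tbound_flat L p : flat p -> tbound L p = tbound 1 p.
Proof. by elim: p => //= [p IHp q IHq|a b p IHp q IHq] /andP[/IHp-> /IHq->]. Qed.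

(** Loops are not nested, so each contributes its body at most [L] times. This is the whole argument
    for linear time, since [main] is a fixed program and [L] will be [4 * n]. *)
Lemma tbound_flat1 L p : (0 < L)%N -> flat1 p -> (tbound L p <= L * tbound 1 p)%N.
Proof.
move=> L0; elim: p => [r e|a e|p IHp q IHq|a b p IHp q IHq|r b p IHp] /=.
- by move=> _; apply: leq_pmull.
- by move=> _; apply: leq_pmull.
- by case/andP=> /IHp h1 /IHq h2; rewrite mulnDr leq_add.
- case/andP=> /IHp h1 /IHq h2.
  move: (tbound L p) (tbound L q) (tbound 1 p) (tbound 1 q) (ecost a) (ecost b) h1 h2.
  by clear -L0; nia.
- by move=> /tbound_flat->; move: (tbound 1 p); clear -L0; nia.
Qed.

(** * The program *)

(* The input takes the cells below [2 n] and is continued by a copy of its first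
   vertex.  The cells above are a table with rows of 64 slots: for step [k] of
   the cycle, slot 60 contains its direction (0, 1, 2) and slot 61 its sign (1
   when it starts at a vertex of colour 0).  For direction [d] the slots from
   [8 d] on contain: the head of the list of the steps at a position, the link
   to the next step of that list, the last step met in a row, the position and
   the row of a step, and the prefix sums [cPS] and [cPP].  Steps are stored
   incremented, so that 0 means none; rows and positions are shifted to be
   nonnegative when they are used as addresses. *)
Notation rN := 0%N (only parsing).
Notation rS0 := 1%N (only parsing).
Notation rS := 2%N (only parsing).
Notation rB := 3%N (only parsing).
Notation rC := 4%N (only parsing).
Notation rI := 5%N (only parsing).
Notation rM := 6%N (only parsing).
Notation rX := 7%N (only parsing).
Notation rY := 8%N (only parsing).
Notation rPS := 9%N (only parsing).
Notation rPP := 10%N (only parsing).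
Notation rA := 11%N (only parsing).
Notation rG := 12%N (only parsing).
Notation rP := 13%N (only parsing).
Notation rU := 14%N (only parsing).
Notation rT := 15%N (only parsing).
Notation rK := 16%N (only parsing).
Notation rR := 17%N (only parsing).
Notation rL := 18%N (only parsing).
Notation rJ := 19%N (only parsing).
Notation rH := 20%N (only parsing).
Notation rW := 21%N (only parsing).

Definition addrE (slot : nat) (idx : expr) : expr :=
  Plus (Plus (Plus (Var rN) (Var rN)) (Cst (2 + slot)%N)) (Times (Cst 64) idx).
Definition tabE slot idx := Get (addrE slot idx).
Definition PutT slot idx e := Put (addrE slot idx) e.

Definition xE (idx : expr) := Get (Times (Cst 2) idx).
Definition yE (idx : expr) := Get (Plus (Times (Cst 2) idx) (Cst 1)).
Definition stepXY : prog :=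
  Sq (Asg rX (Minus (xE (Plus (Var rI) (Cst 1))) (xE (Var rI))))
     (Asg rY (Minus (yE (Plus (Var rI) (Cst 1))) (yE (Var rI)))).
Definition skip := Asg rT (Cst 0).
Definition flip := Asg rS (Minus (Cst 0) (Var rS)).
Definition sq e := Times e e.

(* The colour of the first vertex is not given in the input: it is read off from a
   vertical step, which goes up exactly when it starts at an even vertex. *)
Definition parity_body : prog :=
  Sq stepXY
  (Sq (If (Cst 1) (sq (Var rY)) (Asg rS0 (Times (Var rY) (Var rS))) skip) flip).

Definition type_body : prog :=
  Sq stepXY
  (Sq (PutT 61 (Var rI) (Var rS))
  (Sq (If (Cst 1) (sq (Var rY)) (PutT 60 (Var rI) (Cst 0))
      (If (Cst 1) (Times (Var rX) (Var rS)) (PutT 60 (Var rI) (Cst 1)) (PutT 60 (Var rI) (Cst 2))))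
   flip)).

Definition prelude : prog :=
  Sq (Put (Times (Cst 2) (Var rN)) (Get (Cst 0)))
  (Sq (Put (Plus (Times (Cst 2) (Var rN)) (Cst 1)) (Get (Cst 1)))
  (Sq (Asg rM (Minus (Var rN) (Cst 1)))
  (Sq (Asg rS (Cst 1))
  (Sq (For rI rM parity_body)
  (Sq (Asg rS (Var rS0))
      (For rI rM type_body)))))).

Section Direction.
Variables d d1 : nat.
Notation sl j := (8 * d + j)%N.

(** Here [d1] is the direction after [d]. A step of direction [d1] changes the position [rB], a step
    of the third direction changes [rC], and the row [rB + rC] changes with both. The prefix sums
    are stored before they are updated, so entry [k] covers the steps before [k]. Equality is tested
    by comparing a square with 0, as the machine only has [<=]. *)
Definition fill_body : prog :=
  Sq (Asg rT (tabE 60 (Var rI)))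
  (Sq (Asg rS (tabE 61 (Var rI)))
  (Sq (PutT (sl 5) (Var rI) (Var rPS))
  (Sq (PutT (sl 6) (Var rI) (Var rPP))
  (Sq (If (sq (Minus (Var rT) (Cst d))) (Cst 0)
        (Sq (PutT (sl 3) (Var rI) (Var rB))
        (Sq (PutT (sl 4) (Var rI) (Plus (Var rB) (Var rC)))
        (Sq (PutT (sl 1) (Var rI) (tabE (sl 0) (Plus (Var rB) (Var rN))))
        (Sq (PutT (sl 0) (Plus (Var rB) (Var rN)) (Plus (Var rI) (Cst 1)))
            (Asg rPS (Plus (Var rPS) (Times (Var rS) (Var rB))))))))
        (If (sq (Minus (Var rT) (Cst d1))) (Cst 0)
          (Asg rB (Plus (Var rB) (Var rS)))
          (Asg rC (Plus (Var rC) (Var rS)))))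
      (If (Cst 1) (Var rS) (Asg rPP (Plus (Var rPP) (Cst 1))) skip))))).

Definition tPS e := tabE (sl 5) e.
Definition tPP e := tabE (sl 6) e.
Definition inc e := Plus e (Cst 1).

Definition pair_body : prog :=
  Sq (Asg rJ (Minus (Var rL) (Cst 1)))
  (Sq (Asg rH (Var rK))
  (Sq (Asg rW (Minus (tabE (sl 3) (Var rK)) (tabE (sl 3) (Var rJ))))
  (Sq (If (Var rK) (Var rJ) (Sq (Asg rH (Var rJ)) (Asg rJ (Var rK))) skip)
  (Sq (Asg rX (Plus (Plus (Times (Times (Cst 3) (Var rG)) (Minus (tPS (Var rH)) (tPS (inc (Var rJ)))))
                          (Minus (tPP (Var rH)) (tPP (inc (Var rJ))))) (Var rW)))
  (Sq (Asg rY (Plus (Plus (Times (Times (Cst 3) (Var rG))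
                             (Plus (Minus (tPS (Var rN)) (tPS (inc (Var rH)))) (tPS (Var rJ))))
                          (Plus (Minus (tPP (Var rN)) (tPP (inc (Var rH)))) (tPP (Var rJ)))) (Var rW)))
  (Sq (Asg rA (Plus (Var rA) (Times (Times (inc (Var rW)) (Var rX)) (Var rY))))
      (PutT (sl 2) (Var rR) (Cst 0)))))))).

(* One loop interleaves moving to the next position and taking a step off the
   list of the current position; it makes [2 n] moves and [n] steps at most. *)
Definition sweep_body : prog :=
  If (Var rU) (Cst 0)
    (Sq (Asg rU (tabE (sl 0) (Var rP))) (Asg rP (inc (Var rP))))
    (Sq (Asg rK (Minus (Var rU) (Cst 1)))
    (Sq (Asg rR (Plus (tabE (sl 4) (Var rK)) (Plus (Var rN) (Var rN))))
    (Sq (Asg rL (tabE (sl 2) (Var rR)))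
    (Sq (If (Var rL) (Cst 0) (PutT (sl 2) (Var rR) (inc (Var rK))) pair_body)
        (Asg rU (tabE (sl 1) (Var rK))))))).

Definition fill : prog :=
  Sq (Asg rM (Minus (Var rN) (Cst 1)))
  (Sq (Asg rB (Cst 0)) (Sq (Asg rC (Cst 0)) (Sq (Asg rPS (Cst 0)) (Sq (Asg rPP (Cst 0))
  (Sq (For rI rM fill_body)
  (Sq (PutT (sl 5) (Var rN) (Var rPS))
  (Sq (PutT (sl 6) (Var rN) (Var rPP))
      (If (Cst 1) (Var rPS) (Asg rG (Cst 1)) (Asg rG (Cst (-1))))))))))).

Definition sweep : prog :=
  Sq (Asg rP (Cst 0)) (Sq (Asg rU (Cst 0))
  (Sq (Asg rM (Times (Cst 3) (Var rN)))
      (For rI rM sweep_body))).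

End Direction.

Definition main : prog :=
  Sq prelude
  (Sq (fill 0 1) (Sq (sweep 0)
  (Sq (fill 1 2) (Sq (sweep 1)
  (Sq (fill 2 0) (Sq (sweep 2) (Asg rN (Var rA)))))))).

Lemma main_wf : wf 24 main. Proof. by []. Qed.
Lemma main_flat : flat1 main. Proof. by []. Qed.

(** * Rules for the safety and the effect of programs *)

Section Rules.
Variables (B L : nat).

Definition ok (p : prog) (s : state) (Q : state -> Prop) : Prop := safe B L p s /\ Q (run p s).

Lemma ok_Asg r e s (Q : state -> Prop) : esafe B s e -> Q (set_reg s r (eval s e)) -> ok (Asg r e) s Q.
Proof. by []. Qed.

Lemma ok_Sq p q s (Q : state -> Prop) : ok p s (fun s' => ok q s' Q) -> ok (Sq p q) s Q.
Proof. by case=> sp [sq Qr]; split. Qed.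

Lemma ok_If a b p q s (Q : state -> Prop) : esafe B s a -> esafe B s b ->
  (eval s a <= eval s b -> ok p s Q) -> (eval s b < eval s a -> ok q s Q) -> ok (If a b p q) s Q.
Proof.
move=> sa sb hp hq; rewrite /ok /=; case: (leP (eval s a) (eval s b)) => h.
  by case: (hp h).
by case: (hq h).
Qed.

Lemma ok_imp p s (Q Q' : state -> Prop) : ok p s Q -> (forall s', Q s' -> Q' s') -> ok p s Q'.
Proof. by case=> sp Qr H; split=> //; apply: H. Qed.

Lemma ok_For r b p s (Inv : nat -> state -> Prop) (N : nat) (Q : state -> Prop) :
  r != b -> r \notin writes p -> b \notin writes p -> reg s b + 1 = N%:Z ->
  (N <= L)%N -> (N <= B)%N -> (1 <= B)%N -> Inv 0%N (set_reg s r 0) ->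
  (forall k s', (k < N)%N -> Inv k s' -> reg s' r = k%:Z -> reg s' b + 1 = N%:Z ->
     ok p s' (fun s'' => Inv k.+1 (set_reg s'' r k.+1%:Z))) ->
  (forall s', Inv N s' -> Q s') -> ok (For r b p) s Q.
Proof.
move=> rb rp bp NE NL NB B1 I0 IS IQ.
rewrite /ok /= -/(for_step r p) NE absz_nat.
have H k : (k <= N)%N -> let S := iter k (for_step r p) (set_reg s r 0) in
    [/\ Inv k S, reg S r = k%:Z, reg S b + 1 = N%:Z & forall j, (j < k)%N -> safe B L p (iter j (for_step r p) (set_reg s r 0))].
  elim: k => [|k IH] kN; first by split=> //=; rewrite ?eqxx // eq_sym (negPf rb).
  have [Ik Sr Sb sf] := IH (ltnW kN).
  have [sk Ik'] := IS _ _ kN Ik Sr Sb.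
  have Sr' : reg (iter k.+1 (for_step r p) (set_reg s r 0)) r = k.+1%:Z.
    by rewrite iterS /for_step /= eqxx run_writes // Sr -addn1 PoszD.
  split=> //.
  - rewrite iterS {1}/for_step run_writes // Sr (_ : k%:Z + 1 = k.+1%:Z) //.
    by rewrite -addn1 PoszD.
  - by rewrite iterS /for_step /= eq_sym (negPf rb) run_writes.
  - by move=> j; rewrite ltnS leq_eqVlt => /orP[/eqP->//|]; exact: sf.
have [IN _ _ sf] := H N (leqnn N).
by split; [split=> //; rewrite ?NE|exact: IQ].
Qed.

Variable n : nat.
Definition cadr slot i : nat := (2 * n + 2 + 64 * i + slot)%N.
Definition tab (s : state) slot i : int := cell s (cadr slot i).
Definition set_tab (s : state) slot i v : state := set_cell s (cadr slot i) v.

Lemma tab_reg s r v slot i : tab (set_reg s r v) slot i = tab s slot i.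
Proof. by []. Qed.

Lemma tab_set s slot i v slot' i' : (slot < 64)%N -> (slot' < 64)%N ->
  tab (set_tab s slot i v) slot' i' = if (slot' == slot) && (i' == i) then v else tab s slot' i'.
Proof.
move=> h h'; rewrite /tab /set_tab cell_set /cadr; congr (if _ then _ else _); lia.
Qed.

Hypothesis HB : (2000 * n + 2000 <= B)%N.

(** All indices, namely steps, shifted positions and shifted rows, stay below [5 * n + 5]; the
    addresses are then at most [2 * n + 2 + 64 * (5 * n + 5) + 63], which [HB] covers with room to
    spare. *)
Lemma addr_ok s slot idx : reg s 0 = n%:Z -> (slot < 64)%N -> esafe B s idx -> 0 <= eval s idx -> eval s idx <= 5 * n%:Z + 5 ->
  esafe B s (addrE slot idx) /\ eval s (addrE slot idx) = (cadr slot `|eval s idx|)%:Z.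
Proof.
move=> sn sl si i0 iN; rewrite /= sn /cadr.
move: (eval s idx) si i0 iN => v si i0 iN.
split; last by lia.
by repeat split=> //; lia.
Qed.

Lemma tab_ok s slot idx : reg s 0 = n%:Z -> (slot < 64)%N -> esafe B s idx -> 0 <= eval s idx -> eval s idx <= 5 * n%:Z + 5 ->
  esafe B s (tabE slot idx) /\ eval s (tabE slot idx) = tab s slot `|eval s idx|.
Proof.
move=> sn sl si i0 iN; have [h1 h2] := addr_ok sn sl si i0 iN.
rewrite -[eval s (tabE _ _)]/(cell s `|eval s (addrE slot idx)|%N) h2; split=> //.
by split; [exact: h1|rewrite h2].
Qed.

Lemma ok_PutT slot idx e s (Q : state -> Prop) : reg s 0 = n%:Z -> (slot < 64)%N -> esafe B s idx ->
  0 <= eval s idx -> eval s idx <= 5 * n%:Z + 5 -> esafe B s e ->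
  Q (set_tab s slot `|eval s idx|%N (eval s e)) -> ok (PutT slot idx e) s Q.
Proof.
move=> sn sl si i0 iN se HQ; have [h1 h2] := addr_ok sn sl si i0 iN.
split; first by split=> //; rewrite h2.
by rewrite /PutT [run _ _]/= -[_ + _ * _]/(eval s (addrE slot idx)) h2.
Qed.

End Rules.

Section TableRules.
Variables (B L n : nat).
Hypothesis HB : (2000 * n + 2000 <= B)%N.

Lemma ok_Asg_eq r e v s (Q : state -> Prop) : esafe B s e -> eval s e = v -> Q (set_reg s r v) -> ok B L (Asg r e) s Q.
Proof. by move=> h <-; exact: ok_Asg. Qed.

Lemma ok_Put_eq slot idx e (i : nat) v s (Q : state -> Prop) : reg s 0 = n%:Z -> (slot < 64)%N -> esafe B s idx ->
  eval s idx = i%:Z -> (i <= 5 * n + 5)%N -> esafe B s e -> eval s e = v ->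
  Q (set_tab n s slot i v) -> ok B L (PutT slot idx e) s Q.
Proof.
move=> sn sl si ei il se ev HQ; apply: (ok_PutT L HB sn sl si).
- by rewrite ei.
- by rewrite ei; move: il; clear; lia.
- exact: se.
- by rewrite ei absz_nat ev.
Qed.

Lemma tab_eq slot idx s (i : nat) : reg s 0 = n%:Z -> (slot < 64)%N -> esafe B s idx ->
  eval s idx = i%:Z -> (i <= 5 * n + 5)%N -> esafe B s (tabE slot idx) /\ eval s (tabE slot idx) = tab n s slot i.
Proof.
move=> sn sl si ei il; have := tab_ok HB sn sl si; rewrite ei => H.
by apply: H => //; move: il; clear; lia.
Qed.
End TableRules.

Fixpoint linked (nxt : nat -> int) (cur : int) (l : seq nat) : Prop :=
  if l is i :: l' then cur = i.+1%:Z /\ linked nxt (nxt i) l' else cur = 0.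

Lemma linked_eq nxt nxt' cur l : (forall i, i \in l -> nxt i = nxt' i) -> linked nxt cur l -> linked nxt' cur l.
Proof.
elim: l cur => //= i l IH cur H [-> h]; split=> //; rewrite -H ?mem_head //.
by apply: IH h => j jl; apply: H; rewrite inE jl orbT.
Qed.

(** * The tables filled for one direction *)

Section Arrays.
Variables (n : nat) (sv : nat -> int) (ty : nat -> nat).
Hypothesis sv1 : forall k, sv k = 1 \/ sv k = -1.
Variables d d1 : nat.

(* After [k] steps: the position [cB] in the row, the row [cB + cC], the sum
   [cPS] whose differences count hexagons, and the number [cPP] of positive
   steps, half the length up to parity. *)
Fixpoint cB k : int := if k is k'.+1 then cB k' + (if ty k' == d then 0 else if ty k' == d1 then sv k' else 0) else 0.
Fixpoint cC k : int := if k is k'.+1 then cC k' + (if ty k' == d then 0 else if ty k' == d1 then 0 else sv k') else 0.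
Fixpoint cPS k : int := if k is k'.+1 then cPS k' + (if ty k' == d then sv k' * cB k' else 0) else 0.
Fixpoint cPP k : int := if k is k'.+1 then cPP k' + (if 1 <= sv k' then 1 else 0) else 0.

Lemma cBC_bnd k : `|cB k| + `|cC k| <= k%:Z.
Proof.
elim: k => //= k IH; move: (cB k) (cC k) IH => b c IH.
by case: (sv1 k) => ->; case: ifP => _; try case: ifP => _; lia.
Qed.

Lemma cPS_bnd k : (k <= n)%N -> `|cPS k| <= k%:Z * n%:Z.
Proof.
elim: k => [|k IH] kn; first by rewrite normr0.
have := IH (ltnW kn); have := cBC_bnd k; move: (cC k) => c bb {}IH; rewrite [cPS _]/=.
apply: (le_trans (ler_normD _ _)); rewrite -addn1 PoszD mulrDl mul1r.
apply: lerD => //; case: ifP => _; last by rewrite normr0.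
by move: (cB k) bb => b; case: (sv1 k) => ->; lia.
Qed.

Lemma cPP_bnd k : 0 <= cPP k <= k%:Z.
Proof. by elim: k => //= k; case: ifP => _; lia. Qed.

(** Reversed, since [fill_body] pushes each step at the head of its list. *)
Definition bucket k p := rev [seq i <- iota 0 k | (ty i == d) && (cB i + n%:Z == p%:Z)].

Lemma bucketS k p : bucket k.+1 p = if (ty k == d) && (cB k + n%:Z == p%:Z) then k :: bucket k p else bucket k p.
Proof.
rewrite /bucket -addn1 iotaD filter_cat rev_cat /= add0n.
by case: ifP.
Qed.

Lemma mem_bucket k p i : (i \in bucket k p) = [&& (i < k)%N, ty i == d & cB i + n%:Z == p%:Z].
Proof. by rewrite mem_rev mem_filter mem_iota /= add0n andbC. Qed.

Lemma uniq_bucket k p : uniq (bucket k p).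
Proof. by rewrite rev_uniq filter_uniq ?iota_uniq. Qed.

Notation sl j := (8 * d + j)%N.
Hypothesis d3 : (d < 3)%N.
Hypothesis dd1 : d <> d1.
Hypothesis d13 : (d1 < 3)%N.

Record filled (k : nat) (s0 acc : int) (s : state) : Prop := Filled {
  f_n : reg s 0 = n%:Z;
  f_s0 : reg s 1 = s0;
  f_a : reg s 11 = acc;
  f_ty : forall i, (i < n)%N -> tab n s 60 i = (ty i)%:Z;
  f_sg : forall i, (i < n)%N -> tab n s 61 i = sv i;
  f_PS : forall i, (i < k)%N -> tab n s (sl 5) i = cPS i;
  f_PP : forall i, (i < k)%N -> tab n s (sl 6) i = cPP i;
  f_pos : forall i, (i < k)%N -> ty i = d -> tab n s (sl 3) i = cB i;
  f_row : forall i, (i < k)%N -> ty i = d -> tab n s (sl 4) i = cB i + cC i;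
  f_head : forall p, linked (tab n s (sl 1)) (tab n s (sl 0) p) (bucket (minn k n) p);
  f_last : forall r, tab n s (sl 2) r = 0;
  f_later : forall slot i, (8 * d + 8 <= slot < 24)%N -> tab n s slot i = 0
}.

Record fillregs k (s : state) : Prop := FillRegs {
  g_B : reg s 3 = cB k; g_C : reg s 4 = cC k; g_PS : reg s 9 = cPS k; g_PP : reg s 10 = cPP k }.

Variables (B L : nat).
Hypothesis HB : (2000 * n + 2000 <= B)%N.
Hypothesis HB2 : (100 * n * n <= B)%N.
Hypothesis ty3 : forall k, (ty k < 3)%N.

Lemma fill_body_ok k s0 acc s : (k < n)%N -> filled k s0 acc s -> fillregs k s -> reg s 5 = k%:Z ->
  ok B L (fill_body d d1) s (fun s' => filled k.+1 s0 acc (set_reg s' 5 k.+1%:Z) /\ fillregs k.+1 (set_reg s' 5 k.+1%:Z)).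
Proof.
move=> kn F G sI.
have [Fn Fs0 Fa Fty Fsg FPS FPP Fpos Frow Fh Fl Flt] := F; have [GB GC GPS GPP] := G.
have kmin : minn k n = k by lia.
have kmin' : minn k.+1 n = k.+1 by lia.
rewrite kmin in Fh.
have bc := cBC_bnd k.
have psb := cPS_bnd (ltnW kn).
have ppb := cPP_bnd k.
have kn5 : (k <= 5 * n + 5)%N by lia.
apply: ok_Sq.
have [e1 e2] := tab_eq HB (s := s) (slot := 60) (idx := Var 5) Fn isT I sI kn5.
apply: (ok_Asg_eq _ e1 e2); rewrite (Fty _ kn).
set s1 := set_reg s _ _.
apply: ok_Sq.
have [e3 e4] := tab_eq HB (s := s1) (slot := 61) (idx := Var 5) Fn isT I sI kn5.
apply: (ok_Asg_eq _ e3 e4); rewrite tab_reg (Fsg _ kn).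
set s2 := set_reg s1 _ _.
have slot_lt j : (j < 8)%N -> (sl j < 64)%N by lia.
apply: ok_Sq; apply: (@ok_Put_eq B L n HB (sl 5) (Var 5) (Var 9) k (cPS k) s2) => //; first exact: slot_lt.
apply: ok_Sq; apply: (@ok_Put_eq B L n HB (sl 6) (Var 5) (Var 10) k (cPP k)) => //; first exact: slot_lt.
set s4 := set_tab _ _ _ _ _.
have s4n : reg s4 0 = n%:Z by [].
have s4I : reg s4 5 = k%:Z by [].
have s4T : reg s4 15 = (ty k)%:Z by [].
have s4S : reg s4 2 = sv k by [].
have s4B : reg s4 3 = cB k by [].
have s4C : reg s4 4 = cC k by [].
have s4PS : reg s4 9 = cPS k by [].
have s4PP : reg s4 10 = cPP k by [].
have T4 j i : (j < 64)%N -> tab n s4 j i =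
   if (j == sl 6) && (i == k) then cPP k else if (j == sl 5) && (i == k) then cPS k else tab n s j i.
  by move=> jl; rewrite /s4 !tab_set //; exact: slot_lt.
have ok5 : filled k s0 acc s4 /\ tab n s4 (sl 5) k = cPS k /\ tab n s4 (sl 6) k = cPP k.
  split; last by rewrite !T4 ?slot_lt // !eqxx !eqn_add2l.
  split=> //.
  - by move=> i hi; rewrite T4 // -Fty //; do 2?case: eqP => //=; clear -d3; lia.
  - by move=> i hi; rewrite T4 // -Fsg //; do 2?case: eqP => //=; clear -d3; lia.
  - by move=> i hi; rewrite T4 ?slot_lt // !eqn_add2l eqxx /= ltn_eqF // FPS.
  - by move=> i hi; rewrite T4 ?slot_lt // !eqn_add2l eqxx /= ltn_eqF // FPP.
  - by move=> i hi; rewrite T4 ?slot_lt // !eqn_add2l /=; apply: Fpos.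
  - by move=> i hi; rewrite T4 ?slot_lt // !eqn_add2l /=; apply: Frow.
  - move=> p; rewrite kmin T4 ?slot_lt // !eqn_add2l /=.
    by apply: linked_eq (Fh p) => i _; rewrite T4 ?slot_lt // !eqn_add2l.
  - by move=> r; rewrite T4 ?slot_lt // !eqn_add2l /=.
  - move=> slot i hs; rewrite T4; last by clear -hs; lia.
    have [-> ->] : (slot == sl 6) = false /\ (slot == sl 5) = false by clear -hs; split; lia.
    exact: Flt.
move: s4n s4I s4T s4S s4B s4C s4PS s4PP ok5 {T4 e1 e2 e3 e4 F G Fn Fs0 Fa Fty Fsg FPS FPP Fpos Frow Fh Fl Flt GB GC GPS GPP sI}.
clearbody s4; clear s1 s2; move=> n4 I4 T4 S4 B4 C4 PS4 PP4 [F [tPS tPP]].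
have [Fn Fs0 Fa Fty Fsg FPS FPP Fpos Frow Fh Fl Flt] := F; rewrite kmin in Fh.
apply: ok_Sq.
have sqT : eval s4 (sq (Minus (Var 15) (Cst d))) = ((ty k)%:Z - d%:Z) * ((ty k)%:Z - d%:Z) by rewrite /= T4.
(* The update of [rPP] that follows all three branches on the direction. *)
have fin s5 : filled k.+1 s0 acc s5 -> reg s5 3 = cB k.+1 -> reg s5 4 = cC k.+1 -> reg s5 9 = cPS k.+1 ->
    reg s5 10 = cPP k -> reg s5 2 = sv k ->
    ok B L (If (Cst 1) (Var 2) (Asg 10 (Plus (Var 10) (Cst 1))) skip) s5
      (fun s' => filled k.+1 s0 acc (set_reg s' 5 k.+1%:Z) /\ fillregs k.+1 (set_reg s' 5 k.+1%:Z)).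
  move=> F5 B5 C5 PS5 PP5 S5.
  have F5' : forall r v, (1 < r)%N -> r <> 11%N -> filled k.+1 s0 acc (set_reg s5 r v).
    move=> r v r1 r11; case: F5 => *; split=> //=.
    - by case: eqP => // e; rewrite -e in r1.
    - by case: eqP => // e; rewrite -e in r1.
    - by case: eqP => // e; case: r11.
  have F6 : forall r v, (1 < r)%N -> r <> 11%N -> filled k.+1 s0 acc (set_reg (set_reg s5 r v) 5 k.+1%:Z).
    by move=> r v r1 r11; case: (F5' r v r1 r11).
  apply: ok_If => //=; first by clear -HB; lia.
    rewrite S5 => s1; apply: (@ok_Asg_eq _ _ _ _ (cPP k.+1)).
    - by split=> //; split; rewrite /= ?PP5; clear -ppb HB kn; lia.
    - by rewrite /= PP5 s1.
    - by split; [exact: F6|split].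
  rewrite S5 => s1; apply: (@ok_Asg_eq _ _ _ _ 0) => //.
  split; first exact: F6.
  by split=> //=; rewrite PP5 leNgt s1 addr0.
have sq0 (a b : nat) : ((a%:Z - b%:Z) * (a%:Z - b%:Z) <= 0) = (a == b).
  by rewrite -expr2 exprn_even_le0 // subr_eq0 eqz_nat.
have tyk := ty3 k.
apply: ok_If.
- have h1 : (`|((ty k)%:Z - d%:Z)%R| <= 3)%N by clear -tyk d3; lia.
  have h2 : (`|(((ty k)%:Z - d%:Z) * ((ty k)%:Z - d%:Z))%R| <= 9)%N by rewrite abszM; clear -h1; nia.
  by repeat split=> //=; rewrite ?T4; clear -h1 h2 HB d3; lia.
- by [].
- rewrite sqT /= sq0 => /eqP tk.
  have cBn : 0 <= cB k + n%:Z /\ cB k + n%:Z <= 2 * n%:Z by clear -bc kn; lia.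
  pose p := `|(cB k + n%:Z)%R|%N.
  have pE : cB k + n%:Z = p%:Z by rewrite /p gez0_abs //; case: cBn.
  have p5 : (p <= 5 * n + 5)%N by clear -pE cBn; lia.
  apply: ok_Sq; apply: (@ok_Put_eq B L n HB (sl 3) (Var 5) (Var 3) k (cB k)) => //; first exact: slot_lt.
  apply: ok_Sq; apply: (@ok_Put_eq B L n HB (sl 4) (Var 5) (Plus (Var 3) (Var 4)) k (cB k + cC k)) => //.
  + exact: slot_lt.
  + by split=> //; split=> //=; rewrite B4 C4; clear -bc kn HB; lia.
  + by rewrite /= B4 C4.
  set s5 := set_tab _ _ _ _ _.
  apply: ok_Sq.
  have a3 : esafe B s5 (Plus (Var 3) (Var 0)).
    by split=> //; split=> //=; rewrite B4 n4 pE; clear -p5 HB; lia.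
  have a4 : eval s5 (Plus (Var 3) (Var 0)) = p%:Z by rewrite /= B4 n4.
  have [a1 a2] := tab_eq HB (n4 : reg s5 0 = n%:Z) (slot_lt 0%N isT) a3 a4 p5.
  apply: (@ok_Put_eq B L n HB (sl 1) (Var 5) _ k _ s5 _ n4 (slot_lt 1%N isT) I I4 kn5 a1 a2).
  set s6 := set_tab _ _ _ _ _.
  have B6 : reg s6 3 = cB k := B4.
  have n6 : reg s6 0 = n%:Z := n4.
  have I6 : reg s6 5 = k%:Z := I4.
  apply: ok_Sq; apply: (@ok_Put_eq B L n HB (sl 0) (Plus (Var 3) (Var 0)) (Plus (Var 5) (Cst 1)) p k.+1%:Z s6) => //.
  + exact: slot_lt.
  + by split=> //; split=> //=; rewrite ?I4; clear -kn HB; lia.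
  + by rewrite /= I4 -addn1 PoszD.
  set s7 := set_tab _ _ _ _ _.
  have PS7 : reg s7 9 = cPS k := PS4.
  have S7 : reg s7 2 = sv k := S4.
  have B7 : reg s7 3 = cB k := B4.
  have PSn : cPS k.+1 = cPS k + sv k * cB k by rewrite /= tk eqxx.
  have psb1 := cPS_bnd kn.
  apply: (@ok_Asg_eq _ _ _ _ (cPS k.+1)).
  + have hb : (`|(sv k * cB k)%R| <= n)%N by case: (sv1 k) => ->; clear -bc kn; lia.
    split=> //; split; last by rewrite [eval _ _]/= PS7 S7 B7 -PSn; clear -psb1 kn HB2; nia.
    by split=> //; split=> //=; rewrite S7 B7; clear -hb HB; lia.
  + by rewrite PSn -PS7 -S7 -B7.
  apply: fin => //; last 2 first.
  + by rewrite /= tk eqxx addr0.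
  + by rewrite /= tk eqxx addr0.
  have T7 j i : (j < 64)%N -> tab n s7 j i =
     if (j == sl 0) && (i == p) then k.+1%:Z else if (j == sl 1) && (i == k) then tab n s5 (sl 0) p else
     if (j == sl 4) && (i == k) then cB k + cC k else if (j == sl 3) && (i == k) then cB k else tab n s4 j i.
    by move=> jl; rewrite /s7 /s6 /s5 !tab_set ?slot_lt.
  have T50 : tab n s5 (sl 0) p = tab n s4 (sl 0) p by rewrite /s5 !tab_set ?slot_lt // !eqn_add2l.
  split=> //.
  - by move=> i hi; rewrite tab_reg T7 // -Fty //; do 4?[case: ifP => [/andP[/eqP e _]|_]; first by exfalso; move: e; clear -d3; lia].
  - by move=> i hi; rewrite tab_reg T7 // -Fsg //; do 4?[case: ifP => [/andP[/eqP e _]|_]; first by exfalso; move: e; clear -d3; lia].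
  - move=> i hi; rewrite tab_reg T7 ?slot_lt // !eqn_add2l /=.
    by move: hi; rewrite ltnS leq_eqVlt => /orP[/eqP->|/FPS].
  - move=> i hi; rewrite tab_reg T7 ?slot_lt // !eqn_add2l /=.
    by move: hi; rewrite ltnS leq_eqVlt => /orP[/eqP->|/FPP].
  - move=> i hi ti; rewrite tab_reg T7 ?slot_lt // !eqn_add2l /=.
    by case: eqP => [->//|ne]; apply: Fpos => //; clear -hi ne; lia.
  - move=> i hi ti; rewrite tab_reg T7 ?slot_lt // !eqn_add2l /=.
    by case: eqP => [->//|ne]; apply: Frow => //; clear -hi ne; lia.
  - move=> q; rewrite kmin' bucketS tk eqxx andTb tab_reg T7 ?slot_lt // !eqn_add2l /= pE eqz_nat.
    have lk : linked (tab n (set_reg s7 9 (cPS k.+1)) (sl 1)) (tab n s4 (sl 0) q) (bucket k q).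
      apply: linked_eq (Fh q) => i; rewrite mem_bucket => /and3P[ik _ _].
      by rewrite tab_reg T7 ?slot_lt // !eqn_add2l /= ltn_eqF.
    rewrite [q == p]eq_sym; have [e|ne] := eqVneq p q; last exact: lk.
    split=> //; have nk : tab n s7 (sl 1) k = tab n s4 (sl 0) q.
      by rewrite -e -T50 T7 ?slot_lt // !eqn_add2l !eqxx.
    by move: lk; rewrite -nk.
  - by move=> r; rewrite tab_reg T7 ?slot_lt // !eqn_add2l /=.
  - move=> slot i hs; rewrite tab_reg T7; last by clear -hs; lia.
    do 4?[case: ifP => [/andP[/eqP e _]|_]; first by exfalso; move: e hs; clear; lia].
    exact: Flt.
rewrite sqT /= ltNge sq0 => /negPf tk.
have Fk1 r v : (1 < r)%N -> r <> 11%N -> filled k.+1 s0 acc (set_reg s4 r v).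
  move=> r1 r11; split=> //=.
  - by case: eqP => // e; rewrite -e in r1.
  - by case: eqP => // e; rewrite -e in r1.
  - by case: eqP => // e; case: r11.
  - by move=> i hi; move: hi; rewrite ltnS leq_eqVlt => /orP[/eqP->|/FPS].
  - by move=> i hi; move: hi; rewrite ltnS leq_eqVlt => /orP[/eqP->|/FPP].
  - move=> i hi ti; apply: Fpos => //.
    by move: hi; rewrite ltnS leq_eqVlt => /orP[/eqP e|//]; rewrite -e ti eqxx in tk.
  - move=> i hi ti; apply: Frow => //.
    by move: hi; rewrite ltnS leq_eqVlt => /orP[/eqP e|//]; rewrite -e ti eqxx in tk.
  - by move=> q; rewrite kmin' bucketS tk /=; exact: Fh.
have svb : `|sv k| = 1 by case: (sv1 k) => ->.
apply: ok_If.
- have h1 : (`|((ty k)%:Z - d1%:Z)%R| <= 3)%N by clear -tyk d13; lia.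
  have h2 : (`|(((ty k)%:Z - d1%:Z) * ((ty k)%:Z - d1%:Z))%R| <= 9)%N by rewrite abszM; clear -h1; nia.
  by repeat split=> //=; rewrite ?T4; clear -h1 h2 HB d13; lia.
- by [].
- rewrite /= T4 sq0 => tk1.
  apply: (@ok_Asg_eq _ _ _ _ (cB k.+1)).
  + by split=> //; split=> //=; rewrite B4 S4; clear -bc svb kn HB; lia.
  + by rewrite /= B4 S4 tk tk1.
  by apply: fin; [exact: Fk1| |rewrite /= C4 tk tk1 addr0|rewrite /= PS4 tk addr0| | ].
rewrite /= T4 ltNge sq0 => /negPf tk1.
apply: (@ok_Asg_eq _ _ _ _ (cC k.+1)).
- by split=> //; split=> //=; rewrite C4 S4; clear -bc svb kn HB; lia.
- by rewrite /= C4 S4 tk tk1.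
by apply: fin; [exact: Fk1|rewrite /= B4 tk tk1 addr0| |rewrite /= PS4 tk addr0| | ].
Qed.
End Arrays.

Section Dirs.
Variables (n : nat) (sv : nat -> int) (ty : nat -> nat).
Hypothesis sv1 : forall k, sv k = 1 \/ sv k = -1.
Variables d d1 : nat.
Notation sl j := (8 * d + j)%N.
Hypothesis d3 : (d < 3)%N.
Hypothesis d13 : (d1 < 3)%N.
Hypothesis dd1 : d <> d1.
Variables (B L : nat).
Hypothesis HB : (2000 * n + 2000 <= B)%N.
Hypothesis HB2 : (100 * n * n <= B)%N.
Hypothesis HL : (3 * n + 1 <= L)%N.
Hypothesis n0 : (0 < n)%N.
Hypothesis ty3 : forall k, (ty k < 3)%N.

Notation filled := (filled n sv ty d d1).
Notation cB := (cB sv ty d d1).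
Notation cC := (cC sv ty d d1).
Notation cPS := (cPS sv ty d d1).
Notation cPP := (cPP sv).
Notation bucket := (bucket n sv ty d d1).

Lemma filled_reg k s0 acc s r v : filled k s0 acc s -> (1 < r)%N -> r <> 11%N -> filled k s0 acc (set_reg s r v).
Proof.
move=> F r1 r11; case: F => *; split=> //=.
- by case: eqP => // e; rewrite -e in r1.
- by case: eqP => // e; rewrite -e in r1.
- by case: eqP => // e; case: r11.
Qed.

(** Every direction has eight slots of its own, so the table need not be cleared between directions:
    the slots of [d] and of the later directions are still 0. *)
Record ready (s0 acc : int) (s : state) : Prop := Ready {
  y_n : reg s 0 = n%:Z;
  y_s0 : reg s 1 = s0;
  y_a : reg s 11 = acc;
  y_ty : forall i, (i < n)%N -> tab n s 60 i = (ty i)%:Z;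
  y_sg : forall i, (i < n)%N -> tab n s 61 i = sv i;
  y_zero : forall slot i, (8 * d <= slot < 24)%N -> tab n s slot i = 0
}.

Lemma esafe_cst s (c : int) : (`|c| <= 2000)%N -> esafe B s (Cst c).
Proof. by move=> /= h; clear -h HB; lia. Qed.

Definition area_sign : int := if 1 <= cPS n then 1 else -1.

Lemma fill_ok s0 acc s : ready s0 acc s -> ok B L (fill d d1) s (fun s' =>
  [/\ filled n s0 acc s', tab n s' (sl 5) n = cPS n, tab n s' (sl 6) n = cPP n & reg s' 12 = area_sign]).
Proof.
case=> yn ys ya yty ysg yz.
have slot_lt j : (j < 8)%N -> (sl j < 64)%N by clear -d3; lia.
have psb : `|cPS n| <= n%:Z * n%:Z by apply: cPS_bnd.
have ppb : 0 <= cPP n <= n%:Z by apply: cPP_bnd.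
rewrite /fill; apply: ok_Sq; apply: (@ok_Asg_eq _ _ _ _ (n%:Z - 1)).
- by split=> //; split=> //=; rewrite ?yn; clear -HB n0; lia.
- by rewrite /= yn.
do 4?[apply: ok_Sq; apply: (@ok_Asg_eq _ _ _ _ 0); [by []|by []|]].
set s1 := set_reg _ _ _.
apply: ok_Sq; apply: (@ok_For _ _ _ _ _ _
   (fun k s => filled k s0 acc s /\ fillregs sv ty d d1 k s) n) => //.
- by rewrite /= subrK.
- by clear -HL; lia.
- by clear -HB; lia.
- by clear -HB; lia.
- split=> //; split=> //.
  + by move=> p; rewrite min0n /=; apply: yz; clear -d3; lia.
  + by move=> r; apply: yz; clear -d3; lia.
  + by move=> slot i hs; apply: yz; clear -hs; lia.
- by move=> k s' kn [F G] sI _; apply: (fill_body_ok (d := d) (d1 := d1) sv1) => //.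
move=> s2 [F G]; have [GB GC GPS GPP] := G.
have [Fn Fs0 Fa Fty Fsg FPS FPP Fpos Frow Fh Fl Flt] := F.
have n5 : (n <= 5 * n + 5)%N by clear; lia.
apply: ok_Sq; apply: (@ok_Put_eq B L n HB (sl 5) (Var 0) (Var 9) n (cPS n) s2) => //; first exact: slot_lt.
set s3 := set_tab _ _ _ _ _.
apply: ok_Sq; apply: (@ok_Put_eq B L n HB (sl 6) (Var 0) (Var 10) n (cPP n) s3) => //; first exact: slot_lt.
set s4 := set_tab _ _ _ _ _.
have T4 j i : (j < 64)%N -> tab n s4 j i =
   if (j == sl 6) && (i == n) then cPP n else if (j == sl 5) && (i == n) then cPS n else tab n s2 j i.
  by move=> jl; rewrite /s4 /s3 !tab_set //; exact: slot_lt.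
have t5 : tab n s4 (sl 5) n = cPS n by rewrite T4 ?slot_lt // !eqn_add2l !eqxx.
have t6 : tab n s4 (sl 6) n = cPP n by rewrite T4 ?slot_lt // !eqxx.
have F4 : filled n s0 acc s4.
  split=> //.
  - move=> i hi; rewrite T4 //.
    have [-> ->] : (60 == sl 6)%N = false /\ (60 == sl 5)%N = false by clear -d3; split; lia.
    exact: Fty.
  - move=> i hi; rewrite T4 //.
    have [-> ->] : (61 == sl 6)%N = false /\ (61 == sl 5)%N = false by clear -d3; split; lia.
    exact: Fsg.
  - by move=> i hi; rewrite T4 ?slot_lt // !eqn_add2l eqxx /= ltn_eqF // FPS.
  - by move=> i hi; rewrite T4 ?slot_lt // !eqn_add2l eqxx /= ltn_eqF // FPP.
  - by move=> i hi; rewrite T4 ?slot_lt // !eqn_add2l /=; apply: Fpos.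
  - by move=> i hi; rewrite T4 ?slot_lt // !eqn_add2l /=; apply: Frow.
  - move=> p; rewrite T4 ?slot_lt // !eqn_add2l /=.
    by apply: linked_eq (Fh p) => i _; rewrite T4 ?slot_lt // !eqn_add2l.
  - by move=> r; rewrite T4 ?slot_lt // !eqn_add2l /=.
  - move=> slot i hs; rewrite T4; last by clear -hs; lia.
    have [-> ->] : (slot == sl 6) = false /\ (slot == sl 5) = false by clear -hs; split; lia.
    exact: Flt.
have r4 : reg s4 9 = cPS n := GPS.
apply: ok_If => //; first by apply: esafe_cst.
- move=> h; apply: (@ok_Asg_eq _ _ _ _ 1) => //; first exact: esafe_cst.
  by split=> //; [exact: filled_reg|rewrite /= /area_sign -r4 h].
- move=> h; apply: (@ok_Asg_eq _ _ _ _ (-1)) => //; first exact: esafe_cst.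
  by split=> //; [exact: filled_reg|rewrite /= /area_sign -r4 leNgt h].
Qed.

End Dirs.

(** * Pairing the ends of runs, abstractly *)

Section Pairing.
Variables (n : nat) (isd : nat -> bool) (row pos : nat -> int) (left_in : nat -> bool).
Hypothesis H_uniq : forall i j, (i < n)%N -> (j < n)%N -> isd i -> isd j -> row i = row j -> pos i = pos j -> i = j.
Hypothesis H_first : forall k, (k < n)%N -> isd k -> left_in k ->
  exists k', [/\ (k' < n)%N, isd k', row k' = row k & pos k' < pos k].
Hypothesis H_alt : forall k k', (k < n)%N -> (k' < n)%N -> isd k -> isd k' -> row k = row k' -> pos k < pos k' ->
  (forall l, (l < n)%N -> isd l -> row l = row k -> pos k < pos l -> pos l < pos k' -> False) ->
  left_in k' = ~~ left_in k.

Definition maxin (pl : seq nat) k := forall k', k' \in pl -> row k' = row k -> pos k' <= pos k.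

(* The table [T] records, for every row, the last step met when it begins a run
   that is not finished yet. *)
Definition lastspec (off : int) (T : nat -> int) (pl : seq nat) := forall r : nat,
  (T r = 0 /\ forall k, k \in pl -> row k + off = r%:Z -> maxin pl k -> left_in k) \/
  (exists k, [/\ k \in pl, T r = k.+1%:Z, row k + off = r%:Z, maxin pl k & ~~ left_in k]).

Lemma max_ex (pl : seq nat) rho : (exists2 k, k \in pl & row k = rho) ->
  exists k, [/\ k \in pl, row k = rho & maxin pl k].
Proof.
elim: pl => [[k]//|a pl IH [k kp kr]].
have [hs|no] := boolP (has (fun k => row k == rho) pl).
  case/hasP: hs => k' k'p /eqP k'r.
  have [m [mp mr mm]] := IH (ex_intro2 _ _ k' k'p k'r).
  have [ar|ar] := eqVneq (row a) rho; last first.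
    exists m; split=> //; first by rewrite inE mp orbT.
    move=> j; rewrite inE => /orP[/eqP->|jp]; last exact: mm.
    by rewrite mr => e; rewrite e eqxx in ar.
  have [le|lt] := leP (pos a) (pos m).
    exists m; split=> //; first by rewrite inE mp orbT.
    by move=> j; rewrite inE => /orP[/eqP->//|jp]; exact: mm.
  exists a; split=> //; first by rewrite mem_head.
  move=> j; rewrite inE => /orP[/eqP->//|jp] jr; apply: le_trans (ltW lt); apply: mm => //.
  by rewrite jr ar mr.
exists a; have ka : k = a.
  move: kp; rewrite inE => /orP[/eqP//|kp]; by move/hasPn: no => /(_ _ kp); rewrite kr eqxx.
split; [by rewrite mem_head|by rewrite -ka|].
move=> j; rewrite inE => /orP[/eqP->//|jp] jr.
by move/hasPn: no => /(_ _ jp); rewrite jr -ka kr eqxx.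
Qed.

Variables (off : int) (T : nat -> int) (pl : seq nat) (k r : nat).
Hypothesis kn : (k < n)%N.
Hypothesis kd : isd k.
Hypothesis LS : lastspec off T pl.
Hypothesis PL1 : forall k', k' \in pl -> [/\ (k' < n)%N, isd k', pos k' <= pos k & k' <> k].
Hypothesis PL2 : forall k', (k' < n)%N -> isd k' -> pos k' < pos k -> k' \in pl.
Hypothesis rE : row k + off = r%:Z.

Lemma rowpos k' : k' \in pl -> row k' = row k -> pos k' < pos k.
Proof.
move=> kp kr; have [k'n k'd le ne] := PL1 kp; rewrite lt_neqAle le andbT.
by apply/eqP => e; apply: ne; apply: H_uniq.
Qed.

Lemma between m : m \in pl -> row m = row k -> maxin pl m -> forall l, (l < n)%N -> isd l -> row l = row m ->
  pos m < pos l -> pos l < pos k -> False.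
Proof.
move=> mp mr mm l ln ld lr lt1 lt2; have := mm _ (PL2 ln ld lt2) lr.
by rewrite leNgt lt1.
Qed.

Lemma maxk : maxin (rcons pl k) k.
Proof.
by move=> j; rewrite mem_rcons inE => /orP[/eqP->//|jp] jr; apply: ltW; apply: rowpos.
Qed.

Lemma max_other j : maxin (rcons pl k) j -> j \in rcons pl k -> row j = row k -> j = k.
Proof.
move=> mj; rewrite mem_rcons inE => /orP[/eqP//|jp] jr.
have := mj k; rewrite mem_rcons mem_head => /(_ isT (esym jr)).
by rewrite leNgt rowpos.
Qed.

Lemma lastspec_step v : (if left_in k then v = 0 else v = k.+1%:Z) ->
  lastspec off (fun q => if q == r then v else T q) (rcons pl k).
Proof.
move=> hv q; have [->|ne] := eqVneq q r.
  case: (boolP (left_in k)) hv => iL hv.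
    left; split=> // j jp jr jm.
    have : row j = row k by move: jr; rewrite -rE => /addIr.
    by move=> /(max_other jm jp) ->.
  right; exists k; split=> //; first by rewrite mem_rcons mem_head.
  exact: maxk.
have rq j : row j + off = q%:Z -> row j <> row k.
  by move=> jq e; move: ne; rewrite -eqz_nat -jq e rE eqxx.
have mq j : row j + off = q%:Z -> j \in pl -> maxin pl j <-> maxin (rcons pl k) j.
  move=> jq jp; split=> m i.
    by rewrite mem_rcons inE => /orP[/eqP-> e|/m//]; case: (rq j jq).
  by move=> ip; apply: m; rewrite mem_rcons inE ip orbT.
case: (LS q) => [[T0 H]|[j [jp Tj jr jm iL]]].
  left; split=> // j; rewrite mem_rcons inE => /orP[/eqP->|jp] jr jm; last by apply: H => //; apply/mq.
  by case: (rq k jr).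
by right; exists j; split=> //; [rewrite mem_rcons inE jp orbT|apply/mq].
Qed.

(** If [k] were the end of a run, [H_first] would give an earlier step in its row. The last such
    step is also an end, since the table holds nothing for the row, and two ends in succession
    contradict [H_alt]. *)
Lemma lastspec_zero : T r = 0 -> ~~ left_in k.
Proof.
move=> Tr; apply/negP => iL; have [k' [k'n k'd k'r lt]] := H_first kn kd iL.
have [m [mp mr mm]] := max_ex (ex_intro2 _ _ k' (PL2 k'n k'd lt) k'r).
case: (LS r) => [[_ H]|[j [_ Tj _ _ _]]]; last by rewrite Tr in Tj.
have iLm : left_in m by apply: H => //; rewrite mr.
have [mn md _ _] := PL1 mp.
have := H_alt mn kn md kd mr (rowpos mp mr) (between mp mr mm).
by rewrite iL iLm.
Qed.

Lemma lastspec_pos : T r <> 0 -> exists j, [/\ T r = j.+1%:Z, (j < n)%N, isd j, row j = row k & pos j < pos k] /\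
  left_in k /\ ~~ left_in j /\ (forall l, (l < n)%N -> isd l -> row l = row j -> pos j < pos l -> pos l < pos k -> False).
Proof.
move=> Tr; case: (LS r) => [[//]|[j [jp Tj jr jm iL]]].
have {}jr : row j = row k by move: jr; rewrite -rE => /addIr.
have [jn jd _ _] := PL1 jp; have lt := rowpos jp jr; have bt := between jp jr jm.
exists j; split; [by split|split; [|by split]].
by rewrite (H_alt jn kn jd kd jr lt bt).
Qed.

End Pairing.

(** * The contribution of a pair of steps and its size *)

Section Sweeping.
Variables (n : nat) (sv : nat -> int) (ty : nat -> nat).
Hypothesis sv1 : forall k, sv k = 1 \/ sv k = -1.
Variables d d1 : nat.
Notation sl j := (8 * d + j)%N.
Hypothesis d3 : (d < 3)%N.
Variables (B L : nat).
Hypothesis HB : (2000 * n + 2000 <= B)%N.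
Hypothesis HB2 : (100 * n * n <= B)%N.
Hypothesis n0 : (0 < n)%N.

Notation cB := (cB sv ty d d1).
Notation cC := (cC sv ty d d1).
Notation cPS := (cPS sv ty d d1).
Notation cPP := (cPP sv).
Notation bucket := (bucket n sv ty d d1).
Notation area_sign := (area_sign n sv ty d d1).

Record tables (s0 : int) (s : state) : Prop := Tables {
  h_n : reg s 0 = n%:Z;
  h_s0 : reg s 1 = s0;
  h_g : reg s 12 = area_sign;
  h_ty : forall i, (i < n)%N -> tab n s 60 i = (ty i)%:Z;
  h_sg : forall i, (i < n)%N -> tab n s 61 i = sv i;
  h_PS : forall i, (i <= n)%N -> tab n s (sl 5) i = cPS i;
  h_PP : forall i, (i <= n)%N -> tab n s (sl 6) i = cPP i;
  h_pos : forall i, (i < n)%N -> ty i = d -> tab n s (sl 3) i = cB i;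
  h_row : forall i, (i < n)%N -> ty i = d -> tab n s (sl 4) i = cB i + cC i;
  h_head : forall p, linked (tab n s (sl 1)) (tab n s (sl 0) p) (bucket n p);
  h_later : forall slot i, (8 * d + 8 <= slot < 24)%N -> tab n s slot i = 0
}.

Lemma tables_reg s0 s r v : tables s0 s -> (1 < r)%N -> r <> 12%N -> tables s0 (set_reg s r v).
Proof.
move=> F r1 r12; case: F => *; split=> //=.
- by case: eqP => // e; rewrite -e in r1.
- by case: eqP => // e; rewrite -e in r1.
- by case: eqP => // e; case: r12.
Qed.

Lemma slot_lt j : (j < 8)%N -> (sl j < 64)%N.
Proof. by clear -d3; lia. Qed.

Lemma tab_set_other s i v slot i' : (slot < 64)%N -> slot <> sl 2 -> tab n (set_tab n s (sl 2) i v) slot i' = tab n s slot i'.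
Proof. by move=> h ne; rewrite tab_set ?slot_lt //; case: eqP. Qed.

Lemma tables_put s0 s i v : tables s0 s -> tables s0 (set_tab n s (sl 2) i v).
Proof.
case=> h1 h2 h3 h4 h5 h6 h7 h8 h9 h10 h11; split=> //.
- by move=> j jn; rewrite tab_set_other ?h4 //; clear -d3; lia.
- by move=> j jn; rewrite tab_set_other ?h5 //; clear -d3; lia.
- by move=> j jn; rewrite tab_set_other ?h6 ?slot_lt // => /addnI.
- by move=> j jn; rewrite tab_set_other ?h7 ?slot_lt // => /addnI.
- by move=> j jn; rewrite tab_set_other ?slot_lt // => [|/addnI//]; exact: h8.
- by move=> j jn; rewrite tab_set_other ?slot_lt // => [|/addnI//]; exact: h9.
- move=> p; rewrite tab_set_other ?slot_lt // => [|/addnI//].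
  by apply: linked_eq (h10 p) => j _; rewrite tab_set_other ?slot_lt // => /addnI.
- move=> slot j hs; rewrite tab_set_other; [exact: h11|clear -hs|clear -hs]; lia.
Qed.

(** The term [(r + 1) * m1 * m2] of [run_term_arc], with both counts divided by two: differences of
    [cPP] stand for half the lengths of the arcs. *)
Definition pair_term j k : int :=
  let a := minn j k in let b := maxn j k in let r := cB k - cB j in
  (r + 1) * (3 * area_sign * (cPS b - cPS a.+1) + (cPP b - cPP a.+1) + r)
   * (3 * area_sign * (cPS n - cPS b.+1 + cPS a) + (cPP n - cPP b.+1 + cPP a) + r).

Lemma area_signP : area_sign = 1 \/ area_sign = -1.
Proof. by rewrite /area_sign; case: ifP; [left|right]. Qed.

Lemma pair_term_parts j k : (j < n)%N -> (k < n)%N -> cB j < cB k ->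
  let a := minn j k in let b := maxn j k in let r := cB k - cB j in
  [/\ 0 <= r <= 2 * n%:Z, `|cPS b - cPS a.+1| <= 2 * (n%:Z * n%:Z), 
   `|cPP b - cPP a.+1| <= n%:Z,
   `|cPS n - cPS b.+1 + cPS a| <= 3 * (n%:Z * n%:Z) & `|cPP n - cPP b.+1 + cPP a| <= 2 * n%:Z] /\
   [/\ `|cPS n - cPS b.+1| <= 2 * (n%:Z * n%:Z), `|cPP n - cPP b.+1| <= n%:Z & n%:Z <= n%:Z * n%:Z].
Proof.
move=> jn kn lt a b r.
have an : (a < n)%N by rewrite /a; clear -jn; lia.
have bn : (b < n)%N by rewrite /b; clear -jn kn; lia.
have q (i : nat) : (i <= n)%N -> `|cPS i| <= n%:Z * n%:Z.
  move=> le; apply: le_trans (cPS_bnd ty sv1 d d1 le) _; clear -le; nia.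
have pp (i : nat) : (i <= n)%N -> 0 <= cPP i <= n%:Z.
  move=> le; have := cPP_bnd sv i; clear -le; lia.
have b1 := cBC_bnd ty sv1 d d1 j; have b2 := cBC_bnd ty sv1 d d1 k.
have q1 := q _ (ltnW an); have q2 := q _ an; have q3 := q _ (ltnW bn); have q4 := q _ bn; have q5 := q _ (leqnn n).
have p1 := pp _ (ltnW an); have p2 := pp _ an; have p3 := pp _ (ltnW bn); have p4 := pp _ bn; have p5 := pp _ (leqnn n).
have nn : n%:Z <= n%:Z * n%:Z by clear -n0; nia.
rewrite /r; split.
  split; [clear -b1 b2 jn kn lt|clear -q2 q3|clear -p2 p3|clear -q1 q4 q5|clear -p1 p4 p5]; lia.
split=> //; [clear -q4 q5|clear -p4 p5]; lia.
Qed.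

(** The constant 13 comes from [9 * N ^ 2 + 2 * N + 2 * N] and [N <= N ^ 2]. *)
Lemma factor_bnd (N g x y r : int) : 1 <= N -> g = 1 \/ g = -1 -> `|x| <= 3 * (N * N) -> `|y| <= 2 * N -> 0 <= r <= 2 * N ->
  [/\ `|3 * g| <= 3, `|3 * g * x| <= 9 * (N * N), `|3 * g * x + y| <= 11 * (N * N) & `|3 * g * x + y + r| <= 13 * (N * N)].
Proof.
move=> n1 hg hx hy hr; have nn : N <= N * N by clear -n1; nia.
by case: hg => ->; rewrite ?mulrN ?mulNr ?mulr1 ?normrN; split; clear -hx hy hr nn; lia.
Qed.

(** The product of [3 * N] and twice [13 * N ^ 2] is [507 * N ^ 5], rounded up to 600. *)
Lemma prod_bnd (N r x y : int) : 1 <= N -> 0 <= r <= 2 * N -> `|x| <= 13 * (N * N) -> `|y| <= 13 * (N * N) ->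
  `|(r + 1) * x| <= 39 * (N * N * N) /\ `|(r + 1) * x * y| <= 600 * (N ^+ 5).
Proof.
move=> n1 hr hx hy.
have h1 : `|r + 1| <= 3 * N by clear -hr n1; lia.
have h2 : `|(r + 1) * x| <= 39 * (N * N * N).
  rewrite normrM (_ : 39 * (N * N * N) = (3 * N) * (13 * (N * N))); last by clear; lia.
  exact: ler_pM.
split=> //; rewrite normrM.
apply: (@le_trans _ _ ((39 * (N * N * N)) * (13 * (N * N)))); first exact: ler_pM.
rewrite (_ : _ * _ = 507 * N ^+ 5); last by rewrite !exprS expr0; clear; lia.
apply: ler_wpM2r => //; apply: exprn_ge0; clear -n1; lia.
Qed.

Lemma esafe_bin s (f : int -> int -> int) (op : expr -> expr -> expr) a b (x y : int) :
  (forall a b, esafe B s (op a b) = (esafe B s a /\ esafe B s b /\ (`|eval s (op a b)| <= B)%N)) ->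
  (forall a b, eval s (op a b) = f (eval s a) (eval s b)) ->
  esafe B s a /\ eval s a = x -> esafe B s b /\ eval s b = y -> (`|f x y| <= B)%N ->
  esafe B s (op a b) /\ eval s (op a b) = f x y.
Proof. by move=> -> H [sa ea] [sb eb] h; rewrite !H ea eb. Qed.

Definition evals s e v := esafe B s e /\ eval s e = v.

Lemma evals_plus s a b x y : evals s a x -> evals s b y -> (`|(x + y)%R| <= B)%N -> evals s (Plus a b) (x + y).
Proof. by move=> ha hb h; apply: (@esafe_bin s +%R Plus). Qed.
Lemma evals_minus s a b x y : evals s a x -> evals s b y -> (`|(x - y)%R| <= B)%N -> evals s (Minus a b) (x - y).
Proof. by move=> ha hb h; apply: (@esafe_bin s (fun x y => x - y) Minus). Qed.
Lemma evals_times s a b x y : evals s a x -> evals s b y -> (`|(x * y)%R| <= B)%N -> evals s (Times a b) (x * y).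
Proof. by move=> ha hb h; apply: (@esafe_bin s *%R Times). Qed.
Lemma evals_var s r x : reg s r = x -> evals s (Var r) x.
Proof. by []. Qed.
Lemma evals_cst s (c : int) : (`|c| <= 2000)%N -> evals s (Cst c) c.
Proof. by move=> h; split=> //; apply: (esafe_cst HB). Qed.

Lemma evals_factor s ex ey (x y r : int) : reg s 12 = area_sign -> reg s 21 = r ->
  evals s ex x -> evals s ey y -> `|x| <= 3 * (n%:Z * n%:Z) -> `|y| <= 2 * n%:Z -> 0 <= r <= 2 * n%:Z ->
  evals s (Plus (Plus (Times (Times (Cst 3) (Var 12)) ex) ey) (Var 21)) (3 * area_sign * x + y + r).
Proof.
move=> h12 h21 hx hy bx by_ br; have n1 : 1 <= n%:Z by clear -n0; lia.
have [c1 c2 c3 c4] := factor_bnd n1 area_signP bx by_ br.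
have nB : 100 * (n%:Z * n%:Z) <= B%:Z by rewrite mulrA; clear -HB2; lia.
move: c1 c2 c3 c4 nB; set Q := n%:Z * n%:Z; set u := 3 * area_sign; set v := u * x; set w := v + y; set t := w + r.
move=> c1 c2 c3 c4 nB.
apply: evals_plus; [|exact: evals_var|by rewrite -/u -/v -/w -/t; clear -c4 nB; lia].
apply: evals_plus => //; last by rewrite -/u -/v -/w; clear -c3 nB; lia.
apply: evals_times => //; last by rewrite -/u -/v; clear -c2 nB; lia.
apply: evals_times; [exact: evals_cst|exact: evals_var|rewrite -/u; clear -c1 HB; lia].
Qed.

Lemma evals_tab s slot idx (i : nat) : reg s 0 = n%:Z -> (slot < 64)%N -> evals s idx i%:Z -> (i <= 5 * n + 5)%N ->
  evals s (tabE slot idx) (tab n s slot i).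
Proof. by move=> sn sl [h1 h2] il; exact: (tab_eq HB). Qed.

Lemma evals_inc s e (i : nat) : evals s e i%:Z -> (i <= n)%N -> evals s (inc e) i.+1%:Z.
Proof.
move=> h il; rewrite -addn1 PoszD; apply: evals_plus => //; first exact: evals_cst.
clear -il HB; lia.
Qed.

Lemma ok_Asg_evals r e v s (Q : state -> Prop) : evals s e v -> Q (set_reg s r v) -> ok B L (Asg r e) s Q.
Proof. by case=> h1 h2; exact: ok_Asg_eq. Qed.

Lemma pair_body_ok s0 s (j k R : nat) (A : int) : tables s0 s -> reg s 16 = k%:Z -> reg s 18 = j.+1%:Z -> reg s 17 = R%:Z ->
  (R <= 5 * n + 5)%N -> (j < n)%N -> (k < n)%N -> ty j = d -> ty k = d -> cB j < cB k ->
  `|reg s 11| <= A -> A + 600 * n%:Z ^+ 5 <= B%:Z ->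
  ok B L (pair_body d) s (fun s' => [/\ tables s0 s', reg s' 11 = reg s 11 + pair_term j k,
     (forall q, tab n s' (sl 2) q = if q == R then 0 else tab n s (sl 2) q), reg s' 16 = k%:Z & reg s' 13 = reg s 13 /\ forall q, tab n s' (sl 1) q = tab n s (sl 1) q]).
Proof.
move=> st rK rL rR R5 jn kn tj tk lt hA AB.
have [[cp1 cp2 cp3 cp4 cp5] [cp6 cp7 nn]] := pair_term_parts jn kn lt.
have comE : pair_term j k = let a := minn j k in let b := maxn j k in let r := cB k - cB j in
  (r + 1) * (3 * area_sign * (cPS b - cPS a.+1) + (cPP b - cPP a.+1) + r)
   * (3 * area_sign * (cPS n - cPS b.+1 + cPS a) + (cPP n - cPP b.+1 + cPP a) + r) by [].
have nB : 100 * (n%:Z * n%:Z) <= B%:Z by rewrite mulrA; clear -HB2; lia.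
have le5 i : (i <= n)%N -> (i <= 5 * n + 5)%N by clear; lia.
move: cp1 cp2 cp3 cp4 cp5 cp6 cp7 comE; cbv zeta => cp1 cp2 cp3 cp4 cp5 cp6 cp7 comE.
have an : (minn j k < n)%N by clear -jn kn; lia.
have bn : (maxn j k < n)%N by clear -jn kn; lia.
rewrite /pair_body; apply: ok_Sq; apply: (@ok_Asg_evals _ _ j%:Z).
  rewrite (_ : j%:Z = j.+1%:Z - 1); last by clear; lia.
  apply: evals_minus; [exact: evals_var|exact: evals_cst|clear -jn HB; lia].
set s1 := set_reg s _ _; have st1 : tables s0 s1 by apply: tables_reg.
apply: ok_Sq; apply: (@ok_Asg_evals _ _ k%:Z); first exact: evals_var.
set s2 := set_reg s1 _ _; have st2 : tables s0 s2 by apply: tables_reg.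
have n2 := h_n st2.
apply: ok_Sq; apply: (@ok_Asg_evals _ _ (cB k - cB j)).
  rewrite -(h_pos st2 kn tk) -(h_pos st2 jn tj).
  apply: evals_minus.
  - by apply: evals_tab (le5 _ (ltnW kn)) => //; exact: slot_lt.
  - by apply: evals_tab (le5 _ (ltnW jn)) => //; exact: slot_lt.
  - by rewrite (h_pos st2 kn tk) (h_pos st2 jn tj); clear -cp1 HB; lia.
set s3 := set_reg s2 _ _; have st3 : tables s0 s3 by apply: tables_reg.
(* What follows the exchange of the two steps: from here on [rJ] is the smaller and [rH] the larger
   one, whichever branch was taken. *)
have rest s4 : tables s0 s4 -> reg s4 19 = (minn j k)%:Z -> reg s4 20 = (maxn j k)%:Z -> reg s4 21 = cB k - cB j ->
   reg s4 11 = reg s 11 -> reg s4 17 = R%:Z -> reg s4 16 = k%:Z -> reg s4 13 = reg s 13 ->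
   (forall q, tab n s4 (sl 2) q = tab n s (sl 2) q) -> (forall q, tab n s4 (sl 1) q = tab n s (sl 1) q) ->
   ok B L (Sq (Asg 7 (Plus (Plus (Times (Times (Cst 3) (Var 12)) (Minus (tPS d (Var 20)) (tPS d (inc (Var 19)))))
                          (Minus (tPP d (Var 20)) (tPP d (inc (Var 19))))) (Var 21)))
  (Sq (Asg 8 (Plus (Plus (Times (Times (Cst 3) (Var 12))
                             (Plus (Minus (tPS d (Var 0)) (tPS d (inc (Var 20)))) (tPS d (Var 19))))
                          (Plus (Minus (tPP d (Var 0)) (tPP d (inc (Var 20)))) (tPP d (Var 19)))) (Var 21)))
  (Sq (Asg 11 (Plus (Var 11) (Times (Times (inc (Var 21)) (Var 7)) (Var 8))))
      (PutT (sl 2) (Var 17) (Cst 0))))) s4 (fun s' => [/\ tables s0 s', reg s' 11 = reg s 11 + pair_term j k,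
     (forall q, tab n s' (sl 2) q = if q == R then 0 else tab n s (sl 2) q), reg s' 16 = k%:Z & reg s' 13 = reg s 13 /\ forall q, tab n s' (sl 1) q = tab n s (sl 1) q]).
  move=> st4 r19 r20 r21 r11 r17 r16 r13 T4 T1.
  clear s1 s2 s3 st1 st2 st3 n2.
  set a := minn j k in an cp2 cp3 cp4 cp5 comE r19 *.
  set b := maxn j k in bn cp2 cp3 cp4 cp5 cp6 cp7 comE r20 *.
  set r := cB k - cB j in cp1 comE r21 *.
  have tS s' e (i : nat) : tables s0 s' -> evals s' e i%:Z -> (i <= n)%N -> evals s' (tPS d e) (cPS i).
    move=> st' he il; rewrite -(h_PS st' il); apply: evals_tab => //; [exact: h_n st'|exact: slot_lt|exact: le5].
  have tP s' e (i : nat) : tables s0 s' -> evals s' e i%:Z -> (i <= n)%N -> evals s' (tPP d e) (cPP i).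
    move=> st' he il; rewrite -(h_PP st' il); apply: evals_tab => //; [exact: h_n st'|exact: slot_lt|exact: le5].
  have vb s' : reg s' 20 = b%:Z -> evals s' (Var 20) b%:Z by [].
  have vb1 s' : reg s' 20 = b%:Z -> evals s' (inc (Var 20)) b.+1%:Z by move=> h; apply: evals_inc; [exact: vb|exact: ltnW].
  have va s' : reg s' 19 = a%:Z -> evals s' (Var 19) a%:Z by [].
  have va1 s' : reg s' 19 = a%:Z -> evals s' (inc (Var 19)) a.+1%:Z by move=> h; apply: evals_inc; [exact: va|exact: ltnW].
  have vn s' : tables s0 s' -> evals s' (Var 0) n%:Z by move=> st'; apply: evals_var; exact: h_n st'.
  pose x := 3 * area_sign * (cPS b - cPS a.+1) + (cPP b - cPP a.+1) + r.
  pose y := 3 * area_sign * (cPS n - cPS b.+1 + cPS a) + (cPP n - cPP b.+1 + cPP a) + r.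
  have n1 : 1 <= n%:Z by clear -n0; lia.
  have bx : `|cPS b - cPS a.+1| <= 3 * (n%:Z * n%:Z) by clear -cp2; lia.
  have bxp : `|cPP b - cPP a.+1| <= 2 * n%:Z by clear -cp3; lia.
  apply: ok_Sq; apply: (@ok_Asg_evals _ _ x).
    apply: evals_factor => //; first exact: h_g st4.
    + apply: evals_minus; [exact: tS st4 (vb s4 r20) (ltnW bn)|exact: tS st4 (va1 s4 r19) an|].
      by clear -cp2 nB; lia.
    + apply: evals_minus; [exact: tP st4 (vb s4 r20) (ltnW bn)|exact: tP st4 (va1 s4 r19) an|].
      by clear -cp3 HB; lia.
  set s5 := set_reg s4 _ _; have st5 : tables s0 s5 by apply: tables_reg.
  apply: ok_Sq; apply: (@ok_Asg_evals _ _ y).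
    apply: evals_factor => //; first exact: h_g st5.
    + apply: evals_plus; [|exact: tS st5 (va s5 r19) (ltnW an)|by clear -cp4 nB; lia].
      apply: evals_minus; [exact: tS st5 (vn s5 st5) (leqnn n)|exact: tS st5 (vb1 s5 r20) bn|].
      by clear -cp6 nB; lia.
    + apply: evals_plus; [|exact: tP st5 (va s5 r19) (ltnW an)|by clear -cp5 HB; lia].
      apply: evals_minus; [exact: tP st5 (vn s5 st5) (leqnn n)|exact: tP st5 (vb1 s5 r20) bn|].
      by clear -cp7 HB; lia.
  set s6 := set_reg s5 _ _; have st6 : tables s0 s6 by apply: tables_reg.
  have [_ _ _ fx] := factor_bnd n1 area_signP bx bxp cp1.
  have [_ _ _ fy] := factor_bnd n1 area_signP cp4 cp5 cp1.
  have [p1 p2] := prod_bnd n1 cp1 fx fy.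
  have n5 : n%:Z * n%:Z * n%:Z <= n%:Z ^+ 5.
    rewrite (_ : _ ^+ 5 = (n%:Z * n%:Z * n%:Z) * (n%:Z * n%:Z)); last by rewrite !exprS expr0; clear; lia.
    apply: ler_peMr; clear -n1; [rewrite !mulr_ge0|]; lia.
  rewrite -/x -/y in p1 p2; move: p1 p2 n5 AB.
  set u := (r + 1) * x; set N5 := n%:Z ^+ 5; set N3 := n%:Z * n%:Z * n%:Z => p1 p2 n5 AB.
  have A0 : 0 <= A by apply: le_trans hA.
  apply: ok_Sq; apply: (@ok_Asg_evals _ _ (reg s 11 + pair_term j k)).
    rewrite comE -/x -/y -/u; apply: evals_plus; first exact: evals_var.
      apply: evals_times; [|exact: evals_var|clear -p2 AB A0; lia].
      apply: evals_times; [|exact: evals_var|rewrite -/u; clear -p1 n5 AB A0; lia].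
      apply: evals_plus; [exact: evals_var|exact: evals_cst|clear -cp1 HB; lia].
    clear -p2 AB hA; lia.
  set s7 := set_reg s6 _ _; have st7 : tables s0 s7 by apply: tables_reg.
  apply: (@ok_Put_eq B L n HB (sl 2) (Var 17) (Cst 0) R 0 s7) => //.
  - exact: h_n st7.
  - exact: slot_lt.
  - split=> //; first exact: tables_put.
    + by move=> q; rewrite tab_set ?slot_lt // eqxx andTb -T4.
    + by split=> // q; rewrite tab_set_other ?slot_lt // -?T1 // => /addnI.
apply: ok_Sq; apply: ok_If; [by []|by []| |].
- move=> /= h; rewrite rK in h; apply: ok_Sq; apply: (@ok_Asg_evals _ _ j%:Z); first exact: evals_var.
  set s4 := set_reg s3 _ _; apply: (@ok_Asg_evals _ _ k%:Z); first exact: evals_var.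
  have kj : (k <= j)%N by clear -h; lia.
  by apply: rest => //=; [do 2?apply: tables_reg => //| |]; congr Posz; clear -kj; lia.
- move=> /= h; rewrite rK in h; apply: (@ok_Asg_evals _ _ 0); first exact: evals_cst.
  have kj : (j <= k)%N by clear -h; lia.
  by apply: rest => //=; [apply: tables_reg => //| |]; congr Posz; clear -kj; lia.
Qed.

End Sweeping.

Section Order.
Variables (n : nat) (sv : nat -> int) (ty : nat -> nat) (d d1 : nat).
Notation cB := (cB sv ty d d1).
Notation bucket := (bucket n sv ty d d1).

(** The order in which the sweep takes the steps at positions below [P]. *)
Definition order P := flatten [seq bucket n p | p <- iota 0 P].

Lemma orderS P : order P.+1 = order P ++ bucket n P.
Proof. by rewrite /order -addn1 iotaD map_cat flatten_cat /= cats0. Qed.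

Lemma mem_order P k : (k \in order P) = [&& (k < n)%N, ty k == d & 0 <= cB k + n%:Z < P%:Z].
Proof.
elim: P => [|P IH]; first by rewrite /order /=; rewrite in_nil; clear; lia.
rewrite orderS mem_cat IH mem_bucket; clear; lia.
Qed.

Lemma uniq_order P : uniq (order P).
Proof.
elim: P => // P IH; rewrite orderS cat_uniq IH uniq_bucket andbT /=.
apply/hasPn => k; rewrite mem_bucket mem_order => /and3P[_ _ /eqP->].
by clear; lia.
Qed.

End Order.

(** * Correctness of the sweep *)

Section SweepLoop.
Variables (n : nat) (sv : nat -> int) (ty : nat -> nat).
Hypothesis sv1 : forall k, sv k = 1 \/ sv k = -1.
Variables d d1 : nat.
Notation sl j := (8 * d + j)%N.
Hypothesis d3 : (d < 3)%N.
Variables (B L : nat).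
Hypothesis HB : (2000 * n + 2000 <= B)%N.
Hypothesis HB2 : (100 * n * n <= B)%N.
Hypothesis HL : (3 * n + 1 <= L)%N.
Hypothesis n0 : (0 < n)%N.

Notation cB := (cB sv ty d d1).
Notation cC := (cC sv ty d d1).
Notation tables := (tables n sv ty d d1).
Notation order := (order n sv ty d d1).
Notation bucket := (bucket n sv ty d d1).
Notation pair_term := (pair_term n sv ty d d1).
Notation row k := (cB k + cC k).

Variables (left_in : nat -> bool) (X : nat -> int).
Hypothesis H_uniq : forall i j, (i < n)%N -> (j < n)%N -> ty i == d -> ty j == d -> row i = row j -> cB i = cB j -> i = j.
Hypothesis H_first : forall k, (k < n)%N -> ty k == d -> left_in k ->
  exists k', [/\ (k' < n)%N, ty k' == d, row k' = row k & cB k' < cB k].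
Hypothesis H_alt : forall k k', (k < n)%N -> (k' < n)%N -> ty k == d -> ty k' == d -> row k = row k' -> cB k < cB k' ->
  (forall l, (l < n)%N -> ty l == d -> row l = row k -> cB k < cB l -> cB l < cB k' -> False) ->
  left_in k' = ~~ left_in k.
Hypothesis HX : forall j k, (j < n)%N -> (k < n)%N -> ty j == d -> ty k == d -> row j = row k -> cB j < cB k ->
  (forall l, (l < n)%N -> ty l == d -> row l = row j -> cB j < cB l -> cB l < cB k -> False) ->
  ~~ left_in j -> left_in k -> X k = pair_term j k.

Notation lastspec := (lastspec (fun k => row k) cB left_in (2 * n%:Z)).

(** [pl] are the steps already taken and [cl] is the rest of the current list, that of position
    [P - 1]. Every round either increments [P] or moves a step from [cl] to [pl], so [P + size pl]
    counts the rounds. The accumulator is bounded by charging one term to every round. *)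
Record sweeping (s0 acc A : int) (i : nat) (s : state) (pl cl : seq nat) (P : nat) : Prop := Sweeping {
  w_st : tables s0 s;
  w_P : reg s 13 = P%:Z;
  w_cl : linked (tab n s (sl 1)) (reg s 14) cl;
  w_or : order P = pl ++ cl;
  w_i : i = (P + size pl)%N;
  w_clP : forall k, k \in cl -> cB k + n%:Z + 1 = P%:Z;
  w_last : lastspec (tab n s (sl 2)) pl;
  w_acc : reg s 11 = acc + \sum_(k <- pl | left_in k) X k;
  w_bnd : `|reg s 11| <= A + i%:Z * (600 * n%:Z ^+ 5)
}.

Lemma pair_term_bnd j k : (j < n)%N -> (k < n)%N -> cB j < cB k -> `|pair_term j k| <= 600 * n%:Z ^+ 5.
Proof.
move=> jn kn lt; have [[cp1 cp2 cp3 cp4 cp5] _] := pair_term_parts sv1 n0 jn kn lt.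
have n1 : 1 <= n%:Z by clear -n0; lia.
have bx : `|cPS sv ty d d1 (maxn j k) - cPS sv ty d d1 (minn j k).+1| <= 3 * (n%:Z * n%:Z) by clear -cp2; lia.
have bxp : `|cPP sv (maxn j k) - cPP sv (minn j k).+1| <= 2 * n%:Z by clear -cp3; lia.
have [_ _ _ fx] := factor_bnd n1 (@area_signP n sv ty d d1) bx bxp cp1.
have [_ _ _ fy] := factor_bnd n1 (@area_signP n sv ty d d1) cp4 cp5 cp1.
by have [_] := prod_bnd n1 cp1 fx fy.
Qed.

Lemma sweep_body_ok s0 acc A i s pl cl P : (i < 3 * n + 1)%N -> A + (3 * n%:Z + 1) * (600 * n%:Z ^+ 5) <= B%:Z -> 0 <= A ->
  sweeping s0 acc A i s pl cl P ->
  ok B L (sweep_body d) s (fun s' => exists pl' cl' P', sweeping s0 acc A i.+1 (set_reg s' 5 i.+1%:Z) pl' cl' P').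
Proof.
move=> i3 AB A0 [st rP lk oE iE clP ls ra rb].
have n5 : 0 <= n%:Z ^+ 5 by apply: exprn_ge0.
have P5 : (P <= 5 * n + 5)%N by clear -i3 iE; lia.
rewrite /sweep_body; case: cl lk oE clP => [|k cl] /= lk oE clP.
  apply: ok_If; [by []|by []| |by move=> /=; rewrite lk ltxx].
  move=> _; apply: ok_Sq; apply: (@ok_Asg_evals _ _ _ _ (tab n s (sl 0) P)).
    by apply: (evals_tab HB) => //; [exact: h_n st|exact: slot_lt].
  apply: (@ok_Asg_evals _ _ _ _ P.+1%:Z).
    rewrite (_ : P.+1%:Z = P%:Z + 1); last by clear; lia.
    apply: evals_plus; [exact: evals_var|exact: (evals_cst HB)|].
    by clear -P5 HB; lia.
  exists pl, (bucket n P), P.+1; split=> //.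
  - by do 3?apply: tables_reg => //.
  - exact: (h_head st).
  - by rewrite orderS oE cats0.
  - by rewrite iE.
  - by move=> k; rewrite mem_bucket => /and3P[_ _ /eqP->]; rewrite -addn1 PoszD.
  - by apply: le_trans rb _; rewrite -[i.+1]addn1 PoszD mulrDl; move: n5; set N5 := n%:Z ^+ 5; clear; lia.
have kor : k \in order P by rewrite oE mem_cat mem_head orbT.
have := kor; rewrite mem_order => /and3P[kn kd kP].
have [lk1 lk2] := lk.
have bc := cBC_bnd ty sv1 d d1 k.
have kclP : cB k + n%:Z + 1 = P%:Z by apply: clP; rewrite mem_head.
have un : uniq (pl ++ k :: cl) by rewrite -oE uniq_order.
have kd' : ty k = d by apply/eqP.
pose R := `|(row k + 2 * n%:Z)%R|%N.
have RE : row k + 2 * n%:Z = R%:Z by rewrite /R; clear -bc kn; lia.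
have R5 : (R <= 5 * n + 5)%N by clear -RE bc kn; lia.
have PL1 k' : k' \in pl -> [/\ (k' < n)%N, ty k' == d, cB k' <= cB k & k' <> k].
  move=> kp; have : k' \in order P by rewrite oE mem_cat kp.
  rewrite mem_order => /and3P[a b c]; split=> //; first by clear -c kclP; lia.
  move=> e; move: un; rewrite cat_uniq => /and3P[_ /hasPn/(_ k) H _]; apply/negP: kp.
  by rewrite e; apply: H; rewrite mem_head.
have PL2 k' : (k' < n)%N -> ty k' == d -> cB k' < cB k -> k' \in pl.
  move=> k'n k'd lt; have : k' \in order P.
    rewrite mem_order k'n k'd /=; have := cBC_bnd ty sv1 d d1 k'; clear -lt kclP k'n; lia.
  rewrite oE mem_cat => /orP[//|/clP]; clear -lt kclP; lia.
apply: ok_If; [by []|by []|by move=> /=; rewrite lk1|move=> _].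
apply: ok_Sq; apply: (@ok_Asg_evals _ _ _ _ k%:Z).
  rewrite (_ : k%:Z = k.+1%:Z - 1); last by clear; lia.
  by apply: evals_minus; [exact: evals_var|exact: (evals_cst HB)|clear -kn HB; lia].
set s1 := set_reg s _ _; have st1 : tables s0 s1 by apply: tables_reg.
have k5 : (k <= 5 * n + 5)%N by clear -kn; lia.
apply: ok_Sq; apply: (@ok_Asg_evals _ _ _ _ R%:Z).
  rewrite -RE -(h_row st1 kn kd') mulrC mulr_natr mulr2n; apply: evals_plus.
  - by apply: (evals_tab HB) => //; [exact: h_n st1|exact: slot_lt].
  - apply: evals_plus; [exact: evals_var (h_n st1)|exact: evals_var (h_n st1)|clear -HB; lia].
  - by rewrite (h_row st1 kn kd'); clear -RE R5 HB; lia.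
set s2 := set_reg s1 _ _; have st2 : tables s0 s2 by apply: tables_reg.
apply: ok_Sq; apply: (@ok_Asg_evals _ _ _ _ (tab n s (sl 2) R)).
  by apply: (evals_tab HB) => //; [exact: h_n st2|exact: slot_lt].
set s3 := set_reg s2 _ _; have st3 : tables s0 s3 by apply: tables_reg.
(* The common end of both branches: [v] is the new entry of the row in the table and [x] is what was
   added to the accumulator. *)
have rest s4 v x : tables s0 s4 -> reg s4 16 = k%:Z -> reg s4 13 = P%:Z ->
    (forall q, tab n s4 (sl 2) q = if q == R then v else tab n s (sl 2) q) ->
    (if left_in k then v = 0 else v = k.+1%:Z) -> (reg s4 11 = reg s 11 + x) -> x = (if left_in k then X k else 0) ->
    (forall q, tab n s4 (sl 1) q = tab n s (sl 1) q) ->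
    `|x| <= 600 * n%:Z ^+ 5 ->
    ok B L (Asg 14 (tabE (sl 1) (Var 16))) s4
      (fun s' => exists pl' cl' P', sweeping s0 acc A i.+1 (set_reg s' 5 i.+1%:Z) pl' cl' P').
  move=> st4 r16 r13 T2 hv r11 hx T1 bx.
  apply: (@ok_Asg_evals _ _ _ _ (tab n s (sl 1) k)).
    by rewrite -T1; apply: (evals_tab HB) => //; [exact: h_n st4|exact: slot_lt].
  exists (rcons pl k), cl, P; split.
  - by do 2?apply: tables_reg => //.
  - exact: r13.
  - by apply: linked_eq lk2 => q _; rewrite -T1.
  - by rewrite oE -cats1 -catA.
  - by rewrite iE size_rcons addnS.
  - by move=> k' k'c; apply: clP; rewrite inE k'c orbT.
  - have := lastspec_step H_uniq kn kd ls PL1 RE hv.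
    by move=> + q => /(_ q); cbv beta; rewrite -T2.
  - have -> : reg (set_reg (set_reg s4 14 (tab n s (sl 1) k)) 5 i.+1%:Z) 11 = reg s4 11 by [].
    rewrite r11 ra hx -cats1 big_cat [in RHS]addrA; congr (_ + _); by rewrite big_mkcond big_seq1.
  - have -> : reg (set_reg (set_reg s4 14 (tab n s (sl 1) k)) 5 i.+1%:Z) 11 = reg s4 11 by [].
    rewrite r11; apply: le_trans (ler_normD _ _) _; rewrite -[i.+1]addn1 PoszD mulrDl mul1r addrA.
    exact: lerD.
apply: ok_Sq; apply: ok_If; [by []|by []|move=> /= h|move=> /= h].
  have T0 : tab n s (sl 2) R = 0.
    by case: (ls R) => [[]//|[j [_ Tj _ _ _]]]; move: h; rewrite Tj.
  have iLk := lastspec_zero H_uniq H_first H_alt kn kd ls PL1 PL2 RE T0.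
  apply: (@ok_Put_eq B L n HB (sl 2) (Var 17) (inc (Var 16)) R k.+1%:Z s3 _ (h_n st3) (slot_lt (d := d) d3 (j := 2) isT) I _ R5); first by [].
  - by apply: (proj1 (evals_inc HB _ (ltnW kn))).
  - by rewrite /= -addn1 PoszD.
  apply: (rest _ k.+1%:Z 0).
  - exact: tables_put.
  - by [].
  - by [].
  - by move=> q; rewrite tab_set ?slot_lt // eqxx.
  - by rewrite (negPf iLk).
  - by rewrite addr0.
  - by rewrite (negPf iLk).
  - by move=> q; rewrite tab_set_other ?slot_lt // => /addnI.
  - by rewrite normr0; clear -n5; lia.
have T0 : tab n s (sl 2) R <> 0 by move=> e; move: h; rewrite e.
have [j [[Tj jn jd jr lt] [iLk [iLj bt]]]] := lastspec_pos H_uniq H_alt kn kd ls PL1 PL2 RE T0.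
have jd' : ty j = d by apply/eqP.
apply: (ok_imp (pair_body_ok sv1 d3 L HB HB2 n0 st3 erefl _ erefl R5 jn kn jd' kd' lt rb _)) => //.
  move: AB; move: i3 n5; set N5 := n%:Z ^+ 5; clear; nia.
move=> s4 [st4 r11 T2 r16 [r13 T1]].
apply: (rest s4 0 (pair_term j k)) => //.
- by rewrite r13.
- by rewrite iLk.
- by rewrite iLk; symmetry; apply: HX.
- exact: pair_term_bnd.
Qed.

(** At most [n] of the [3 * n + 1] rounds take a step, so [P] ends above [2 * n], beyond all
    positions; then the current list is empty and every step has been taken. *)
Lemma sweep_end s0 acc A s pl cl P : sweeping s0 acc A (3 * n + 1)%N s pl cl P ->
  \sum_(k <- pl | left_in k) X k = \sum_(0 <= k < n | (ty k == d) && left_in k) X k.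
Proof.
move=> [_ _ _ oE iE clP _ _ _].
have un : uniq (pl ++ cl) by rewrite -oE uniq_order.
have mo k : k \in pl ++ cl -> (k < n)%N by rewrite -oE mem_order => /and3P[].
have sz : (size (pl ++ cl) <= n)%N.
  by rewrite -[X in (_ <= X)%N](size_iota 0); apply: uniq_leq_size => // k /mo; rewrite mem_iota.
have cl0 : cl = [::].
  case: cl oE clP un mo sz {iE} (iE) => // k cl oE clP un mo sz iE.
  have kn : (k < n)%N by apply: mo; rewrite mem_cat mem_head orbT.
  have := clP k (mem_head _ _); have := cBC_bnd ty sv1 d d1 k.
  by move: sz iE; rewrite size_cat /=; clear -kn; lia.
rewrite cl0 cats0 in un oE sz.
rewrite -big_filter -[RHS]big_filter; apply: perm_big; apply: uniq_perm.
- exact: filter_uniq.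
- by apply: filter_uniq; rewrite iota_uniq.
move=> k; rewrite !mem_filter -oE mem_order mem_iota subn0 add0n leq0n /=.
have := cBC_bnd ty sv1 d d1 k; move: iE sz; clear.
by case: (left_in k); case: (ty k == d) => /=; lia.
Qed.

Lemma sweep_ok s0 acc A s : tables s0 s -> (forall r, tab n s (sl 2) r = 0) -> reg s 11 = acc -> 0 <= A -> `|acc| <= A ->
  A + (3 * n%:Z + 1) * (600 * n%:Z ^+ 5) <= B%:Z ->
  ok B L (sweep d) s (fun s' =>
    ready n sv ty d.+1 s0 (acc + \sum_(0 <= k < n | (ty k == d) && left_in k) X k) s' /\
    `|acc + \sum_(0 <= k < n | (ty k == d) && left_in k) X k| <= A + (3 * n%:Z + 1) * (600 * n%:Z ^+ 5)).
Proof.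
move=> st T0 ra A0 aA AB.
rewrite /sweep; apply: ok_Sq; apply: (@ok_Asg_evals _ _ _ _ 0); first exact: (evals_cst HB).
apply: ok_Sq; apply: (@ok_Asg_evals _ _ _ _ 0); first exact: (evals_cst HB).
apply: ok_Sq; apply: (@ok_Asg_evals _ _ _ _ (3 * n%:Z)).
  by apply: evals_times; [exact: (evals_cst HB)|exact: evals_var (h_n st)|clear -HB; lia].
set s1 := set_reg _ 6 _.
apply: (@ok_For _ _ _ _ _ _ (fun i s => exists pl cl P, sweeping s0 acc A i s pl cl P) (3 * n + 1)) => //.
- by clear -HB; lia.
- by clear -HB; lia.
- exists [::], [::], 0%N; split=> //.
  + by do 4?apply: tables_reg => //.
  + by move=> r; left; split=> //; exact: T0.
  + by rewrite big_nil addr0 -ra.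
  + by rewrite mul0r addr0 -ra in aA *.
- move=> i s' i3 [pl [cl [P sw]]] _ _; exact: sweep_body_ok sw.
move=> s' [pl [cl [P sw]]]; have E := sweep_end sw.
have [st' _ _ _ _ _ _ ra' rb'] := sw.
rewrite E in ra'; rewrite ra' PoszD PoszM in rb'; split=> //.
case: st' => h1 h2 _ h4 h5 _ _ _ _ _ h11; split=> // slot i; rewrite mulnS addnC; exact: h11.
Qed.

End SweepLoop.

(** * Finding the directions and signs of the steps *)

Section Prelude.
Variables (n : nat) (sv : nat -> int) (ty : nat -> nat) (xs ys : nat -> int).
Hypothesis sv1 : forall k, sv k = 1 \/ sv k = -1.
Variables (B L : nat).
Hypothesis HB : (2000 * n + 2000 <= B)%N.
Hypothesis HL : (3 * n + 1 <= L)%N.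
Hypothesis n0 : (0 < n)%N.
Hypothesis svS : forall k, sv k.+1 = - sv k.
Hypothesis steps : forall k, (k < n)%N ->
  [\/ [/\ ty k = 0%N, xs k.+1 - xs k = 0 & ys k.+1 - ys k = sv k],
      [/\ ty k = 1%N, xs k.+1 - xs k = sv k & ys k.+1 - ys k = 0] |
      [/\ ty k = 2%N, xs k.+1 - xs k = - sv k & ys k.+1 - ys k = 0]].
Hypothesis vert : exists2 k, (k < n)%N & ty k = 0%N.

Definition cells s := forall k, (k <= n)%N -> cell s (2 * k) = xs k /\ cell s (2 * k + 1) = ys k.

Lemma stepXY_ok k s (Q : state -> Prop) : (k < n)%N -> cells s -> reg s 5 = k%:Z ->
  Q (set_reg (set_reg s 7 (xs k.+1 - xs k)) 8 (ys k.+1 - ys k)) -> ok B L stepXY s Q.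
Proof.
move=> kn cs r5 HQ; have [x0 y0] := cs k (ltnW kn); have [x1 y1] := cs _ kn.
have b1 : `|xs k.+1 - xs k| <= 1 /\ `|ys k.+1 - ys k| <= 1.
  by case: (steps kn) => -[_ -> ->]; case: (sv1 k) => ->.
have i0 s' : reg s' 5 = k%:Z -> evals B s' (Var 5) k%:Z by [].
have i1 s' : reg s' 5 = k%:Z -> evals B s' (Plus (Var 5) (Cst 1)) k.+1%:Z.
  by move=> h; apply: (evals_inc HB); [exact: i0|exact: ltnW].
have tw s' e (i : nat) : evals B s' e i%:Z -> (i <= n)%N -> evals B s' (Times (Cst 2) e) (2 * i)%N%:Z.
  by move=> h il; rewrite PoszM; apply: evals_times => //; [exact: (evals_cst HB)|clear -il HB; lia].
have tw1 s' e (i : nat) : evals B s' e i%:Z -> (i <= n)%N -> evals B s' (Plus (Times (Cst 2) e) (Cst 1)) (2 * i + 1)%N%:Z.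
  by move=> h il; rewrite PoszD; apply: evals_plus => //; [exact: tw|exact: (evals_cst HB)|clear -il HB; lia].
have gt s' e (i : nat) : evals B s' e i%:Z -> evals B s' (Get e) (cell s' i).
  by case=> h1 h2; split; rewrite /= h2.
apply: ok_Sq; apply: (@ok_Asg_evals _ _ _ _ (xs k.+1 - xs k)).
  rewrite -x0 -x1; apply: evals_minus.
  - by apply: gt; apply: tw => //; exact: i1.
  - by apply: gt; apply: tw; [exact: i0|exact: ltnW].
  - by rewrite x0 x1; case: b1; clear -HB; lia.
apply: (@ok_Asg_evals _ _ _ _ (ys k.+1 - ys k)) => //.
rewrite -y0 -y1; set s1 := set_reg s _ _.
have -> : cell s = cell s1 by [].
apply: evals_minus.
- by apply: gt; apply: tw1 => //; exact: i1.
- by apply: gt; apply: tw1; [exact: i0|exact: ltnW].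
- by rewrite -[cell s1]/(cell s) y0 y1; case: b1; clear -HB; lia.
Qed.

Lemma tab_zero s : (forall a, (2 * n + 2 <= a)%N -> cell s a = 0) -> forall slot i, tab n s slot i = 0.
Proof. by move=> h slot i; apply: h; rewrite /cadr; clear; lia. Qed.

Lemma cells_put s slot i v : cells s -> cells (set_tab n s slot i v).
Proof.
move=> cs k kn; have [x0 y0] := cs k kn; rewrite /set_tab !cell_set -x0 -y0 /cadr.
by split; case: eqP => //; clear -kn; lia.
Qed.

Lemma prelude_ok s : reg s 0 = n%:Z -> (forall r, r <> 0%N -> reg s r = 0) ->
  (forall k, (k < n)%N -> cell s (2 * k) = xs k /\ cell s (2 * k + 1) = ys k) ->
  xs n = xs 0 -> ys n = ys 0 -> (forall a, (2 * n <= a)%N -> cell s a = 0) ->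
  ok B L prelude s (fun s' => ready n sv ty 0 (sv 0) 0 s').
Proof.
move=> rn r0 cs xn yn cz.
have n2 : evals B s (Times (Cst 2) (Var 0)) (2 * n)%N%:Z.
  by rewrite PoszM; apply: evals_times; [exact: (evals_cst HB)|exact: evals_var|clear -HB; lia].
have [x0 y0] := cs 0%N n0.
rewrite /prelude; apply: ok_Sq; split; first by split; [exact: n2.1|split|rewrite n2.2].
rewrite [run _ _]/= rn absz_nat x0.
rewrite (_ : (2 * n)%N = (2 * n)%N) //.
set s1 := set_cell s _ _.
have n21 : evals B s1 (Plus (Times (Cst 2) (Var 0)) (Cst 1)) (2 * n + 1)%N%:Z.
  rewrite PoszD; apply: evals_plus; [|exact: (evals_cst HB)|clear -HB; lia].
  by rewrite PoszM; apply: evals_times; [exact: (evals_cst HB)|exact: evals_var|clear -HB; lia].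
have y01 : cell s1 1 = ys 0 by rewrite /s1 cell_set; case: eqP => [|//]; clear -n0; lia.
apply: ok_Sq; split; first by split; [exact: n21.1|by split=> //=; clear -HB; lia|rewrite n21.2].
have -> : run (Put (Plus (Times (Cst 2) (Var 0)) (Cst 1)) (Get (Cst 1))) s1 = set_cell s1 (2 * n + 1) (ys 0).
  by rewrite [run _ _]/= -[2 * _ + 1]/(eval s1 (Plus (Times (Cst 2) (Var 0)) (Cst 1))) n21.2 absz_nat -y01.
set s2 := set_cell s1 _ _.
have c2 : cells s2.
  move=> k; rewrite /s2 /s1 !cell_set leq_eqVlt => /orP[/eqP->|kn].
    by rewrite !eqxx xn yn; split=> //; case: eqP => //; clear; lia.
  have [<- <-] := cs k kn; split; do 2?[case: eqP => //; first by clear -kn; lia].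
have z2 : forall a, (2 * n + 2 <= a)%N -> cell s2 a = 0.
  by move=> a ha; rewrite /s2 /s1 !cell_set; do 2?[case: eqP; first by clear -ha; lia]; move=> _ _; apply: cz; clear -ha; lia.
have rs2 r : reg s2 r = reg s r by [].
clearbody s2; clear s1 n21 y01.
apply: ok_Sq; apply: (@ok_Asg_evals _ _ _ _ (n%:Z - 1)).
  by apply: evals_minus; [by apply: evals_var; rewrite rs2|exact: (evals_cst HB)|clear -HB n0; lia].
apply: ok_Sq; apply: (@ok_Asg_evals _ _ _ _ 1); first exact: (evals_cst HB).
set s3 := set_reg _ 2 _.
have svsq k : sv k * sv k = 1 by case: (sv1 k) => ->.
have sq_ok s' r x : reg s' r = x -> `|x| <= 1 -> evals B s' (sq (Var r)) (x * x).
  move=> h hx; apply: evals_times; [exact: evals_var|exact: evals_var|].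
  by have : x = 0 \/ x = 1 \/ x = -1 by [clear -hx; lia]; case=> [|[]] ->; clear -HB; lia.
have flip_ok s' x (Q : state -> Prop) : reg s' 2 = x -> `|x| <= 1 -> Q (set_reg s' 2 (- x)) -> ok B L flip s' Q.
  move=> h hx HQ; apply: (@ok_Asg_evals _ _ _ _ (- x)) => //; rewrite -[- x]add0r.
  by apply: evals_minus; [exact: (evals_cst HB)|exact: evals_var|clear -hx HB; lia].
(* Register [rS] starts with 1 and alternates, so it contains [sv 0 * sv k]. On a vertical step [rY]
   is [sv k], and the product of the two is [sv 0]. *)
apply: ok_Sq; apply: (@ok_For _ _ _ _ _ _ (fun k s' => [/\ cells s', (forall a, (2 * n + 2 <= a)%N -> cell s' a = 0),
    reg s' 0 = n%:Z, reg s' 2 = sv 0 * sv k & reg s' 6 + 1 = n%:Z /\ reg s' 11 = 0] /\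
    forall j, (j < k)%N -> ty j = 0%N -> reg s' 1 = sv 0) n) => //.
- by rewrite /= subrK.
- by clear -HL; lia.
- by clear -HB; lia.
- by clear -HB; lia.
- split; last by [].
  split; [exact: c2|exact: z2|by rewrite -rn -rs2|by rewrite svsq|].
  by split; [rewrite -[LHS]/(n%:Z - 1 + 1) subrK|rewrite -(r0 11%N) // -rs2].
- move=> k s' kn [[c' z' n' S' [M' A']] v'] r5 _.
  apply: ok_Sq; apply: (stepXY_ok kn) => //.
  set s4 := set_reg _ 8 _.
  have S4 : reg s4 2 = sv 0 * sv k by [].
  have fin s5 : cells s5 -> (forall a, (2 * n + 2 <= a)%N -> cell s5 a = 0) -> reg s5 0 = n%:Z -> 
     reg s5 2 = sv 0 * sv k -> reg s5 6 + 1 = n%:Z -> reg s5 11 = 0 ->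
     (forall j, (j < k.+1)%N -> ty j = 0%N -> reg s5 1 = sv 0) ->
     ok B L flip s5 (fun s' => [/\ cells (set_reg s' 5 k.+1%:Z), (forall a, (2 * n + 2 <= a)%N -> cell s' a = 0),
    reg s' 0 = n%:Z, reg s' 2 = sv 0 * sv k.+1 & reg s' 6 + 1 = n%:Z /\ reg s' 11 = 0] /\
    forall j, (j < k.+1)%N -> ty j = 0%N -> reg s' 1 = sv 0).
    move=> c5 z5 n5 S5 M5 A5 v5; apply: (flip_ok _ (sv 0 * sv k)) => //.
      by case: (sv1 0) => ->; case: (sv1 k) => ->.
    by split=> //; split=> //=; rewrite svS mulrN.
  have y1 : `|ys k.+1 - ys k| <= 1 by case: (steps kn) => -[_ _ ->] //; case: (sv1 k) => ->.
  have [q1 q2] := sq_ok s4 8%N (ys k.+1 - ys k) erefl y1.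
  apply: ok_Sq; apply: ok_If => //; first exact: (evals_cst HB _ _).1.
    move=> h; have [[tk _ yk]|[tk _ yk]|[tk _ yk]] := steps kn; rewrite q2 yk // in h.
    apply: (@ok_Asg_evals _ _ _ _ (sv 0)); last by apply: fin.
    have -> : sv 0 = (ys k.+1 - ys k) * (sv 0 * sv k) by rewrite yk mulrCA svsq mulr1.
    apply: evals_times; [exact: evals_var|exact: evals_var|].
    by rewrite yk mulrCA svsq mulr1; case: (sv1 0) => ->; clear -HB; lia.
  move=> h; apply: (@ok_Asg_evals _ _ _ _ 0); first exact: (evals_cst HB).
  apply: fin => // j; rewrite ltnS leq_eqVlt => /orP[/eqP->|]; last exact: v'.
  have [[tk _ yk]|[tk _ yk]|[tk _ yk]] := steps kn; rewrite tk //.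
  by move: h; rewrite q2 yk svsq.
move=> s4 [[c4 z4 n4 S4 [M4 A4]] v4]; have [k0 k0n tk0] := vert.
have {v4} S04 := v4 _ k0n tk0.
apply: ok_Sq; apply: (@ok_Asg_evals _ _ _ _ (sv 0)); first exact: evals_var.
apply: (@ok_For _ _ _ _ _ _ (fun k s' => [/\ cells s', (forall slot i, (slot < 24)%N -> tab n s' slot i = 0),
    reg s' 0 = n%:Z, reg s' 2 = sv k & reg s' 1 = sv 0 /\ reg s' 11 = 0] /\
    (forall i, (i < k)%N -> tab n s' 60 i = (ty i)%:Z) /\ (forall i, (i < k)%N -> tab n s' 61 i = sv i)) n) => //.
- by clear -HL; lia.
- by clear -HB; lia.
- by clear -HB; lia.
- by split=> //; split=> // slot i _; exact: tab_zero.
- move=> k s' kn [[c' z' n' S' [S0' A']] [t' g']] r5 _.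
  apply: ok_Sq; apply: (stepXY_ok kn) => //.
  set s5 := set_reg _ 8 _.
  have k5 : (k <= 5 * n + 5)%N by clear -kn; lia.
  apply: ok_Sq; apply: (@ok_Put_eq B L n HB 61 (Var 5) (Var 2) k (sv k) s5) => //.
  set s6 := set_tab _ _ _ _ _.
  have put s7 t (Q : state -> Prop) : s7 = s6 -> (`|t| <= 3)%N -> (forall s8, s8 = set_tab n s6 60 k t -> Q s8) ->
     ok B L (PutT 60 (Var 5) (Cst t)) s7 Q.
    move=> -> t3 HQ; apply: (@ok_Put_eq B L n HB 60 (Var 5) (Cst t) k t s6) => //; last exact: HQ.
    by apply: (evals_cst HB _ _).1; clear -t3; lia.
  have fin s8 : s8 = set_tab n s6 60 k (ty k)%:Z -> ok B L flip s8 (fun s'' =>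
     [/\ cells (set_reg s'' 5 k.+1%:Z), (forall slot i, (slot < 24)%N -> tab n (set_reg s'' 5 k.+1%:Z) slot i = 0),
      reg s'' 0 = n%:Z, reg s'' 2 = sv k.+1 & reg s'' 1 = sv 0 /\ reg s'' 11 = 0] /\
    (forall i, (i < k.+1)%N -> tab n s'' 60 i = (ty i)%:Z) /\ (forall i, (i < k.+1)%N -> tab n s'' 61 i = sv i)).
    move=> ->; apply: (flip_ok _ (sv k)) => //; first by case: (sv1 k) => ->.
    have T8 slot i : (slot < 64)%N -> tab n (set_tab n s6 60 k (ty k)%:Z) slot i =
       if (slot == 60%N) && (i == k) then (ty k)%:Z else if (slot == 61%N) && (i == k) then sv k else tab n s' slot i.
      by move=> h; rewrite !tab_set.
    split; first split=> //.
    + by apply: cells_put; apply: cells_put.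
    + move=> slot i h; rewrite tab_reg tab_reg T8; last by clear -h; lia.
      have [-> ->] : (slot == 60%N) = false /\ (slot == 61%N) = false by clear -h; split; lia.
      exact: z'.
    + split=> i; rewrite ltnS leq_eqVlt tab_reg T8 //=.
        by case: eqP => [->//|_]; exact: t'.
      by case: eqP => [->//|_]; exact: g'.
  have y1 : `|ys k.+1 - ys k| <= 1 by case: (steps kn) => -[_ _ ->] //; case: (sv1 k) => ->.
  have x1 : `|(xs k.+1 - xs k) * sv k| <= 1 by case: (steps kn) => -[_ -> _] //; case: (sv1 k) => ->.
  have [q1 q2] := sq_ok s6 8%N (ys k.+1 - ys k) erefl y1.
  apply: ok_Sq; apply: ok_If => //; first exact: (evals_cst HB _ _).1.
    move=> h; have [[tk _ yk]|[tk _ yk]|[tk _ yk]] := steps kn; rewrite q2 yk // in h.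
    by apply: put => // s8 e; apply: fin; rewrite e tk.
  move=> h; have ex : evals B s6 (Times (Var 7) (Var 2)) ((xs k.+1 - xs k) * sv k).
    by apply: evals_times; [exact: evals_var|exact: evals_var|clear -x1 HB; lia].
  apply: ok_If; [exact: (evals_cst HB _ _).1|exact: ex.1| |]; rewrite ex.2 => h2.
    have [[tk xk yk]|[tk xk yk]|[tk xk yk]] := steps kn.
    - by rewrite xk mul0r in h2.
    - by apply: put => // s8 e; apply: fin; rewrite e tk.
    - by rewrite xk mulNr svsq in h2.
  have [[tk xk yk]|[tk xk yk]|[tk xk yk]] := steps kn.
  - by move: h; rewrite q2 yk svsq.
  - by rewrite xk svsq in h2.
  - by apply: put => // s8 e; apply: fin; rewrite e tk.
move=> s5 [[c5 z5 n5 S5 [S05 A5]] [t5 g5]]; split=> // slot i /andP[_ h]; exact: z5.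
Qed.
End Prelude.

Section Main.
Variables (n : nat) (sv : nat -> int) (ty : nat -> nat).
Hypothesis sv1 : forall k, sv k = 1 \/ sv k = -1.
Hypothesis ty3 : forall k, (ty k < 3)%N.
Variables (B L : nat).
Hypothesis HB : (2000 * n + 2000 <= B)%N.
Hypothesis HB2 : (100 * n * n <= B)%N.
Hypothesis HL : (3 * n + 1 <= L)%N.
Hypothesis n0 : (0 < n)%N.
Variables (left_in : nat -> bool) (X : nat -> int).

(** All that the sweep needs to know about the cycle, so that the program is verified without
    reference to the lattice; [link_paired] provides it. *)
Record paired (d d1 : nat) : Prop := Paired {
  p_uniq : forall i j, (i < n)%N -> (j < n)%N -> ty i == d -> ty j == d ->
    cB sv ty d d1 i + cC sv ty d d1 i = cB sv ty d d1 j + cC sv ty d d1 j -> cB sv ty d d1 i = cB sv ty d d1 j -> i = j;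
  p_first : forall k, (k < n)%N -> ty k == d -> left_in k ->
    exists k', [/\ (k' < n)%N, ty k' == d, cB sv ty d d1 k' + cC sv ty d d1 k' = cB sv ty d d1 k + cC sv ty d d1 k
      & cB sv ty d d1 k' < cB sv ty d d1 k];
  p_alt : forall k k', (k < n)%N -> (k' < n)%N -> ty k == d -> ty k' == d ->
    cB sv ty d d1 k + cC sv ty d d1 k = cB sv ty d d1 k' + cC sv ty d d1 k' -> cB sv ty d d1 k < cB sv ty d d1 k' ->
    (forall l, (l < n)%N -> ty l == d -> cB sv ty d d1 l + cC sv ty d d1 l = cB sv ty d d1 k + cC sv ty d d1 k ->
       cB sv ty d d1 k < cB sv ty d d1 l -> cB sv ty d d1 l < cB sv ty d d1 k' -> False) ->
    left_in k' = ~~ left_in k;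
  p_X : forall j k, (j < n)%N -> (k < n)%N -> ty j == d -> ty k == d ->
    cB sv ty d d1 j + cC sv ty d d1 j = cB sv ty d d1 k + cC sv ty d d1 k -> cB sv ty d d1 j < cB sv ty d d1 k ->
    (forall l, (l < n)%N -> ty l == d -> cB sv ty d d1 l + cC sv ty d d1 l = cB sv ty d d1 j + cC sv ty d d1 j ->
       cB sv ty d d1 j < cB sv ty d d1 l -> cB sv ty d d1 l < cB sv ty d d1 k -> False) ->
    ~~ left_in j -> left_in k -> X k = pair_term n sv ty d d1 j k
}.

Definition dir_part d := \sum_(0 <= k < n | (ty k == d) && left_in k) X k.

Lemma dir_ok d d1 s0 acc A s q (Q : state -> Prop) : (d < 3)%N -> (d1 < 3)%N -> d <> d1 -> paired d d1 ->
  ready n sv ty d s0 acc s -> `|acc| <= A -> A + (3 * n%:Z + 1) * (600 * n%:Z ^+ 5) <= B%:Z ->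
  (forall s', ready n sv ty d.+1 s0 (acc + dir_part d) s' -> `|acc + dir_part d| <= A + (3 * n%:Z + 1) * (600 * n%:Z ^+ 5) -> ok B L q s' Q) ->
  ok B L (Sq (fill d d1) (Sq (sweep d) q)) s Q.
Proof.
move=> d3 d13 dd1 [h1 h2 h3 h4] rd aA AB HQ.
have A0 : 0 <= A by apply: le_trans aA.
apply: ok_Sq; apply: ok_imp (fill_ok sv1 d3 d13 dd1 HB HB2 HL n0 ty3 rd) _ => s1 [F t5 t6 g].
have st : tables n sv ty d d1 s0 s1.
  case: F => f1 f2 f3 f4 f5 f6 f7 f8 f9 f10 f11 f12; split=> //.
  - by move=> i; rewrite leq_eqVlt => /orP[/eqP->|/f6].
  - by move=> i; rewrite leq_eqVlt => /orP[/eqP->|/f7].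
  - by move=> p; have := f10 p; rewrite minnn.
apply: ok_Sq; apply: ok_imp (sweep_ok sv1 d3 HB HB2 HL n0 h1 h2 h3 h4 st (f_last F) (f_a F) A0 aA AB) _.
by move=> s2 [r2 b2]; exact: HQ.
Qed.

Lemma main_ok s xs ys : (forall k, sv k.+1 = - sv k) ->
  (forall k, (k < n)%N ->
  [\/ [/\ ty k = 0%N, xs k.+1 - xs k = 0 & ys k.+1 - ys k = sv k],
      [/\ ty k = 1%N, xs k.+1 - xs k = sv k & ys k.+1 - ys k = 0] |
      [/\ ty k = 2%N, xs k.+1 - xs k = - sv k & ys k.+1 - ys k = 0]]) ->
  (exists2 k, (k < n)%N & ty k = 0%N) ->
  reg s 0 = n%:Z -> (forall r, r <> 0%N -> reg s r = 0) ->
  (forall k, (k < n)%N -> cell s (2 * k) = xs k /\ cell s (2 * k + 1) = ys k) ->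
  xs n = xs 0 -> ys n = ys 0 -> (forall a, (2 * n <= a)%N -> cell s a = 0) ->
  paired 0 1 -> paired 1 2 -> paired 2 0 ->
  3 * ((3 * n%:Z + 1) * (600 * n%:Z ^+ 5)) <= B%:Z ->
  ok B L main s (fun s' => reg s' 0 = dir_part 0 + dir_part 1 + dir_part 2).
Proof.
move=> svS steps vert rn r0 cs xn yn cz p0 p1 p2; set D := _ * (600 * _) => DB.
have D0 : 0 <= D by rewrite /D !mulr_ge0 ?exprn_ge0 //; clear; lia.
rewrite /main; apply: ok_Sq; apply: ok_imp (prelude_ok sv1 HB HL n0 svS steps vert rn r0 cs xn yn cz) _ => s1 r1.
apply: (dir_ok (d := 0) (d1 := 1) (A := 0) isT isT _ p0 r1); [by []|by rewrite normr0|by rewrite -/D; clear -D0 DB; lia|].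
rewrite -/D add0r add0r => s2 r2 b2.
apply: (dir_ok (d := 1) (d1 := 2) (A := D) isT isT _ p1 r2); [by []|exact: b2|by rewrite -/D; clear -D0 DB; lia|].
rewrite -/D => s3 r3 b3.
apply: (dir_ok (d := 2) (d1 := 0) (A := D + D) isT isT _ p2 r3); [by []|exact: b3|by rewrite -/D; clear -D0 DB; lia|].
move=> s4 r4 b4.
by apply: ok_Asg; [|rewrite /= (y_a r4)].
Qed.

End Main.

Local Open Scope fset_scope.
Local Open Scope ring_scope.

(** * The computed sums are those of the benzenoid *)

Definition dcode t : nat := match t with T0 => 0 | T1 => 1 | T2 => 2 end.
Lemma dcode_eq t t' : (dcode t == dcode t') = eqd t t'.
Proof. by case: t t' => -[]. Qed.

Lemma lpos_sh t s p : lpos t (sh s p) = lpos t p + 3 * ib (eqd s (nx t)) - 1.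
Proof. by case: p => u v; case: t s => -[]; rewrite /lpos /sh /=; clear; lia. Qed.
Lemma lrow_sh t s p : lrow t (sh s p) = lrow t p + 1 - 3 * ib (eqd s t).
Proof. by case: p => u v; case: t s => -[]; rewrite /lrow /sh /=; clear; lia. Qed.

Section Link.
Variable z : seq pt.
Hypotheses (z2 : (2 < size z)%N) (zU : uniq z) (zC : cycle hstep z).
Notation w := (winding z).
Notation n := (size z).
Variable E : {fset pt * pt}.
Hypothesis inGP : forall t a, (ed t a \in E) = inG z t a.
Hypothesis E_ed : forall e, e \in E -> exists t a, e = ed t a.
Variable sg : int.
Hypothesis sg1 : sg = 1 \/ sg = -1.
Hypothesis wsg : forall f, col f = 2 -> w f = 0 \/ w f = sg.
Notation zn := (zn z).
Notation ak := (ak z).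
Notation sk := (sk z).
Notation is_step := (is_step z).

Definition step_dir k := dir_of (ez z (zn k)).1 (ez z (zn k)).2.
Definition step_type k := dcode (step_dir k).
Definition eps k : int := ib (col (zn k) != 0).

Lemma step_typeE t k : (step_type k == dcode t) = is_step t k.
Proof. by rewrite dcode_eq. Qed.

Lemma step_dirP k : is_step (step_dir k) k. Proof. exact/eqdP. Qed.

Lemma zn_step k : [/\ sk k = 1, ak k = zn k, zn k.+1 = sh (step_dir k) (zn k), eps k = 0 & eps k.+1 = 1] \/
  [/\ sk k = -1, ak k = zn k.+1, zn k = sh (step_dir k) (zn k.+1), eps k = 1 & eps k.+1 = 0].
Proof.
have [e c Z] := is_step_ez z2 zC (step_dirP k); move: e c; rewrite /ak.
have ezE : ez z (zn k) = if col (zn k) == 0 then (zn k, zn k.+1) else (zn k.+1, zn k) by rewrite /ez nz_zn.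
rewrite ezE /sk /eps /sgn; move: (step_dir k) => t.
case: ifP => [c0 [e2] c|c0 [e2] c] /=; [left|right].
  by split=> //; rewrite e2 col_sh c.
by split=> //; rewrite c.
Qed.

Lemma sk_eps k : sk k = 1 - 2 * eps k.
Proof. by case: (zn_step k) => -[-> _ _ ->]. Qed.
Lemma eps01 k : eps k = 0 \/ eps k = 1.
Proof. by case: (zn_step k) => -[_ _ _ ->]; auto. Qed.
Lemma epsS k : eps k.+1 = 1 - eps k.
Proof. by case: (zn_step k) => -[_ _ _ -> ->]. Qed.
Lemma skS k : sk k.+1 = - sk k.
Proof. by rewrite !sk_eps epsS; clear; lia. Qed.
Lemma sk1 k : sk k = 1 \/ sk k = -1.
Proof. by case: (zn_step k) => -[->]; auto. Qed.
Lemma eps_n : eps n = eps 0.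
Proof. by rewrite /eps /zn modnn mod0n. Qed.

Lemma cPP_eps k : 2 * cPP sk k = k%:Z + eps k - eps 0.
Proof.
elim: k => [|k IH]; first by rewrite /= subrr.
rewrite [cPP _ _]/= mulrDr IH epsS sk_eps.
move: (eps01 k); case: ifP => h; move: h; clear; lia.
Qed.

Section Direction.
Variable t : dir.
Notation d := (dcode t).
Notation d1 := (dcode (nx t)).
Notation cB := (cB sk step_type d d1).
Notation cC := (cC sk step_type d d1).
Notation cPS := (cPS sk step_type d d1).
Notation cPP := (cPP sk).

(** By [lpos_sh] a step changes [lpos] by 2 or by -1, up to its sign. As the signs alternate along
    [z], the units cancel up to [eps], and what remains is three times the position kept by the
    program. *)
Lemma lpos_zn k : lpos t (zn k) = lpos t (zn 0) + 3 * cB k - eps k + eps 0.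
Proof.
elim: k => [|k IH]; first by rewrite /= mulr0 addr0 subrK.
rewrite [cB _]/= !dcode_eq.
have st : 3 * (if eqd (step_dir k) t then 0 else if eqd (step_dir k) (nx t) then sk k else 0) = 3 * ib (eqd (step_dir k) (nx t)) * sk k.
  by case: (step_dir k) => /=; case: (t) => /=; clear; lia.
rewrite mulrDr st.
case: (zn_step k) => -[-> _ e e0 e1]; rewrite e0 in IH; rewrite e1.
  by rewrite e lpos_sh IH; clear; lia.
by move: IH; rewrite e lpos_sh; clear; lia.
Qed.

Lemma lrow_zn k : lrow t (zn k) = lrow t (zn 0) + 3 * (cB k + cC k) - 2 * (eps k - eps 0).
Proof.
elim: k => [|k IH]; first by rewrite subrr; clear; rewrite /=; lia.
rewrite [cB _]/= [cC _]/= !dcode_eq.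
have st : (if eqd (step_dir k) t then 0 else if eqd (step_dir k) (nx t) then sk k else 0) +
   (if eqd (step_dir k) t then 0 else if eqd (step_dir k) (nx t) then 0 else sk k) = (1 - ib (eqd (step_dir k) t)) * sk k.
  by case: (step_dir k) => /=; case: (t) => /=; clear; lia.
rewrite addrACA st.
case: (zn_step k) => -[-> _ e e0 e1]; rewrite e0 in IH; rewrite e1.
  by rewrite e lrow_sh IH; clear; lia.
by move: IH; rewrite e lrow_sh; clear; lia.
Qed.

Definition c_pos : int := lpos t (zn 0) + eps 0.
Definition c_row : int := lrow t (zn 0) + 2 * eps 0.

Lemma lpos_ak k : is_step t k -> lpos t (ak k) = c_pos + 3 * cB k.
Proof.
move=> /eqdP tk; have h := lpos_zn k; rewrite /c_pos.
case: (zn_step k) => -[_ -> e e0 e1]; rewrite e0 in h; first by rewrite h; clear; lia.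
by move: h; rewrite e lpos_sh /step_dir tk; case: (t) => /=; clear; lia.
Qed.

Lemma lrow_ak k : is_step t k -> lrow t (ak k) = c_row + 3 * (cB k + cC k).
Proof.
move=> /eqdP tk; have h := lrow_zn k; rewrite /c_row.
case: (zn_step k) => -[_ -> e e0 e1]; rewrite e0 in h; first by rewrite h; clear; lia.
by move: h; rewrite e lrow_sh /step_dir tk; case: (t) => /=; clear; lia.
Qed.

(** This is the function [b] of [run_count]: it grows by one along every row and agrees with [cB] at
    the steps of direction [t], so the prefix sums of the program are those of Green's formula. *)
Definition strip_index (a : pt) : int := ((lpos t a - c_pos) %/ 3)%Z.

Lemma strip_index_ak k : is_step t k -> strip_index (ak k) = cB k.
Proof. by move=> tk; rewrite /strip_index lpos_ak //; clear; lia. Qed.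
Lemma strip_index_ash a : strip_index (ash t 1 a) = strip_index a + 1.
Proof. by rewrite /strip_index lpos_ash; clear; lia. Qed.

Lemma cPS_sum m : cPS m = \sum_(0 <= l < m) ib (is_step t l) * (sk l * strip_index (ak l)).
Proof.
elim: m => [|m IH]; first by rewrite big_geq.
rewrite big_nat_recr //= -IH; congr (_ + _); rewrite step_typeE.
by case: (boolP (is_step t m)) => [tm|_]; rewrite ?mul0r // mul1r strip_index_ak.
Qed.

Lemma row_eq k k' : is_step t k -> is_step t k' -> cB k + cC k = cB k' + cC k' <-> lrow t (ak k) = lrow t (ak k').
Proof. by move=> tk tk'; rewrite !lrow_ak //; split; clear; lia. Qed.
Lemma pos_lt k k' : is_step t k -> is_step t k' -> cB k < cB k' <-> lpos t (ak k) < lpos t (ak k').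
Proof. by move=> tk tk'; rewrite !lpos_ak //; split; clear; lia. Qed.

Lemma flow_step k : is_step t k -> w (Lf t (ak k)) - w (Rf t (ak k)) = sk k.
Proof.
move=> tk; have [e c Z] := is_step_ez z2 zC tk.
have iE : ez z (zn k) \in E by apply: (ez_E z2 zU zC inGP); exact: zn_in.
have := flow_ez z2 zU zC inGP E_ed sg1 iE; rewrite e lface_ed rface_ed => ->.
rewrite (bigD1_seq (zn k)) //= ?zn_in // e eqxx mulr1 big1_seq ?addr0 // => u /andP[ne uz].
case: eqP => [eu|_]; last by rewrite mulr0.
by case/eqP: ne; apply: (ez_inj z2 zU) => //; [exact: zn_in|rewrite eu e].
Qed.

Lemma sk_inL k : is_step t k -> sk k = if left_in z t k then sg else - sg.
Proof.
move=> tk; have [e c Z] := is_step_ez z2 zC tk; have := flow_step tk.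
have := Z_sides z2 zU zC sg1 wsg c Z; have := wsg (col_Lf t c); have := wsg (col_Rf t c).
rewrite /left_in; move: (w _) (w _) (sk k) sg1 => x y q; clear.
by case: eqP => /= hx; case: eqP => /= hy //; lia.
Qed.

(* Green's formula for the whole benzenoid: [cPS] ends with plus or minus the
   number of hexagons, which gives the orientation of [z]. *)
Lemma cPS_area : exists N : nat, (0 < N)%N /\ cPS n = sg * N%:Z.
Proof.
have [DS [uD DP]] := DS_ex z2 zU zC sg1.
exists (size DS); split.
  have [e c Z] := is_step_ez z2 zC (step_dirP 0).
  have : (Lf (step_dir 0) (ak 0) \in DS) || (Rf (step_dir 0) (ak 0) \in DS).
    rewrite !DP col_Lf ?col_Rf //= (Z_sides z2 zU zC sg1 wsg c Z).
    by case: eqP.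
  by case: (DS).
pose G (e : pt * pt) : int := ib (eqd (dir_of e.1 e.2) t) * strip_index e.1.
have h : \sum_(e <- E) G e * (w (lface e) - w (rface e)) = cPS n.
  rewrite big_seq (eq_bigr (fun e => G e * \sum_(u <- z) sgn u * ib (ez z u == e))); last first.
    by move=> e eE; rewrite (flow_ez z2 zU zC inGP E_ed sg1 eE).
  rewrite -big_seq (sum_ez z2 zU zC inGP) sum_zn cPS_sum; apply: eq_bigr => k _.
  by rewrite /G -/(is_step t k) -/(ak k) -/(sk k) mulrCA.
rewrite -h.
have wE f : col f = 2 -> w f = sg * ib (w f != 0).
  by move=> /wsg [->|->]; rewrite ?eqxx ?mulr0 //; case: sg1 => ->.
transitivity (\sum_(e <- E) sg * (G e * (1 * ib (w (lface e) != 0)) - G e * (1 * ib (w (rface e) != 0)))).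
  rewrite big_seq [RHS]big_seq; apply: eq_bigr => e eE; have [s [a ee]] := E_ed eE.
  have ca : col a = 0 by move: eE; rewrite ee inGP => /inG_col.
  rewrite ee lface_ed rface_ed {1}(wE _ (col_Lf s ca)) {1}(wE _ (col_Rf s ca)); move: (G _) (ib _) (ib _); clear.
  by move=> x y y'; lia.
rewrite -mulr_sumr sumrB; congr (_ * _).
rewrite (flux_L z2 zU zC inGP E_ed sg1 G (fun=> 1) uD DP) (flux_R z2 zU zC inGP E_ed sg1 G (fun=> 1) uD DP).
rewrite -sumrB (eq_bigr (fun=> 1)); last first.
  move=> f _; rewrite /G !dir_of_sh /strip_index.
  by case: (t) => /=; rewrite /lpos /sh /=; clear; lia.
by rewrite big_const_seq count_predT iter_addr addr0 natz.
Qed.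

Lemma area_sign_sg : area_sign n sk step_type d d1 = sg.
Proof.
have [N [N0 e]] := cPS_area; rewrite /area_sign e; case: sg1 => ->; case: ifP => //; clear -N0; lia.
Qed.

(** The direction is taken from the step itself, so that one function serves all three passes of
    [main_ok]. *)
Definition step_left_in k := left_in z (step_dir k) k.
Definition step_term k := run_term z E (step_dir k) k.

Lemma link_paired : paired n sk step_type step_left_in step_term d d1.
Proof.
have inLE k : is_step t k -> step_left_in k = left_in z t k by move=> /eqdP e; rewrite /step_left_in /step_dir e.
split; rewrite /=.
- move=> i j ni nj; rewrite !step_typeE => ti tj er ep; apply: (row_inj z2 zU zC ni nj ti tj).
    exact/row_eq.
  by rewrite !lpos_ak // ep.
- move=> k kn; rewrite step_typeE => tk; rewrite inLE // => iL.
  have [k' [k'n tk' kr kp niL]] := first_end z2 zU zC sg1 wsg tk iL.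
  exists k'; rewrite step_typeE; split=> //; first exact/row_eq.
  exact/pos_lt.
- move=> k k' kn k'n; rewrite !step_typeE => tk tk' er lt nb; rewrite !inLE //.
  have [||l ln tl lr l1 l2|r [_ _ _ -> _]//] := next_end z2 zU zC sg1 wsg kn k'n tk tk'.
  + exact/row_eq.
  + exact/pos_lt.
  + by apply: (nb l) => //; [rewrite step_typeE|apply/row_eq|apply/pos_lt|apply/pos_lt].
- move=> j k jn kn; rewrite !step_typeE => tj tk er lt nb; rewrite !inLE // => iLj iLk.
  have [||l ln tl lr l1 l2|r [r0 rp ra _ H]] := next_end z2 zU zC sg1 wsg jn kn tj tk.
  + exact/row_eq.
  + exact/pos_lt.
  + by apply: (nb l) => //; [rewrite step_typeE|apply/row_eq|apply/pos_lt|apply/pos_lt].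
  have [run rrE] := H iLj.
  have := run_term_arc z2 zU zC inGP E_ed sg1 wsg strip_index_ash jn kn tj tk run rrE ra.
  cbv beta zeta; rewrite -!cPS_sum => -[m1 [m2 [XE h1 h2]]].
  have -> : step_term k = run_term z E t k by rewrite /step_term; move/eqdP: tk; rewrite /step_dir => ->.
  rewrite /pair_term area_sign_sg XE.
  have rE : cB k - cB j = r%:Z by move: rp; rewrite !lpos_ak //; clear; lia.
  rewrite rE.
  (* The two ends of a run have their inside hexagon on opposite sides, so [z] traverses them in
     opposite directions. Hence the arcs between them have even length and [cPP] counts exactly half
     of their steps. *)
  have se : eps j + eps k = 1.
    have := sk_inL tj; have := sk_inL tk; rewrite iLk (negPf iLj) !sk_eps.
    by case: sg1 => ->; clear; lia.
  have se2 : eps (minn j k) + eps (maxn j k) = 1.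
    by rewrite /minn /maxn; case: ifP => _ //; rewrite addrC.
  set a := minn j k in h1 h2 se2 *; set b := maxn j k in h1 h2 se2 *.
  have p1 := cPP_eps a; have p2 := cPP_eps a.+1; have p3 := cPP_eps b; have p4 := cPP_eps b.+1.
  have p5 := cPP_eps n; rewrite eps_n in p5; rewrite !epsS in p2 p4.
  have -> : m1 = 3 * sg * (cPS b - cPS a.+1) + (cPP b - cPP a.+1) + r%:Z.
    move: h1 p2 p3 se2; case: sg1 => ->; clear; lia.
  have -> : m2 = 3 * sg * (cPS n - cPS b.+1 + cPS a) + (cPP n - cPP b.+1 + cPP a) + r%:Z.
    move: h2 p1 p4 p5 se2; case: sg1 => ->; clear; lia.
  by [].
Qed.

Lemma dir_partE : dir_part n step_type step_left_in step_term d = \sum_(0 <= k < n | is_step t k && left_in z t k) run_term z E t k.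
Proof.
rewrite /dir_part big_mkcond [RHS]big_mkcond; apply: eq_bigr => k _; rewrite step_typeE.
case: (boolP (is_step t k)) => //= /eqdP tk.
by rewrite /step_left_in /step_term /step_dir tk.
Qed.

End Direction.

Lemma Sz_parts : (Sz_e E)%:Z = dir_part n step_type step_left_in step_term 0 + dir_part n step_type step_left_in step_term 1 + dir_part n step_type step_left_in step_term 2.
Proof.
by rewrite (Sz_sum z2 zU zC inGP E_ed sg1 wsg) (dir_partE T0) (dir_partE T1) (dir_partE T2).
Qed.

End Link.

From mathcomp Require Import all_reals all_analysis.
Import numFieldNormedType.Exports.

Local Open Scope ring_scope.

(** * Geometric realization *)

(* From the coordinates of the input to axial ones. *)
Definition kap (v : vertex) : pt := (((3 * v.2 - v.1) %/ 2)%Z, v.1).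
Definition ikap (p : pt) : vertex := (p.2, ((2 * p.1 + p.2 + 1) %/ 3)%Z).

Lemma kapK : cancel kap ikap.
Proof. by case=> x y; rewrite /kap /ikap /=; congr pair; lia. Qed.

Lemma ikapK p : col p = 0 \/ col p = 1 -> kap (ikap p) = p.
Proof. by case: p => u v; rewrite /col /kap /ikap /= => h; congr pair; lia. Qed.

Lemma col_kap v : col (kap v) = if even_vertex v then 0 else 1.
Proof.
case: v => x y; rewrite /even_vertex /kap /col /=; case: ifP; lia.
Qed.

Lemma hex_edgeP u v : reflect (exists t, up_step t (kap u) (kap v)) (hex_edge (u, v)).
Proof.
have key t : up_step t (kap u) (kap v) -> hex_edge (u, v).
  case: u v => x y [x' y']; rewrite /hex_edge /up_step col_kap !inE /= !xpair_eqE.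
  case: ifP => [ev /=|//]; move: ev; rewrite /even_vertex /kap /sh /=.
  by case: t => /=; rewrite -?pt_eqE ?xpair_eqE /=; lia.
apply: (iffP idP) => [|[t /key//]].
case: u v {key} => x y [x' y']; rewrite /hex_edge /up_step col_kap !inE /= !xpair_eqE.
case/andP => ev; rewrite ev /=; move: ev; rewrite /even_vertex /=.
move=> ev /or3P[] /andP[/eqP-> /eqP->].
- by exists T2; rewrite /kap /sh /= xpair_eqE; lia.
- by exists T1; rewrite /kap /sh /= xpair_eqE; lia.
- by exists T0; rewrite /kap /sh /= xpair_eqE; lia.
Qed.

Lemma hex_adj_hstep u v : hex_adj u v = hstep (kap u) (kap v).
Proof.
rewrite /hex_adj /=; apply/orP/hstepP.
  by case=> /hex_edgeP[t h]; exists t; [left|right].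
by case=> t [] h; [left|right]; apply/hex_edgeP; exists t.
Qed.

(** A closed hexagon extends by 1 from its centre in each coordinate. The margins keep the hexagons
    centred in the box of size [M] strictly within size [N], and let [B] contain the centre of every
    hexagon that meets the open box of size [N]. *)
Lemma box_ex (M : int) : exists (N : int) (B : seq pt),
  (forall g, in_box M g -> [/\ 2 - N <= g.1, g.1 <= N - 2, 2 - N <= g.2 & g.2 <= N - 2]) /\
  (forall g : pt, - N - 1 <= g.1 -> g.1 <= N + 1 -> - N - 1 <= g.2 -> g.2 <= N + 1 -> g \in B).
Proof.
pose N : int := `|M| + 2; exists N.
pose rg := [seq (Posz i) - (N + 1) | i <- iota 0 `|(2 * N + 2)%R|%N.+1].
exists [seq ((x, y) : pt) | x <- rg, y <- rg]; split.
  by case=> x y; rewrite /in_box /N /=; split; lia.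
have rgP x : - N - 1 <= x -> x <= N + 1 -> x \in rg.
  move=> h1 h2; apply/mapP; exists `|(x + (N + 1))%R|%N; last by move: h1 h2; clear; lia.
  by rewrite mem_iota; move: h1 h2; clear; lia.
by move=> g *; apply/allpairsP; exists (g.1, g.2); split; [exact: rgP|exact: rgP|case: (g)].
Qed.

Local Open Scope classical_set_scope.
Local Open Scope ring_scope.

Section Geo.
Variable R : realType.
Notation rs := (Num.sqrt 3 / 2 : R).

Lemma rs_gt0 : 0 < rs. Proof. by rewrite divr_gt0 // sqrtr_gt0. Qed.

(* The geometric realization, extended to the centres of the hexagons; [Uc] and
   [Vc] are the affine coordinates that invert it. *)
Definition cen (f : pt) : R * R := (rs * f.2%:~R, f.1%:~R + f.2%:~R / 2 + 1 / 4).
Definition Vc (p : R * R) : R := p.1 / rs.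
Definition Uc (p : R * R) : R := p.2 - 1 / 4 - Vc p / 2.

Lemma Vc_cen f : Vc (cen f) = f.2%:~R.
Proof. by rewrite /Vc /cen /= mulrC mulKf // gt_eqF // rs_gt0. Qed.
Lemma Uc_cen f : Uc (cen f) = f.1%:~R.
Proof. rewrite /Uc Vc_cen /cen /=; lra. Qed.

Lemma UV_inj p q : Uc p = Uc q -> Vc p = Vc q -> p = q.
Proof.
case: p q => p1 p2 [q1 q2]; rewrite /Uc /= => h1 h2.
have e1 : p1 = q1 by move: h2; rewrite /Vc /= => /mulIf; apply; rewrite invr_neq0 // gt_eqF // rs_gt0.
by rewrite e1; congr pair; move: h1; rewrite h2; lra.
Qed.

Lemma Vc_conv (s : R) p q : Vc ((1 - s) *: p + s *: q) = (1 - s) * Vc p + s * Vc q.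
Proof. by rewrite /Vc /= mulrDl !mulrA. Qed.
Lemma Uc_conv (s : R) p q : Uc ((1 - s) *: p + s *: q) = (1 - s) * Uc p + s * Uc q.
Proof.
rewrite /Uc Vc_conv (_ : ((1 - s) *: p + s *: q).2 = (1 - s) * p.2 + s * q.2) //.
move: (Vc p) (Vc q) p.2 q.2 => a b c d; lra.
Qed.

Lemma pos_cen v : pos R v = cen (kap v).
Proof.
rewrite /pos /cen /kap /=; congr pair.
have [ev|od] := boolP (even_vertex v).
  have e : 2 * ((3 * v.2 - v.1) %/ 2)%Z = 3 * v.2 - v.1 by move: ev; rewrite /even_vertex; case: v => x y /=; lia.
  have := congr1 (fun x : int => x%:~R : R) e; rewrite /= !(intrD, intrM, intrN, rmorphN) /= => h; lra.
have e : 2 * ((3 * v.2 - v.1) %/ 2)%Z = 3 * v.2 - v.1 - 1 by move: od; rewrite /even_vertex; case: v => x y /=; lia.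
have := congr1 (fun x : int => x%:~R : R) e; rewrite /= !(intrD, intrM, rmorphN) /= => h; lra.
Qed.

(* The closed hexagon with centre [f], and its interior. *)
Definition Hx (f : pt) (p : R * R) : Prop :=
  [/\ `|Uc p - f.1%:~R| <= 1, `|Vc p - f.2%:~R| <= 1 &
      `|(Uc p - f.1%:~R) + (Vc p - f.2%:~R)| <= 1].
Definition Hi (f : pt) (p : R * R) : Prop :=
  [/\ `|Uc p - f.1%:~R| < 1, `|Vc p - f.2%:~R| < 1 &
      `|(Uc p - f.1%:~R) + (Vc p - f.2%:~R)| < 1].

Definition segP (a b : pt) : set (R * R) := [set (1 - s) *: cen a + s *: cen b | s in `[0, 1]].

Lemma segP_coord a b p : segP a b p <->
  exists s : R, [/\ 0 <= s <= 1, Uc p = (1 - s) * a.1%:~R + s * b.1%:~R & Vc p = (1 - s) * a.2%:~R + s * b.2%:~R].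
Proof.
split.
  case=> s; rewrite /= in_itv /= => s01 <-; exists s.
  by rewrite Uc_conv Vc_conv !Uc_cen !Vc_cen.
case=> s [s01 e1 e2]; exists s; first by rewrite /= in_itv.
by apply: UV_inj; rewrite (Uc_conv, Vc_conv) !(Uc_cen, Vc_cen).
Qed.

Lemma segP_sym a b : segP a b = segP b a.
Proof.
apply/seteqP; split=> p /segP_coord[s [s01 e1 e2]]; apply/segP_coord; exists (1 - s); split; lra.
Qed.

Lemma segment_segP u v : @segment R u v = segP (kap u) (kap v).
Proof. by rewrite /segment /segP !pos_cen. Qed.

Lemma edge_Hx t a p : segP a (sh t a) p -> Hx (Lf t a) p /\ Hx (Rf t a) p.
Proof.
case/segP_coord=> s [s01 e1 e2]; move: e1 e2; rewrite /Hx /Lf /Rf.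
move: (Uc p) (Vc p) => u v; case: t; rewrite /sh /us /= !(intrD, rmorphN) /= => -> ->;
 move: (a.1%:~R) (a.2%:~R) => x y; rewrite !ler_norml; split; split; lra.
Qed.

Lemma Hi_Hx f p : Hi f p -> Hx f p.
Proof. by case=> *; split; apply: ltW. Qed.

Lemma int_bnd (x : R) (i j : int) : `|x - i%:~R| <= 1 -> `|x - j%:~R| <= 1 -> `|j - i| <= 2.
Proof.
rewrite !ler_norml => h1 h2; apply/andP; split; rewrite -(ler_int R) !(intrD, rmorphN) /=; lra.
Qed.

(** Centres of hexagons with a common point differ by at most 2 in each of the three coordinates
    [u], [v] and [u + v]. As both have colour 2, only the six displacements to neighbouring hexagons
    remain, and each is a linear problem. *)
Lemma two_hex f g p : col f = 2 -> col g = 2 -> Hx f p -> Hx g p -> f != g ->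
  ~ Hi f p /\ exists t a, [/\ col a = 0, (f = Lf t a /\ g = Rf t a) \/ (f = Rf t a /\ g = Lf t a) &
    segP a (sh t a) p].
Proof.
move=> cf cg [f1 f2 f3] [g1 g2 g3] fg.
have b1 := int_bnd f1 g1; have b2 := int_bnd f2 g2.
have b3 : `|(g.1 + g.2) - (f.1 + f.2)| <= 2.
  apply: (@int_bnd (Uc p + Vc p)); rewrite intrD.
    by move: f3; rewrite !ler_norml; lra.
  by move: g3; rewrite !ler_norml; lra.
move: f g cf cg fg f1 f2 f3 g1 g2 g3 b1 b2 b3 => [x y] [x' y'].
rewrite /= /Hi; set u := Uc p; set v := Vc p => cf cg fg f1 f2 f3 g1 g2 g3 b1 b2 b3.
have [t D] : exists t, (x' = x + du (nx t) - du (nx (nx t)) /\ y' = y + dv (nx t) - dv (nx (nx t))) \/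
    (x' = x - du (nx t) + du (nx (nx t)) /\ y' = y - dv (nx t) + dv (nx (nx t))).
  move: cf cg fg b1 b2 b3; rewrite /col pt_eqE /=; clear => cf cg fg b1 b2 b3.
  have : ((x' = x - 1 /\ y' = y + 2) \/ (x' = x + 1 /\ y' = y - 2)) \/
             ((x' = x - 1 /\ y' = y - 1) \/ (x' = x + 1 /\ y' = y + 1)) \/
             ((x' = x + 2 /\ y' = y - 1) \/ (x' = x - 2 /\ y' = y + 1)) by lia.
  by case=> [h|[h|h]]; [exists T0|exists T1|exists T2]; move: h => /=; lia.
have F : ((x, y) : pt) = Lf t (sh (nx t) (x, y)) /\ ((x, y) : pt) = Rf t (sh (nx (nx t)) (x, y)).
  by rewrite /Lf /Rf !us_sh.
have [F1 F2] := F.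
have ca s : col (sh s (x, y)) = 0 by rewrite col_sh cf.
case: D => -[ex ey].
  have G : ((x', y') : pt) = Rf t (sh (nx t) (x, y)).
    by rewrite ex ey /Rf /us /sh /=; congr pair; lia.
  rewrite ex ey !(intrD, rmorphN) /= in g1 g2 g3; rewrite !ler_norml in f1 f2 f3 g1 g2 g3.
  split; first by rewrite !ltr_norml => -[]; move: f1 f2 f3 g1 g2 g3; case: (t) => /=; rewrite ?(rmorphN, rmorph1, rmorph0) /=; lra.
  exists t, (sh (nx t) (x, y)); split=> //; first by left.
  apply/segP_coord; rewrite -/u -/v.
  (* The parameter of [p] on the common edge, read off from a coordinate that varies along the
     edge. *)
  exists (match t with T0 => u - x%:~R + 1 | T1 => x%:~R - u | T2 => y%:~R - v end).
  move: f1 f2 f3 g1 g2 g3; rewrite /sh; case: (t) => /=; rewrite !(intrD, rmorphN) /= ?(rmorph1, rmorph0) /= => f1 f2 f3 g1 g2 g3; move: x%:~R y%:~R u v f1 f2 f3 g1 g2 g3 => X Y u0 v0; clear; split; first [lra | nra].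
have G : ((x', y') : pt) = Lf t (sh (nx (nx t)) (x, y)).
  by rewrite ex ey /Lf /us /sh /=; congr pair; lia.
rewrite ex ey !(intrD, rmorphN) /= in g1 g2 g3; rewrite !ler_norml in f1 f2 f3 g1 g2 g3.
split; first by rewrite !ltr_norml => -[]; move: f1 f2 f3 g1 g2 g3; case: (t) => /=; rewrite ?(rmorphN, rmorph1, rmorph0) /=; lra.
exists t, (sh (nx (nx t)) (x, y)); split=> //; first by right.
apply/segP_coord; rewrite -/u -/v.
exists (match t with T0 => u - x%:~R | T1 => v - y%:~R | T2 => 1 - (v - y%:~R) end).
move: f1 f2 f3 g1 g2 g3; rewrite /sh; case: (t) => /=; rewrite !(intrD, rmorphN) /= ?(rmorph1, rmorph0) /= => f1 f2 f3 g1 g2 g3; move: x%:~R y%:~R u v f1 f2 f3 g1 g2 g3 => X Y u0 v0; clear; split; first [lra | nra].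
Qed.

End Geo.

Section Geo.
Variable R : realType.

(** The unit cell containing [p] is cut by a diagonal into two triangles. The corners of each have
    three different colours, and the hexagon centred at the corner of colour 2 contains the
    triangle. *)
Lemma cover (p : R * R) : exists f, col f = 2 /\ Hx f p.
Proof.
pose i := Num.floor (Uc p); pose j := Num.floor (Vc p).
have /andP[u1 u2] : i%:~R <= Uc p < (i + 1)%:~R by exact: floor_itv.
have /andP[v1 v2] : j%:~R <= Vc p < (j + 1)%:~R by exact: floor_itv.
rewrite !intrD /= in u2 v2.
suff H : forall q : pt, col q = 2 -> (q = (i, j) /\ (Uc p - i%:~R) + (Vc p - j%:~R) <= 1) \/ q = (i + 1, j) \/ q = (i, j + 1) \/
   (q = (i + 1, j + 1) /\ 1 <= (Uc p - i%:~R) + (Vc p - j%:~R)) -> Hx q p.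
  have [le|lt] := leP ((Uc p - i%:~R) + (Vc p - j%:~R)) 1.
    have : col (i, j) = 2 \/ col (i + 1, j) = 2 \/ col (i, j + 1) = 2 by rewrite /col /=; clear; lia.
    by case=> [c|[c|c]]; [exists (i, j)|exists (i + 1, j)|exists (i, j + 1)]; split=> //; apply: H; auto.
  have : col (i + 1, j + 1) = 2 \/ col (i + 1, j) = 2 \/ col (i, j + 1) = 2 by rewrite /col /=; clear; lia.
  case=> [c|[c|c]]; [exists (i + 1, j + 1)|exists (i + 1, j)|exists (i, j + 1)]; split=> //; apply: H; auto.
  by do 3!right; split=> //; apply: ltW.
move=> q cq; rewrite /Hx !ler_norml; move: (Uc p) (Vc p) u1 u2 v1 v2 => u v u1 u2 v1 v2.
by case=> [[-> h]|[->|[->|[-> h]]]] /=; rewrite ?intrD /=; split; lra.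
Qed.

(** The midpoint of an edge lies on no other edge, so one can pass through it from a face to its
    neighbour without meeting the rest of the curve. *)
Lemma mid_hex t a g (p : R * R) : col a = 0 -> col g = 2 ->
  Uc p = (a.1%:~R + (sh t a).1%:~R) / 2 -> Vc p = (a.2%:~R + (sh t a).2%:~R) / 2 ->
  Hx g p -> g = Lf t a \/ g = Rf t a.
Proof.
move=> ca cg e1 e2 [h1 h2 h3].
have B (x : R) (m k : int) : x * 2 = m%:~R -> `|x - k%:~R| <= 1 -> `|m - 2 * k| <= 2.
  move=> xm; rewrite !ler_norml => h; apply/andP; split; rewrite -(ler_int R) !(intrD, rmorphN, intrM) /=; lra.
have b1 := B _ (a.1 + (sh t a).1) _ (_ : Uc p * 2 = _) h1.
have b2 := B _ (a.2 + (sh t a).2) _ (_ : Vc p * 2 = _) h2.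
have b3 := B (Uc p + Vc p) (a.1 + (sh t a).1 + (a.2 + (sh t a).2)) (g.1 + g.2).
have {}b1 : `|a.1 + (sh t a).1 - 2 * g.1| <= 2 by apply: b1; rewrite intrD; lra.
have {}b2 : `|a.2 + (sh t a).2 - 2 * g.2| <= 2 by apply: b2; rewrite intrD; lra.
have {}b3 : `|a.1 + (sh t a).1 + (a.2 + (sh t a).2) - 2 * (g.1 + g.2)| <= 2.
  apply: b3; first by rewrite 3!intrD e1 e2; lra.
  by move: h3; rewrite intrD !ler_norml; lra.
move: ca cg b1 b2 b3; clear; case: a g => x y [x' y']; rewrite /col /Lf /Rf /sh /us /= => ca cg b1 b2 b3.
suff /orP[/eqP|/eqP] : ((x', y') == us (nx t) (x, y)) || ((x', y') == us (nx (nx t)) (x, y)) by auto.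
by rewrite /us; case: (t) b1 b2 b3 => /= b1 b2 b3; rewrite !pt_eqE; lia.
Qed.

Lemma sides_inj t t' a a' : (Lf t a = Lf t' a' /\ Rf t a = Rf t' a') \/ (Lf t a = Rf t' a' /\ Rf t a = Lf t' a') ->
  t = t' /\ a = a'.
Proof.
case: a a' => x y [x' y'].
by rewrite /Lf /Rf /us; case: t t' => -[] /= [] [[? ?] [? ?]]; first [by split=> //; congr pair; lia | exfalso; lia].
Qed.

Lemma Hi_seg f (p : R * R) (s : R) : Hx f p -> 0 < s <= 1 ->
  Hi f ((1 - s) *: p + s *: cen R f).
Proof.
move=> [h1 h2 h3] s01; rewrite /Hi !Uc_conv !Vc_conv !Uc_cen !Vc_cen.
have E (x y : R) : (1 - s) * x + s * y - y = (1 - s) * (x - y) by lra.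
have K (x : R) : `|x| <= 1 -> `|(1 - s) * x| < 1.
  move=> hx; rewrite normrM ger0_norm; last lra.
  by apply: (le_lt_trans (ler_piMr _ hx)); lra.
rewrite !E -mulrDr; split; exact: K.
Qed.

Lemma Lf_Rf t a : Lf t a != Rf t a.
Proof. by case: a => x y; rewrite /Lf /Rf /us; case: t; rewrite /= pt_eqE; lia. Qed.

Lemma edge_nHi t a g (p : R * R) : col a = 0 -> col g = 2 -> @segP R a (sh t a) p -> ~ Hi g p.
Proof.
move=> ca cg /edge_Hx[hL hR] hi; have hg := Hi_Hx hi.
have [e|ne] := eqVneq g (Lf t a).
  have ne : g != Rf t a by rewrite e Lf_Rf.
  by have [] := two_hex cg (col_Rf t ca) hg hR ne.
by have [] := two_hex cg (col_Lf t ca) hg hL ne.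
Qed.

End Geo.

Local Open Scope fset_scope.
Local Open Scope classical_set_scope.
Local Open Scope ring_scope.

(** * Closedness, connectedness and boundedness in affine coordinates *)

Section Topo.
Variable R : realType.
Notation rs := (Num.sqrt 3 / 2 : R).

Lemma Vc_cont : continuous (@Vc R : R * R -> R).
Proof. by move=> p; apply: cvgM; [exact: cvg_fst|exact: cvg_cst]. Qed.

Lemma Uc_cont : continuous (@Uc R : R * R -> R).
Proof.
move=> p; apply: cvgB; last by apply: cvgM; [exact: Vc_cont|exact: cvg_cst].
by apply: cvgB; [exact: cvg_snd|exact: cvg_cst].
Qed.

Lemma closed_norm_le (g : R * R -> R) (c : R) : continuous g -> closed [set p | `|g p| <= c].
Proof.
move=> cg; apply: (@preimage_closed _ _ (fun p => `|g p|) [set x | x <= c]); last exact: closed_le.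
by move=> p _; apply: cvg_norm; exact: cg.
Qed.

Lemma open_norm_lt (g : R * R -> R) (c : R) : continuous g -> open [set p | `|g p| < c].
Proof.
move=> cg; apply: (@open_comp _ _ (fun p => `|g p|) [set x | x < c]); last exact: open_lt.
by move=> p _; apply: cvg_norm; exact: cg.
Qed.

Lemma Hx_closed f : closed [set p | Hx (R := R) f p].
Proof.
have -> : [set p | Hx (R := R) f p] = [set p | `|Uc p - f.1%:~R| <= 1] `&` [set p | `|Vc p - f.2%:~R| <= 1] `&`
    [set p | `|(Uc p - f.1%:~R) + (Vc p - f.2%:~R)| <= 1].
  by apply/seteqP; split=> p /=; [case=> *; do 2?split|case=> -[]; split].
have cU : continuous (fun p : R * R => Uc p - f.1%:~R).
  by move=> p; apply: cvgB; [exact: Uc_cont|exact: cvg_cst].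
have cV : continuous (fun p : R * R => Vc p - f.2%:~R).
  by move=> p; apply: cvgB; [exact: Vc_cont|exact: cvg_cst].
apply: closedI; last by apply: closed_norm_le => p; apply: cvgD; [exact: cU|exact: cV].
by apply: closedI; apply: closed_norm_le.
Qed.

Definition line (p q : R * R) : set (R * R) := [set (1 - s) *: p + s *: q | s in `[0, 1]].

Lemma line_connected p q : connected (line p q).
Proof.
apply: connected_continuous_connected; first exact: segment_connected.
apply: continuous_subspaceT => s; apply: cvgD; apply: cvgZr_tmp; last exact: cvg_id.
by apply: cvgB; [exact: cvg_cst|exact: cvg_id].
Qed.

Lemma line_component (A : set (R * R)) p q : line p q `<=` A -> connected_component A p q.
Proof.
move=> pqA; apply: (@connected_component_max _ A (line p q) p _ pqA (@line_connected p q)).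
  by exists 0; [rewrite /= in_itv /= lexx ler01|rewrite subr0 scale1r scale0r addr0].
by exists 1; [rewrite /= in_itv /= lexx ler01|rewrite subrr scale1r scale0r add0r].
Qed.

Lemma bounded_coord (A : set (R * R)) (M : R) : (forall p, A p -> `|Uc p| <= M /\ `|Vc p| <= M) ->
  bounded_set A.
Proof.
move=> H; exists (rs * M + (2 * M + 1)); split; first exact: num_real.
move=> K0 hK p /= /H[hU hV]; apply: le_trans (ltW hK).
have M0 : 0 <= M by apply: le_trans hU.
have r0 := rs_gt0 R.
have e1 : p.1 = rs * Vc p by rewrite /Vc mulrC divfK // gt_eqF.
have e2 : p.2 = Uc p + Vc p / 2 + 1 / 4 by rewrite /Uc; move: (Vc p) => v; lra.
rewrite prod_normE ge_max; apply/andP; split.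
  rewrite e1 normrM gtr0_norm //; apply: (@le_trans _ _ (rs * M)); last lra.
  by rewrite ler_pM2l.
have : 0 <= rs * M by rewrite mulr_ge0 // ltW.
rewrite e2; move: (rs * M) => K Kp; move: hU hV; rewrite !ler_norml; lra.
Qed.

Lemma bounded_Vc (A : set (R * R)) : bounded_set A -> exists M : R, forall p, A p -> `|Vc p| <= M.
Proof.
move=> [M [_ hM]]; exists ((M + 1) / rs) => p Ap; have lt : M < M + 1 by rewrite ltrDl.
have := hM _ lt p Ap.
rewrite /= prod_normE ge_max => /andP[h _].
have r0 := rs_gt0 R.
by rewrite /Vc normrM normfV (gtr0_norm r0) ler_pM2r // invr_gt0.
Qed.

End Topo.

Lemma hex_cycle_kap z : hex_cycle z ->
  [/\ (2 < size (map kap z))%N, uniq (map kap z) & cycle hstep (map kap z)].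
Proof.
case/andP=> s2 /andP[zC zU]; split.
- by rewrite size_map.
- by rewrite map_inj_uniq //; exact: can_inj kapK.
- rewrite cycle_map; congr (is_true _): zC; apply: eq_cycle => u v; exact: hex_adj_hstep.
Qed.

(** * Components of the complement of the curve *)

Section Region.
Variable R : realType.
Variable z : seq vertex.
Hypothesis hz : hex_cycle z.
Notation zP := (map kap z).
Let z2 : (2 < size zP)%N. Proof. by case: (hex_cycle_kap hz). Qed.
Let zU : uniq zP. Proof. by case: (hex_cycle_kap hz). Qed.
Let zC : cycle hstep zP. Proof. by case: (hex_cycle_kap hz). Qed.
Notation w := (winding zP).
Notation crv := (@curve R z).
Notation comp := (connected_component (~` crv)).

Lemma curveP p : crv p <-> exists t a, [/\ col a = 0, Zedge zP t a & segP a (sh t a) p].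
Proof.
have zUv : uniq z by case/andP: hz => _ /andP[].
have nk u : next zP (kap u) = kap (next z u) by apply: next_map zUv u; exact: can_inj kapK.
split.
  case=> u /= uz; rewrite segment_segP -nk.
  have uzP : kap u \in zP by apply: map_f.
  have hs := hstep_nz zC uzP; case/orP: (hstep_col hs) => /eqP cu.
    have [e c] := hstep_even hs cu => h; exists (dir_of (kap u) (next zP (kap u))), (kap u).
    by rewrite /Zedge -e uzP eqxx.
  have [e c] := hstep_odd hs cu; rewrite segP_sym => h.
  exists (dir_of (next zP (kap u)) (kap u)), (next zP (kap u)).
  by rewrite /Zedge -e uzP eqxx orbT.
case=> t [a [ca /orP[]/andP[/mapP[u uz e] /eqP n] h]]; exists u => //; rewrite segment_segP -nk -e n //.
by rewrite segP_sym.
Qed.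

Lemma curve_nHi p f : crv p -> col f = 2 -> ~ Hi f p.
Proof. by case/curveP=> t [a [ca _ h]] cf; exact: (edge_nHi ca cf h). Qed.

Lemma mixed_curve f g p : col f = 2 -> col g = 2 -> Hx f p -> Hx g p -> w f != w g -> crv p.
Proof.
move=> cf cg hf hg wfg.
have fg : f != g by apply: contraNneq wfg => ->.
have [_ [t [a [ca H h]]]] := two_hex cf cg hf hg fg.
apply/curveP; exists t, a; split=> //; apply: contraNT wfg => nZ.
by have := winding_off_edge z2 zU zC ca nZ; case: H => -[-> ->] ->.
Qed.

(** The finite union [K] of the inside hexagons is closed. Off the curve it agrees with an open set,
    a box minus the outside hexagons centred in [B], because an inside and an outside hexagon meet
    only on the curve. So [K] is open and closed in the component of [p], and contains it. The box
    keeps the union of outside hexagons finite, hence closed. *)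
Lemma comp_bounded p f : col f = 2 -> w f != 0 -> Hx f p -> ~ crv p -> bounded_set (comp p).
Proof.
move=> cf wf hf np.
have [M hM] := winding_bounded z2 zU zC.
have [N [B [hB BP]]] := box_ex M.
pose K := \big[setU/set0]_(g <- [seq g <- B | (col g == 2) && (w g != 0)]) [set q : R * R | Hx g q].
pose K' := \big[setU/set0]_(g <- [seq g <- B | (col g == 2) && (w g == 0)]) [set q : R * R | Hx g q].
have cK : closed K by apply: closed_bigsetU => g _; exact: Hx_closed.
have cK' : closed K' by apply: closed_bigsetU => g _; exact: Hx_closed.
have KP q : K q <-> exists g, [/\ col g = 2, w g != 0 & Hx g q].
  rewrite /K -bigcup_seq; split.
    case=> g gB h; have : g \in [seq g <- B | (col g == 2) && (w g != 0)] by exact: gB.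
    by rewrite mem_filter => /andP[/andP[/eqP cg wg] _]; exists g.
  case=> g [cg wg h]; suff gB : g \in [seq g <- B | (col g == 2) && (w g != 0)] by exists g.
  rewrite mem_filter cg eqxx wg andTb.
  have [b1 b2 b3 b4] := hB _ (hM _ cg wg); apply: BP; move: b1 b2 b3 b4; clear; lia.
have KB q : K q -> `|Uc q| < N%:~R /\ `|Vc q| < N%:~R.
  case/KP=> g [cg wg [h1 h2 _]]; have [] := hB _ (hM _ cg wg).
  rewrite -!(ler_int R) !intrD !rmorphN /= !mulr1z => b1 b2 b3 b4.
  by move: h1 h2; rewrite !ler_norml !ltr_norml => h1 h2; split; lra.
pose O := [set q : R * R | `|Uc q| < N%:~R] `&` [set q : R * R | `|Vc q| < N%:~R] `&` ~` K'.
have oO : open O.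
  apply: openI; last by rewrite openC.
  by apply: openI; apply: open_norm_lt; [exact: Uc_cont|exact: Vc_cont].
have KO q : ~ crv q -> K q <-> O q.
  move=> nq; split.
    move=> kq; split; first by have [] := KB _ kq.
    rewrite /K' -bigcup_seq => -[g gB hg].
    have : g \in [seq g <- B | (col g == 2) && (w g == 0)] by exact: gB.
    rewrite mem_filter => /andP[/andP[/eqP cg /eqP wg] _].
    by apply: nq; case/KP: kq => g' [cg' wg' hg']; apply: (mixed_curve cg' cg hg' hg); rewrite wg.
  case=> -[/= u1 v1] nK'; apply/KP.
  have [g [cg hg]] := cover q; exists g; split=> //; apply/negP => /eqP wg; apply: nK'.
  suff gB : g \in [seq g <- B | (col g == 2) && (w g == 0)] by rewrite /K' -bigcup_seq; exists g.
  rewrite mem_filter cg wg !eqxx andTb.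
  case: hg => h1 h2 _; move: u1 v1 h1 h2; rewrite !ler_norml !ltr_norml => u1 v1 h1 h2.
  by apply: BP; rewrite -(ler_int R) !intrD ?rmorphN /=; lra.
have cc := @component_connected _ (~` crv) p.
have sub := @connected_component_sub _ (~` crv) p.
have E : comp p `&` K = comp p.
  apply: cc.
  - by exists p; split; [apply: connected_component_refl|apply/KP; exists f].
  - by exists O => //; apply/seteqP; split=> q [cq]; [move=> /(KO q (sub _ cq))|move=> /(KO q (sub _ cq))].
  - by exists K.
apply: (@bounded_coord _ _ N%:~R) => q; rewrite -E => -[_ /KB[h1 h2]].
by split; apply: ltW.
Qed.

Lemma comp_cen p f : col f = 2 -> Hx f p -> ~ crv p -> comp p (cen R f).
Proof.
move=> cf hf np; apply: line_component => q [s]; rewrite /= in_itv /= => /andP[s0 s1] <-.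
have [->|sn] := eqVneq s 0; first by rewrite subr0 scale1r scale0r addr0.
move=> /curve_nHi /(_ cf); apply; apply: Hi_seg => //.
by rewrite lt_neqAle eq_sym sn s0.
Qed.

(** The path goes from one centre to the other through the midpoint of the common edge, which
    [mid_hex] keeps off the curve. *)
Lemma comp_adj f g : face_adj zP f g -> comp (cen R f) (cen R g).
Proof.
case=> t [a [ca nZ H]].
have key : comp (cen R (Lf t a)) (cen R (Rf t a)).
  pose m := (1 - 1 / 2) *: cen R a + (1 / 2 : R) *: cen R (sh t a).
  have sm : segP a (sh t a) m by exists (1 / 2) => //; rewrite /= in_itv /=; lra.
  have [hL hR] := edge_Hx sm.
  have nm : ~ crv m.
    case/curveP=> t' [a' [ca' Z' h]]; have [hL' hR'] := edge_Hx h.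
    have mU : Uc m = (a.1%:~R + (sh t a).1%:~R) / 2 by rewrite Uc_conv !Uc_cen; move: _%:~R _%:~R => x y; lra.
    have mV : Vc m = (a.2%:~R + (sh t a).2%:~R) / 2 by rewrite Vc_conv !Vc_cen; move: _%:~R _%:~R => x y; lra.
    have e1 := mid_hex ca (col_Lf t' ca') mU mV hL'.
    have e2 := mid_hex ca (col_Rf t' ca') mU mV hR'.
    have ne := Lf_Rf t' a'.
    have [et ea] : t' = t /\ a' = a.
      apply: sides_inj; case: e1 e2 ne => -> [] ->; rewrite ?eqxx //; auto.
    by rewrite et ea (negPf nZ) in Z'.
  apply: connected_component_trans (comp_cen (col_Rf t ca) hR nm).
  by apply: connected_component_sym; exact: comp_cen (col_Lf t ca) hL nm.
by case: H => -[-> ->] //; exact: connected_component_sym.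
Qed.

(** By [jordan] and [far_reach] an outside face reaches faces arbitrarily far to the right, and by
    [comp_adj] their centres are in the component of [p]. *)
Lemma comp_unbounded p f : col f = 2 -> w f = 0 -> Hx f p -> ~ crv p -> ~ bounded_set (comp p).
Proof.
move=> cf wf hf np /bounded_Vc[M hM].
have [sg [_ _ _ J]] := jordan z2 zU zC.
have [g fg [farg cg]] := J _ cf wf.
have [g' [cg' gg' _ Mg]] := far_reach (Num.ceil M + 1) cg farg.
have fg' := reach_trans fg gg'.
have : comp p (cen R g').
  apply: (fg' (fun x => comp p (cen R x))); last exact: comp_cen.
  by move=> x y /comp_adj xy px; exact: connected_component_trans px xy.
move=> /hM; rewrite Vc_cen.
have := Num.Theory.ceil_ge M; rewrite -(ler_int R) intrD /= in Mg.
rewrite ler_norml; lra.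
Qed.

(** An edge between two outside faces is excluded by its midpoint, which is neither on the curve nor
    in a bounded component. *)
Lemma benz_set e : (hex_edge e /\ @segment R e.1 e.2 `<=` crv `|` inside z) <->
  exists t, [/\ up_step t (kap e.1) (kap e.2) & (w (Lf t (kap e.1)) != 0) || (w (Rf t (kap e.1)) != 0)].
Proof.
case: e => u v /=; split.
  case=> /hex_edgeP[t us] sub; exists t; split=> //; case/andP: (us) => /eqP ca /eqP e.
  apply/negPn/negP; rewrite negb_or !negbK => /andP[/eqP wL /eqP wR].
  pose m := (1 - 1 / 2) *: cen R (kap u) + (1 / 2 : R) *: cen R (kap v).
  have sm : segP (kap u) (kap v) m by exists (1 / 2) => //; rewrite /= in_itv /=; lra.
  have : (crv `|` inside z) m by apply: sub; rewrite segment_segP.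
  rewrite e in sm; have [hL hR] := edge_Hx sm.
  case=> [|[nm]]; last exact: (comp_unbounded (col_Lf t ca) wL hL nm).
  case/curveP=> t' [a' [ca' Z' h]].
  have mU : Uc m = ((kap u).1%:~R + (sh t (kap u)).1%:~R) / 2 by rewrite Uc_conv !Uc_cen -e; move: _%:~R _%:~R => x y; lra.
  have mV : Vc m = ((kap u).2%:~R + (sh t (kap u)).2%:~R) / 2 by rewrite Vc_conv !Vc_cen -e; move: _%:~R _%:~R => x y; lra.
  have [hL' hR'] := edge_Hx h.
  have e1 := mid_hex ca (col_Lf t' ca') mU mV hL'.
  have e2 := mid_hex ca (col_Rf t' ca') mU mV hR'.
  have [w1 w2] : w (Lf t' a') = 0 /\ w (Rf t' a') = 0 by case: e1 e2 => -> [] ->.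
  by have := winding_on_edge z2 zU zC ca' Z'; rewrite w1 w2 => -[].
case=> t [us H]; split; first by apply/hex_edgeP; exists t.
case/andP: us => /eqP ca /eqP e; rewrite segment_segP e => p /edge_Hx[hL hR].
have [cp|np] := pselect (crv p); [by left|right; split=> //].
by case/orP: H => wf; [exact: (comp_bounded (col_Lf t ca) wf hL np)|exact: (comp_bounded (col_Rf t ca) wf hR np)].
Qed.

Lemma benzP e : (e \in benzenoid R z) <->
  exists t, up_step t (kap e.1) (kap e.2) /\ inG zP t (kap e.1).
Proof.
rewrite /benzenoid in_fset_set; last first.
  (* Finiteness of the set, without which [fset_set] would be empty: inside faces are confined to a
     box, and with them the ends of their edges. *)
  have [M hM] := winding_bounded z2 zU zC.
  have [N [B0 [hB BP]]] := box_ex M.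
  pose Bt t := [seq (ikap a, ikap (sh t a)) | a <- B0].
  pose B := Bt T0 ++ Bt T1 ++ Bt T2.
  apply: (@sub_finite_set _ _ [set` B]); last exact: finite_seq.
  move=> [u v] /benz_set [t [/andP[/eqP ca /eqP e0] H]]; rewrite [kap _]/= in ca e0 H.
  suff : (u, v) \in B by [].
  have uB : kap u \in B0.
    case/orP: H => wf; [have := hB _ (hM _ (col_Lf t ca) wf)|have := hB _ (hM _ (col_Rf t ca) wf)];
      rewrite /Lf /Rf /us; move: (kap u) => [x y] /= [b1 b2 b3 b4]; apply: BP => /=;
      move: b1 b2 b3 b4; case: (t) => /=; clear; lia.
  have uvB s : t = s -> (u, v) \in Bt s.
    by move=> <-; apply/mapP; exists (kap u) => //; rewrite -e0 !kapK.
  rewrite !mem_cat; case et : t; apply/or3P; [constructor 1|constructor 2|constructor 3]; exact: uvB.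
rewrite inE /=; split=> [/benz_set [t [us H]]|[t [us H]]].
  by exists t; split=> //; rewrite /inG; case/andP: us => ->.
by apply/benz_set; exists t; split=> //; case/andP: H.
Qed.

Definition Ez : {fset pt * pt} := map_edges kap (benzenoid R z).

Lemma EzP t a : (ed t a \in Ez) = inG zP t a.
Proof.
apply/imfsetP/idP => /= [[[u v] /benzP[t' [/andP[ca /eqP e] H]] E0]|ia].
  have ea : a = kap u := congr1 fst E0; have es : sh t a = kap v := congr1 snd E0.
  rewrite /= in e H; rewrite e -ea in es; have := congr1 (dir_of a) es.
  by rewrite !dir_of_sh => ->; rewrite ea.
have ca := inG_col ia; have cs : col (sh t a) = 1 by rewrite col_sh ca.
exists (ikap a, ikap (sh t a)); last by rewrite /map_edge /= !ikapK; auto.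
by apply/benzP; exists t; rewrite /= !ikapK /up_step ?ca ?eqxx; auto.
Qed.

Lemma Ez_ed e : e \in Ez -> exists t a, e = ed t a.
Proof.
case/imfsetP=> /= [[u v] /benzP[t [/andP[_ /eqP e1] _]] ->].
by exists t, (kap u); rewrite /map_edge /ed -e1.
Qed.

Lemma Sz_Ez : Sz_e Ez = Sz_e (benzenoid R z).
Proof. by apply: Sz_e_map; exact: can_inj kapK. Qed.

End Region.

Local Open Scope ring_scope.

(** * The input format, the word size and the final assembly *)

Lemma nth_input (z : seq vertex) k : (k < size z)%N ->
  nth 0 (flatten [seq [:: v.1; v.2] | v <- z]) (2 * k) = (nth (0, 0) z k).1 /\
  nth 0 (flatten [seq [:: v.1; v.2] | v <- z]) (2 * k + 1) = (nth (0, 0) z k).2.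
Proof.
elim: z k => // v z IH [|k] kz; first by [].
by have [<- <-] := IH k kz; rewrite (_ : 2 * k.+1 = (2 * k).+2)%N ?mulnS.
Qed.

Lemma size_input (z : seq vertex) : size (flatten [seq [:: v.1; v.2] | v <- z]) = (2 * size z)%N.
Proof. by elim: z => //= v z ->; rewrite mulnS. Qed.

Lemma kap_sh t (v v' : vertex) : kap v' = sh t (kap v) ->
  v'.1 - v.1 = match t with T0 => 0 | T1 => 1 | T2 => -1 end /\
  v'.2 - v.2 = match t with T0 => 1 | _ => 0 end.
Proof.
case: v v' => x y [x' y']; rewrite /kap /sh; case: t => /= -[]; clear; lia.
Qed.

(** The largest number to fit is the total of the accumulators, below [7200 * n ^ 6]. For [n] at
    least 3 the constant is absorbed by [n ^ 9], as [3 ^ 9] is 19683; this gives the exponent 15. *)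
Lemma word_bound_ge n m : (2 < n)%N -> (n <= m)%N -> [/\ 2000 * n + 2000 <= m ^ 15, 100 * n * n <= m ^ 15 &
  3 * ((3 * n + 1) * (600 * n ^ 5)) <= m ^ 15]%N.
Proof.
move=> n3 nm; have h : (n ^ 15 <= m ^ 15)%N by rewrite leq_exp2r.
have h9 : (4 * 1800 <= n ^ 9)%N by apply: (@leq_trans (3 ^ 9)); rewrite ?leq_exp2r.
have h6 : (4 * 1800 * n ^ 6 <= n ^ 15)%N by rewrite -[15%N]/(9 + 6)%N expnD leq_mul2r h9 orbT.
have e6 : (n ^ 6 = n * n ^ 5)%N by rewrite expnS.
have e5 : (n * n ^ 4 = n ^ 5)%N by rewrite expnS.
have p4 : (0 < n ^ 4)%N by rewrite expn_gt0; clear -n3; lia.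
move: (n ^ 15)%N (m ^ 15)%N h h6 => x y h h6; rewrite e6 in h6.
have n5 : (n <= n ^ 5)%N by rewrite -e5; apply: leq_pmulr.
move: (n ^ 5)%N n5 h6 => q n5 h6; clear -h h6 n5 n3.
have h1 : (n * n <= n * q)%N by rewrite leq_mul2l n5 orbT.
have h2 : (3 * n <= n * n)%N by rewrite leq_mul2r n3 orbT.
have e1 : (3 * ((3 * n + 1) * (600 * q)) = 3 * 1800 * (n * q) + 1800 * q)%N by ring.
have h3 : (3 * q <= n * q)%N by rewrite leq_mul2r n3 orbT.
rewrite e1 -mulnA; move: (n * q)%N (n * n)%N h1 h2 h3 h6 => a b h1 h2 h3 h6.
clear e1; split; lia.
Qed.

Theorem theorem4p7 (R : realType) :
  exists (p : cmd) (c k : nat),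
    forall z : seq vertex, hex_cycle z ->
      exists (s : state) (t : nat),
        [/\ exec (word_bound k z) p (input_state z) s t,
            (t <= c * size z)%N
          & output s = Posz (Sz_e (benzenoid R z))].
Proof.
(* The longest loop makes [3 * n + 1] rounds, at most [4 * n], and [tbound_flat1] turns this into
   the factor 4. The registers from 24 on serve to evaluate expressions. *)
exists (compile 24 main), (4 * tbound 1 main)%N, 15%N => z hz.
have [z2 zU zC] := hex_cycle_kap hz.
set zP := map kap z in z2 zU zC.
have szP : size zP = size z by rewrite size_map.
have [sg [sg1 wsg _ _]] := jordan z2 zU zC.
have inGP := EzP R hz.
have E_ed := @Ez_ed R z hz.
set n := size z in szP *.
pose vs k := nth ((0, 0) : vertex) z (k %% n).
have n3 : (2 < n)%N by rewrite -szP.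
have n0 : (0 < n)%N by apply: leq_trans n3.
have znE k : zn zP k = kap (vs k).
  by rewrite /zn szP (nth_map ((0, 0) : vertex)) // ltn_mod.
have [B1 B2 B3] := @word_bound_ge n (size z + \max_(v <- z) maxn `|v.1| `|v.2|) n3 (leq_addr _ _).
rewrite -/(word_bound 15 z) in B1 B2 B3.
have HL : (3 * n + 1 <= 4 * n)%N by clear -n3; lia.
have sgs := sk1 z2 zU zC.
have [sf rE] : ok (word_bound 15 z) (4 * n) main (input_state z)
   (fun s' => reg s' 0 = dir_part n (step_type zP) (step_left_in zP) (step_term zP (Ez R z)) 0 +
      dir_part n (step_type zP) (step_left_in zP) (step_term zP (Ez R z)) 1 + dir_part n (step_type zP) (step_left_in zP) (step_term zP (Ez R z)) 2).
  have ty3 k : (step_type zP k < 3)%N by rewrite /step_type; case: step_dir.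
  have n0' : (0 < n)%N := n0.
  (* This supplies the vertical step from which the prelude finds the colour of the first vertex. *)
  have [a ca [Za _]] := rightmost z2 zU zC.
  have [k0 [k0n tk0 _]] := Z_index ca Za.
  have pair t := link_paired z2 zU zC inGP E_ed sg1 wsg t.
  rewrite szP in pair k0n.
  apply: (@main_ok n (sk zP) (step_type zP) sgs ty3 (word_bound 15 z) (4 * n) B1 B2 HL n0 _ _ _
     (fun k => (vs k).1) (fun k => (vs k).2)).
  - exact: skS.
  - move=> k kn.
    have := zn_step z2 zU zC k; rewrite /step_type !znE; case=> -[-> _ e _ _]; have [e1 e2] := kap_sh e.
      by case: (step_dir zP k) e1 e2 => e1 e2; [constructor 1|constructor 2|constructor 3].
    case: (step_dir zP k) e1 e2 => e1 e2; [constructor 1|constructor 2|constructor 3]; split=> //;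
    by move: e1 e2; clear; lia.
  - by exists k0 => //; apply/eqP; rewrite (step_typeE zP T0).
  - by [].
  - by move=> r /eqP r0; rewrite /= (negPf r0).
  - by move=> k kn; rewrite /vs modn_small //; exact: nth_input.
  - by rewrite /vs modnn mod0n.
  - by rewrite /vs modnn mod0n.
  - by move=> b hb; rewrite /= nth_default // size_input.
  - exact: (pair T0).
  - exact: (pair T1).
  - exact: (pair T2).
  - have -> : n%:Z ^+ 5 = (n ^ 5)%N%:Z by rewrite -[n%:Z]natz -natrX natz.
    by move: B3; clear; move: (n ^ 5)%N => q; lia.
have ini : sim 24 (input_state z) (input_state z) by [].
have [t' [c [ex tc st]]] := compile_ok main_wf sf ini.
exists t', c; split=> //.
- apply: leq_trans tc _; apply: leq_trans (tbound_flat1 _ main_flat) _; first by rewrite muln_gt0.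
  by rewrite mulnAC.
- rewrite /output; case: st => -> // _; rewrite rE -szP -(Sz_parts z2 zU zC inGP E_ed sg1 wsg).
  by rewrite Sz_Ez.
Qed.
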